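(* Let $n\ge1$ and let $a_{1,1},\dots,a_{1,n},a_0\in\mathcal G(\mathbb R^{n+1})$ be Colombeau generalised functions of $(t,x)\in\mathbb R\times\mathbb R^n$. Consider the Cauchy problem $$D_tb=\sum_{j=1}^na_{1,j}(t,x)D_jb+a_0(t,x)b,\qquad b(0,\cdot)=1.\quad( * )$$ (i) Assume that the $a_{1,j}$ are real valued, compactly supported with respect to $x$, with $\partial_{x_k}a_{1,j}$ of logarithmic type for $k,j=1,\dots,n$, and that $a_0$ is compactly supported in $x$ and of logarithmic type. Then there exists a unique solution $b\in\mathcal G(\mathbb R^{n+1})$ of $( * )$. (ii) Assume that the $a_{1,j}$ are real valued, slow scale regular, compactly supported with respect to $x$, with $\partial_{x_k}a_{1,j}$ of slow scale logarithmic type for $k,j=1,\dots,n$, and that $a_0$ is slow scale regular, compactly supported in $x$ and of slow scale logarithmic type. Then the solution $b\in\mathcal G(\mathbb R^{n+1})$ of $( * )$ is slow scale regular. (iii) Further, $b(t,x)=e^{i\beta(t,x)}$ with $$\beta(t,x)=\int_0^ta_0(s,\gamma_1(x,t,s),\dots,\gamma_n(x,t,s))\,ds,$$ where $\gamma=(\gamma_1,\dots,\gamma_n)$ is the characteristic curve.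
   Context: $D_t=-i\partial_t$, $D_j=-i\partial_{x_j}$. Nets are indexed by $\varepsilon\in(0,1]$ and $O(\cdot)$ refers to $\varepsilon\to0$. $\mathcal G(\mathbb R^d)=\mathcal E_M(\mathbb R^d)/\mathcal N(\mathbb R^d)$ is the Colombeau algebra: $\mathcal E_M$ consists of nets $(u_\varepsilon)_\varepsilon$ in $C^\infty(\mathbb R^d)$ such that for all compact $K$ and all $\alpha$ there is $N\in\mathbb N$ with $\sup_K|\partial^\alpha u_\varepsilon|=O(\varepsilon^{-N})$; $\mathcal N$ consists of those nets with $\sup_K|\partial^\alpha u_\varepsilon|=O(\varepsilon^q)$ for all compact $K$, all $\alpha$, all $q\in\mathbb N$. Operations (products, derivatives, integrals, compositions) are performed on representatives, and equations are equalities in $\mathcal G$. A slow scale net is a net $(\mu_\varepsilon)_\varepsilon$ in $\mathbb C$ with $|\mu_\varepsilon|^q=O(\varepsilon^{-1})$ for all $q\ge0$. An element $u\in\mathcal G(\mathbb R^d)$ is: real valued if it has a representative of real valued functions; of logarithmic type if it has a representative with $\sup_K|u_\varepsilon|=O(\log(\varepsilon^{-1}))$ for all compact $K$; of slow scale logarithmic type if it has a representative such that for every compact $K$ there is a slow scale net $(\mu_\varepsilon)$ with $\sup_K|u_\varepsilon|=O(\log\mu_\varepsilon)$; slow scale regular if it has a representative such that for every compact $K$ and every $\alpha$ there is a slow scale net $(\mu_\varepsilon)$ with $\sup_K|\partial^\alpha u_\varepsilon|=O(\mu_\varepsilon)$. A generalised function of $(t,x)$ is compactly supported in $x$ if its support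 is contained in $\mathbb R\times K$ for some compact $K\subset\mathbb R^n$. The characteristic curve $\gamma_h=\gamma_h(x,t,s)\in\mathcal G(\mathbb R^{n+2})$ is the unique solution of $\frac{d}{ds}\gamma_h(x,t,s)=-a_{1,h}(s,\gamma_1(x,t,s),\dots,\gamma_n(x,t,s))$, $\gamma_h(x,t,t)=x_h$, $h=1,\dots,n$ (known to be well-posed under the hypotheses of (i) on the $a_{1,j}$). *)

(* Defs.v *)
From HB Require Import structures.
From mathcomp Require Import all_boot all_order all_algebra.
From mathcomp Require Import ring_quotient complex.
From mathcomp Require Import all_classical all_reals all_analysis.
From mathcomp Require Import ring lra.
Import Order.TTheory GRing.Theory Num.Theory numFieldNormedType.Exports.
Import ComplexField.

Set Implicit Arguments.
Unset Strict Implicit.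
Unset Printing Implicit Defensive.

Local Open Scope classical_set_scope.
Local Open Scope ring_scope.

(* C = R[i] carries no normed R-module structure in the libraries: functions
   into R[i] are differentiated and integrated componentwise, and the modulus
   is Normc.normc : R[i] -> R. *)

Section SmoothFunctions.
Context {R : realType} {d : nat}.
Implicit Types f g : 'rV[R]_d -> R[i].

Definition cdifferentiable f x :=
  differentiable (fun y => complex.Re (f y)) x /\
  differentiable (fun y => complex.Im (f y)) x.

Definition partial (j : 'I_d) f : 'rV[R]_d -> R[i] := fun x =>
  Complex ('D_(delta_mx 0 j) (fun y => complex.Re (f y)) x)
          ('D_(delta_mx 0 j) (fun y => complex.Im (f y)) x).

(* A multi-index is given as a list of directions. *)
Definition ipartial (s : seq 'I_d) f := foldl (fun g j => partial j g) f s.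

Definition smooth f := forall s x, cdifferentiable (ipartial s f) x.

Lemma partial_cst j (c : R[i]) : partial j (fun=> c) = fun=> 0.
Proof.
by apply/funext => x; rewrite /partial (derive_cst (complex.Re c)) (derive_cst (complex.Im c)).
Qed.

Let ReD (z w : R[i]) : complex.Re (z + w) = complex.Re z + complex.Re w.
Proof. by case: z => ? ?; case: w. Qed.
Let ImD (z w : R[i]) : complex.Im (z + w) = complex.Im z + complex.Im w.
Proof. by case: z => ? ?; case: w. Qed.
Let ReM (z w : R[i]) : complex.Re (z * w) =
  complex.Re z * complex.Re w - complex.Im z * complex.Im w.
Proof. by case: z => ? ?; case: w. Qed.
Let ImM (z w : R[i]) : complex.Im (z * w) =
  complex.Re z * complex.Im w + complex.Im z * complex.Re w.
Proof. by case: z => ? ?; case: w. Qed.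

Let ReDf f g : (fun y => complex.Re (f y + g y)) =
  (fun y => complex.Re (f y)) + (fun y => complex.Re (g y)).
Proof. by apply/funext => y; rewrite ReD. Qed.
Let ImDf f g : (fun y => complex.Im (f y + g y)) =
  (fun y => complex.Im (f y)) + (fun y => complex.Im (g y)).
Proof. by apply/funext => y; rewrite ImD. Qed.
Let ReMf f g : (fun y => complex.Re (f y * g y)) =
  (fun y => complex.Re (f y)) * (fun y => complex.Re (g y)) -
  (fun y => complex.Im (f y)) * (fun y => complex.Im (g y)).
Proof. by apply/funext => y; rewrite ReM. Qed.
Let ImMf f g : (fun y => complex.Im (f y * g y)) =
  (fun y => complex.Re (f y)) * (fun y => complex.Im (g y)) +
  (fun y => complex.Im (f y)) * (fun y => complex.Re (g y)).
Proof. by apply/funext => y; rewrite ImM. Qed.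

Lemma cdifferentiable_cst (c : R[i]) x : cdifferentiable (fun=> c) x.
Proof. by split; exact: differentiable_cst. Qed.

Lemma cdifferentiableD f g x : cdifferentiable f x -> cdifferentiable g x ->
  cdifferentiable (fun y => f y + g y) x.
Proof.
by move=> [f1 f2] [g1 g2]; split; rewrite ?ReDf ?ImDf; exact: differentiableD.
Qed.

Lemma cdifferentiableM f g x : cdifferentiable f x -> cdifferentiable g x ->
  cdifferentiable (fun y => f y * g y) x.
Proof.
move=> [f1 f2] [g1 g2]; split; rewrite ?ReMf ?ImMf.
  by apply: differentiableB; exact: differentiableM.
by apply: differentiableD; exact: differentiableM.
Qed.

Lemma partialD j f g : (forall x, cdifferentiable f x) ->
  (forall x, cdifferentiable g x) ->
  partial j (fun y => f y + g y) = fun y => partial j f y + partial j g y.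
Proof.
move=> df dg; apply/funext => x; have [f1 f2] := df x; have [g1 g2] := dg x.
rewrite /partial ReDf ImDf !deriveD; try exact: diff_derivable.
by [].
Qed.

Let ReBf f g : (fun y => complex.Re (f y - g y)) =
  (fun y => complex.Re (f y)) - (fun y => complex.Re (g y)).
Proof. by apply/funext => y; rewrite !fctE; case: (f y); case: (g y). Qed.
Let ImBf f g : (fun y => complex.Im (f y - g y)) =
  (fun y => complex.Im (f y)) - (fun y => complex.Im (g y)).
Proof. by apply/funext => y; rewrite !fctE; case: (f y); case: (g y). Qed.

Lemma partialB j f g :
  (forall x, cdifferentiable f x) -> (forall x, cdifferentiable g x) ->
  partial j (fun y => f y - g y) = fun y => partial j f y - partial j g y.
Proof.
move=> df dg; apply/funext => x; have [f1 f2] := df x; have [g1 g2] := dg x.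
rewrite /partial ReBf ImBf !deriveB; try exact: diff_derivable.
by [].
Qed.

Lemma partialM j f g : (forall x, cdifferentiable f x) ->
  (forall x, cdifferentiable g x) ->
  partial j (fun y => f y * g y) =
  fun y => partial j f y * g y + f y * partial j g y.
Proof.
move=> df dg; apply/funext => x; have [f1 f2] := df x; have [g1 g2] := dg x.
rewrite /partial ReMf ImMf deriveB ?deriveD ?deriveM;
  try (by apply: diff_derivable => //; exact: differentiableM).
case: (f x) => fr fi; case: (g x) => gr gi /=.
rewrite /GRing.scale /=.
by congr Complex; rewrite /=; ring.
Qed.

End SmoothFunctions.

Section LinearChangeOfVariables.
Context {R : realType} {m d : nat}.
Variable L : {linear 'rV[R]_m -> 'rV[R]_d}.

Lemma rV_sum_delta n (v : 'rV[R]_n) : v = \sum_k v 0 k *: delta_mx 0 k.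
Proof. exact: row_sum_delta. Qed.

Lemma linear_rV_continuous : continuous L.
Proof.
have -> : L = (fun v : 'rV[R]_m => \sum_k v 0 k *: L (delta_mx 0 k)) :> (_ -> _).
  apply/funext => v; rewrite {1}(rV_sum_delta v) linear_sum.
  by apply: eq_bigr => k _; rewrite linearZ.
elim: (index_enum _) => [|k r IH].
  rewrite (_ : (fun _ => _) = fun=> 0); first exact: cst_continuous.
  by apply/funext => v; rewrite big_nil.
rewrite (_ : (fun _ => _) = (fun v : 'rV[R]_m => v 0 k *: L (delta_mx 0 k)) +
    (fun v => \sum_(i <- r) v 0 i *: L (delta_mx 0 i))).
  move=> v; apply: continuousD; last exact: IH.
  apply: continuousZr_tmp; exact: (@coord_continuous R 1 m 0 k v).
by apply/funext => v; rewrite big_cons.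
Qed.

Lemma derive_linear (f : 'rV[R]_d -> R) x v :
  'D_v (fun y => f (L y)) x = 'D_(L v) f (L x).
Proof.
rewrite /derive /=.
suff -> : (fun h : R => h^-1 *: (f (L (shift x (h *: v))) - f (L x))) =
          (fun h : R => h^-1 *: (f (shift (L x) (h *: L v)) - f (L x))) by [].
apply/funext => h; rewrite /shift /=.
by have -> : L (h *: v + x) = h *: L v + L x by exact: linearP.
Qed.

Lemma derive_sum_delta (f : 'rV[R]_d -> R) y w : differentiable f y ->
  'D_w f y = \sum_k w 0 k * 'D_(delta_mx 0 k) f y.
Proof.
move=> df; rewrite deriveE // {1}(rV_sum_delta w) linear_sum.
by apply: eq_bigr => k _; rewrite linearZ deriveE.
Qed.

Lemma cdifferentiable_linear (f : 'rV[R]_d -> R[i]) x :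
  cdifferentiable f (L x) -> cdifferentiable (fun y => f (L y)) x.
Proof.
have dL : differentiable L x by apply: linear_differentiable; exact: linear_rV_continuous.
move=> [f1 f2]; split; first exact: (differentiable_comp dL f1).
exact: (differentiable_comp dL f2).
Qed.

Lemma partial_linear j (f : 'rV[R]_d -> R[i]) :
  (forall x, cdifferentiable f x) ->
  partial j (fun y => f (L y)) =
  fun y => \sum_k (L (delta_mx 0 j) 0 k)%:C%C * partial k f (L y).
Proof.
move=> df; apply/funext => x; have [f1 f2] := df (L x).
rewrite /partial (derive_linear (fun y => complex.Re (f y)))
  (derive_linear (fun y => complex.Im (f y))) !derive_sum_delta //.
elim/big_rec3: _ => // k a b c _ <-.
have -> (r u v : R) : r%:C%C * Complex u v = Complex (r * u) (r * v).
  by rewrite [LHS]/GRing.mul /= !mul0r subr0 addr0.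
by [].
Qed.

End LinearChangeOfVariables.

(* The index set (0,1] of nets. *)
Definition eps_index (R : realType) := {e : R | 0 < e <= 1}.

HB.instance Definition _ (R : realType) := Choice.on (eps_index R).
Lemma eps_index_one (R : realType) : 0 < (1 : R) <= 1.
Proof. by rewrite ltr01 lexx. Qed.
HB.instance Definition _ (R : realType) :=
  isPointed.Build (eps_index R) (exist _ 1 (@eps_index_one R)).

Definition net (R : realType) (d : nat) := eps_index R -> 'rV[R]_d -> R[i].

HB.instance Definition _ (R : realType) (d : nat) :=
  GRing.ComNzRing.on (net R d).

Section ModerateNets.
Context {R : realType} {d : nat}.
Implicit Types (u v w : net R d) (K : set 'rV[R]_d) (s : seq 'I_d).

(* sup_K |u_e| = O(g_e) as e -> 0.  The bound g_e is deliberately not wrapped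
   in an absolute value, see slow_scale_log_type. *)
Definition O_on K u (g : eps_index R -> R) := exists C eta : R,
  [/\ 0 < C, 0 < eta & forall e : eps_index R, sval e < eta ->
    forall x, K x -> Normc.normc (u e x) <= C * g e].

Definition npartial (j : 'I_d) u : net R d := fun e => partial j (u e).

Definition nipartial s u : net R d := fun e => ipartial s (u e).

Definition moderate u := (forall e, smooth (u e)) /\
  forall K s, compact K ->
    exists N : nat, O_on K (nipartial s u) (fun e => sval e ^- N).

Let ndiff u := forall e x, cdifferentiable (u e) x.

(* Smooth nets all of whose derivatives satisfy B. *)
Definition all_derivatives (B : net R d -> Prop) u :=
  (forall e, smooth (u e)) /\ forall s, B (nipartial s u).

Lemma all_derivatives_coind (P B : net R d -> Prop) :
  (forall u, P u -> [/\ ndiff u, B u & forall j, P (npartial j u)]) ->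
  forall u, P u -> all_derivatives B u.
Proof.
move=> PB u Pu; split=> [e s x|s].
  elim: s u Pu => [|j s IH] u Pu; first by have [+ _ _] := PB _ Pu; exact.
  by apply: (IH (npartial j u)); have [_ _] := PB _ Pu; exact.
elim: s u Pu => [|j s IH] u Pu; first by have [] := PB _ Pu.
by apply: (IH (npartial j u)); have [_ _] := PB _ Pu; exact.
Qed.

Lemma all_derivatives_diff B u : all_derivatives B u -> ndiff u.
Proof. by move=> [su _] e x; exact: (su e [::] x). Qed.

Lemma all_derivatives_nil B u : all_derivatives B u -> B u.
Proof. by move=> [_ Bu]; exact: (Bu [::]). Qed.

Lemma all_derivatives_partial B u j :
  all_derivatives B u -> all_derivatives B (npartial j u).
Proof.
by move=> [su Bu]; split=> [e s x|s]; [exact: (su e (j :: s) x)|exact: (Bu (j :: s))].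
Qed.

Lemma npartialD j u v : ndiff u -> ndiff v ->
  npartial j (u + v) = npartial j u + npartial j v.
Proof.
by move=> du dv; apply/funext => e; exact: (partialD j (du e) (dv e)).
Qed.

Lemma npartialM j u v : ndiff u -> ndiff v ->
  npartial j (u * v) = npartial j u * v + u * npartial j v.
Proof.
by move=> du dv; apply/funext => e; exact: (partialM j (du e) (dv e)).
Qed.

Lemma ndiffD u v : ndiff u -> ndiff v -> ndiff (u + v).
Proof. by move=> du dv e x; exact: cdifferentiableD. Qed.

Lemma ndiffM u v : ndiff u -> ndiff v -> ndiff (u * v).
Proof. by move=> du dv e x; exact: cdifferentiableM. Qed.

Lemma all_derivativesD (B : net R d -> Prop) u v :
  (forall u v, B u -> B v -> B (u + v)) ->
  all_derivatives B u -> all_derivatives B v -> all_derivatives B (u + v).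
Proof.
move=> BD Bu Bv.
apply: (@all_derivatives_coind (fun w => exists u v,
  [/\ all_derivatives B u, all_derivatives B v & w = u + v])); last by exists u, v.
move=> {u v Bu Bv} _ [u [v [Bu Bv ->]]].
have [du dv] := (all_derivatives_diff Bu, all_derivatives_diff Bv).
split; first exact: ndiffD.
  by apply: BD; exact: all_derivatives_nil.
move=> j; exists (npartial j u), (npartial j v).
by rewrite npartialD //; split=> //; exact: all_derivatives_partial.
Qed.

Inductive sum_of_products (B1 B2 : net R d -> Prop) : net R d -> Prop :=
| sum_of_products_mul u v of all_derivatives B1 u & all_derivatives B2 v :
    sum_of_products B1 B2 (u * v)
| sum_of_products_add u v of sum_of_products B1 B2 u & sum_of_products B1 B2 v :
    sum_of_products B1 B2 (u + v).

Lemma all_derivativesM (B1 B2 B3 : net R d -> Prop) u v :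
  (forall u v, B3 u -> B3 v -> B3 (u + v)) ->
  (forall u v, B1 u -> B2 v -> B3 (u * v)) ->
  all_derivatives B1 u -> all_derivatives B2 v -> all_derivatives B3 (u * v).
Proof.
move=> BD BM B1u B2v.
apply: (@all_derivatives_coind (sum_of_products B1 B2)); last exact: sum_of_products_mul.
move=> {u v B1u B2v} w; elim=> {w} [u v Bu Bv|u v _ [du Bu Pu] _ [dv Bv Pv]].
  have [du dv] := (all_derivatives_diff Bu, all_derivatives_diff Bv).
  split; first exact: ndiffM.
    by apply: BM; exact: all_derivatives_nil.
  move=> j; rewrite npartialM //; apply: sum_of_products_add;
    by apply: sum_of_products_mul => //; exact: all_derivatives_partial.
split; [exact: ndiffD|exact: BD|].
by move=> j; rewrite npartialD //; exact: sum_of_products_add.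
Qed.

Lemma eps_gt0 (e : eps_index R) : 0 < sval e.
Proof. by case: e => e /= /andP[]. Qed.

Lemma eps_le1 (e : eps_index R) : sval e <= 1.
Proof. by case: e => e /= /andP[]. Qed.

Lemma normcD (z w : R[i]) : Normc.normc (z + w) <= Normc.normc z + Normc.normc w.
Proof. exact: le_normcD. Qed.

Lemma normc_ge0 (z : R[i]) : 0 <= Normc.normc z.
Proof. by case: z => a b /=; exact: sqrtr_ge0. Qed.

Lemma O_onD K u v g : O_on K u g -> O_on K v g -> O_on K (u + v) g.
Proof.
move=> [C [eta [C0 eta0 H]]] [C' [eta' [C'0 eta'0 H']]].
exists (C + C'), (Order.min eta eta'); split; [exact: addr_gt0|by rewrite lt_min eta0|].
move=> e; rewrite lt_min => /andP[e1 e2] x Kx.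
by rewrite mulrDl (le_trans (normcD _ _)) // lerD ?H ?H'.
Qed.

Lemma O_onM K u v g h : O_on K u g -> O_on K v h ->
  O_on K (u * v) (fun e => g e * h e).
Proof.
move=> [C [eta [C0 eta0 H]]] [C' [eta' [C'0 eta'0 H']]].
exists (C * C'), (Order.min eta eta'); split; [exact: mulr_gt0|by rewrite lt_min eta0|].
move=> e; rewrite lt_min => /andP[e1 e2] x Kx.
rewrite [(u * v) e x]/(u e x * v e x) Normc.normcM mulrACA.
by rewrite ler_pM ?normc_ge0 // ?H ?H'.
Qed.

Lemma O_on_le K u g h : (forall e, g e <= h e) -> O_on K u g -> O_on K u h.
Proof.
move=> gh [C [eta [C0 eta0 H]]]; exists C, eta; split=> // e ee x Kx.
by rewrite (le_trans (H e ee x Kx)) // ler_wpM2l // ltW.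
Qed.

Definition moderate0 u := forall K, compact K ->
  exists N : nat, O_on K u (fun e => sval e ^- N).
Definition negligible0 u := forall K, compact K ->
  forall q : nat, O_on K u (fun e => sval e ^+ q).

Lemma moderateE u : moderate u <-> all_derivatives moderate0 u.
Proof.
by split=> -[su H]; split=> //; [move=> s K|move=> K s] => cK; exact: H.
Qed.

Lemma moderate0D u v : moderate0 u -> moderate0 v -> moderate0 (u + v).
Proof.
move=> Mu Mv K cK; have [[N HN] [N' HN']] := (Mu K cK, Mv K cK).
exists (maxn N N'); apply: O_onD.
  apply: O_on_le HN => e.
  by rewrite -!exprVn ler_weXn2l ?leq_maxl // invf_ge1 ?eps_gt0 ?eps_le1.
apply: O_on_le HN' => e.
by rewrite -!exprVn ler_weXn2l ?leq_maxr // invf_ge1 ?eps_gt0 ?eps_le1.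
Qed.

Lemma moderate0M u v : moderate0 u -> moderate0 v -> moderate0 (u * v).
Proof.
move=> Mu Mv K cK; have [[N HN] [N' HN']] := (Mu K cK, Mv K cK).
exists (N + N')%N; apply: O_on_le (O_onM HN HN') => e.
by rewrite exprD invfM.
Qed.

Lemma negligible0D u v : negligible0 u -> negligible0 v -> negligible0 (u + v).
Proof. by move=> Nu Nv K cK q; apply: O_onD; [exact: Nu|exact: Nv]. Qed.

Lemma negligible0M u v : moderate0 u -> negligible0 v -> negligible0 (u * v).
Proof.
move=> Mu Nv K cK q; have [N HN] := Mu K cK.
apply: O_on_le (O_onM HN (Nv K cK (N + q)%N)) => e.
by rewrite exprD mulKf // expf_neq0 // gt_eqF // eps_gt0.
Qed.

Lemma npartial_cst j (c : R[i]) : npartial j (fun _ _ => c) = fun _ _ => 0.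
Proof. by apply/funext => e; rewrite /npartial partial_cst. Qed.

Lemma moderate_cst (c : R[i]) : moderate (fun _ _ => c).
Proof.
apply/moderateE.
apply: (@all_derivatives_coind (fun u => exists c, u = fun _ _ => c)); last by exists c.
move=> {c} _ [c ->]; split=> [e x||j].
- exact: cdifferentiable_cst.
- move=> K cK; exists 0%N, (Normc.normc c + 1), 1.
  by split=> [||e _ x _]; rewrite ?expr0 ?invr1 ?mulr1 ?lerDl ?ler01 // ltr_wpDl ?normc_ge0.
- by rewrite npartial_cst; exists 0.
Qed.

Lemma moderateD u v : moderate u -> moderate v -> moderate (u + v).
Proof.
move=> /moderateE Mu /moderateE Mv; apply/moderateE.
by apply: all_derivativesD => //; exact: moderate0D.
Qed.

Lemma moderateM u v : moderate u -> moderate v -> moderate (u * v).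
Proof.
move=> /moderateE Mu /moderateE Mv; apply/moderateE.
by apply: all_derivativesM Mu Mv; [exact: moderate0D|exact: moderate0M].
Qed.

Lemma moderate_partial j u : moderate u -> moderate (npartial j u).
Proof.
by move=> /moderateE Mu; apply/moderateE; exact: all_derivatives_partial.
Qed.

Definition moderate_pred : {pred net R d} := fun u => `[< moderate u >].

Lemma moderate_subring : subring_closed moderate_pred.
Proof.
have M1 : moderate (-1 : net R d) by exact: (moderate_cst (-1)).
split=> [|u v|u v].
- by apply/asboolP; exact: (moderate_cst 1).
- move=> /asboolP Mu /asboolP Mv; apply/asboolP; rewrite -[- v]mulN1r.
  by apply: moderateD => //; exact: moderateM.
- by move=> /asboolP Mu /asboolP Mv; apply/asboolP; exact: moderateM.
Qed.
HB.instance Definition _ :=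
  GRing.isSubringClosed.Build (net R d) moderate_pred moderate_subring.

End ModerateNets.

Record moderate_net (R : realType) (d : nat) :=
  ModerateNet { net_of :> net R d; _ : net_of \in moderate_pred }.

Section ColombeauAlgebra.
Context {R : realType} {d : nat}.

HB.instance Definition _ := [isSub for @net_of R d].
HB.instance Definition _ := [Choice of moderate_net R d by <:].
HB.instance Definition _ := [SubChoice_isSubComNzRing of moderate_net R d by <:].

Lemma moderate_netP (u : moderate_net R d) : moderate u.
Proof. by case: u => u /= /asboolP. Qed.

Lemma moderate_in (u : net R d) : moderate u -> u \in moderate_pred.
Proof. by move=> Mu; apply/asboolP. Qed.

Definition negligible (u : moderate_net R d) := forall K s (q : nat),
  compact K -> O_on K (nipartial s u) (fun e => sval e ^+ q).

Lemma negligibleE u : negligible u <-> all_derivatives negligible0 u.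
Proof.
split=> [Nu|[_ Nu] K s q cK]; last exact: Nu.
by split=> [|s K cK q]; [case: (moderate_netP u)|exact: Nu].
Qed.

Definition negligible_pred : {pred moderate_net R d} :=
  fun u => `[< negligible u >].

Lemma negligible_ideal : idealr_closed negligible_pred.
Proof.
split.
- apply/asboolP/negligibleE; apply: (@all_derivatives_coind _ _ (eq (fun _ _ => 0))) => //.
  move=> _ <-; split=> [e x|K cK q|j].
  + exact: cdifferentiable_cst.
  + exists 1, 1; split=> // e _ x _.
    by rewrite Normc.normc0 mul1r exprn_ge0 // ltW // eps_gt0.
  + by rewrite npartial_cst.
- apply/negP => /asboolP /(_ [set 0] [::] 1%N (@compact_set1 'rV[R]_d 0)).
  move=> [C [eta [C0 eta0 H]]].
  pose r := Order.min (eta / 2) (Order.min 1 (C^-1 / 2)).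
  have r01 : 0 < r <= 1.
    by rewrite !lt_min !ge_min lexx orbT /= ltr01 !divr_gt0 ?invr_gt0.
  have := H (exist _ r r01) _ 0 erefl.
  rewrite /= [X in X <= _](_ : _ = 1) ?expr1; last exact: Normc.normc1.
  have reta : r < eta.
    by rewrite !gt_min ltr_pdivrMr // mulr_natr mulr2n ltrDl eta0.
  move=> /(_ reta); apply/negP; rewrite -ltNge.
  have : C * r <= C * (C^-1 / 2) 
    by apply: ler_wpM2l; [exact: ltW|rewrite /r !ge_min lexx !orbT].
  by rewrite mulVKf ?gt_eqF //; lra.
- move=> a u v /asboolP/negligibleE Nu /asboolP/negligibleE Nv.
  apply/asboolP/negligibleE; apply: all_derivativesD => //; first exact: negligible0D.
  apply: all_derivativesM (_ : all_derivatives moderate0 a) Nu.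
  + exact: negligible0D.
  + exact: negligible0M.
  + by apply/moderateE; exact: moderate_netP.
Qed.
HB.instance Definition _ :=
  isIdealr.Build (moderate_net R d) negligible_pred negligible_ideal.

End ColombeauAlgebra.

Definition colombeau (R : realType) (d : nat) :=
  {ideal_quot (@negligible_pred R d)}.

HB.instance Definition _ (R : realType) (d : nat) :=
  GRing.ComNzRing.on (colombeau R d).

Section GeneralisedFunctions.
Context {R : realType} {d : nat}.
Implicit Types (u : moderate_net R d) (a : colombeau R d).

Definition gclass u : colombeau R d := \pi_(colombeau R d)%qT u.

Definition represents (v : net R d) a :=
  exists u : moderate_net R d, (u : net R d) = v /\ gclass u = a.

Lemma gclass_eq u v : gclass u = gclass v <-> negligible (u - v).
Proof.
rewrite /gclass; split => [/eqP|Nuv].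
  by rewrite -Quotient.idealrBE => /asboolP.
by apply/eqP; rewrite -Quotient.idealrBE; apply/asboolP.
Qed.

Definition mcst (c : R[i]) : moderate_net R d :=
  ModerateNet (moderate_in (moderate_cst c)).

Definition gcst (c : R[i]) : colombeau R d := gclass (mcst c).

Definition mpartial j u : moderate_net R d :=
  ModerateNet (moderate_in (moderate_partial j (moderate_netP u))).

Definition gpartial j a : colombeau R d := gclass (mpartial j (repr a)).

Lemma mpartialB j u v : mpartial j (u - v) = mpartial j u - mpartial j v.
Proof.
apply: val_inj; apply/funext => e.
have du x : cdifferentiable (net_of u e) x.
  by have [+ _] := moderate_netP u => /(_ e [::] x).
have dv x : cdifferentiable (net_of v e) x.
  by have [+ _] := moderate_netP v => /(_ e [::] x).
exact: (partialB j du dv).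
Qed.

Lemma gpartial_class j u : gpartial j (gclass u) = gclass (mpartial j u).
Proof.
rewrite /gpartial; apply/gclass_eq; rewrite -mpartialB.
have : negligible (repr (gclass u) - u) by apply/gclass_eq; rewrite /gclass reprK.
move=> N K s q cK; exact: (N K (j :: s) q cK).
Qed.

(* D_j = -i d/dx_j *)
Definition gD j a : colombeau R d := gcst (Complex 0 (-1)) * gpartial j a.

Lemma derive_coord (j k : 'I_d) (x : 'rV[R]_d) :
  'D_(delta_mx 0 k) (fun y : 'rV[R]_d => y 0 j) x = (delta_mx 0 k : 'rV[R]_d) 0 j.
Proof.
rewrite /derive; apply: cvg_lim => //; apply: cvg_near_cst.
near=> h; rewrite /= /shift mxE [X in X + _ - _]mxE addrK.
rewrite /GRing.scale /= mulKf //.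
by near: h; exact: nbhs_dnbhs_neq.
Unshelve. all: by end_near.
Qed.

Lemma moderate_coord (j : 'I_d) :
  moderate ((fun _ x => (x 0 j)%:C%C) : net R d).
Proof.
apply/moderateE.
apply: (@all_derivatives_coind _ _ (fun u : net R d =>
   (u = (fun _ x => (x 0 j)%:C%C)) \/ exists c, u = fun _ _ => c)); last by left.
move=> _ [->|[c ->]]; last first.
  split; first by move=> e x; exact: cdifferentiable_cst.
    by have /moderateE[_ /(_ [::])] := @moderate_cst R d c; exact.
  by move=> i; rewrite npartial_cst; right; exists 0.
split=> [e x|K cK|i].
- by split; [exact: differentiable_coord|exact: differentiable_cst].
- have cj : compact ((fun y : 'rV[R]_d => y 0 j) @` K).
    apply: continuous_compact => //; apply: continuous_subspaceT.
    exact: coord_continuous.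
  have [M [_ HM]] := compact_bounded cj.
  exists 0%N, (`|M| + 1), 1; split=> // e _ x Kx.
  rewrite expr0 invr1 mulr1 /= expr0n /= addr0 sqrtr_sqr.
  by apply: HM; [rewrite (le_lt_trans (ler_norm _)) // ltrDl|exists x].
- right; exists ((delta_mx 0 i : 'rV[R]_d) 0 j)%:C%C.
  apply/funext => e; apply/funext => x.
  by rewrite /npartial /partial derive_coord (derive_cst (0 : R)).
Qed.

Definition gcoord (j : 'I_d) : colombeau R d :=
  gclass (ModerateNet (moderate_in (moderate_coord j))).

End GeneralisedFunctions.

Section Pullback.
Context {R : realType} {m d : nat}.
Variable L : {linear 'rV[R]_m -> 'rV[R]_d}.

Definition npull (u : net R d) : net R m := fun e x => u e (L x).

Inductive pull_closure (B : net R d -> Prop) : net R m -> Prop :=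
| pull_closure0 : pull_closure B 0
| pull_closure1 u of all_derivatives B u : pull_closure B (npull u)
| pull_closureZ c u of pull_closure B u : pull_closure B ((fun _ _ => c) * u)
| pull_closureD u v of pull_closure B u & pull_closure B v :
    pull_closure B (u + v).

Lemma all_derivatives_pull (B : net R d -> Prop) (B' : net R m -> Prop) u :
  (forall u v, B' u -> B' v -> B' (u + v)) ->
  (forall c u, B' u -> B' ((fun _ _ => c) * u)) ->
  (forall u, B u -> B' (npull u)) ->
  B' 0 ->
  all_derivatives B u -> all_derivatives B' (npull u).
Proof.
move=> BD BZ BL B0 Bu.
apply: (@all_derivatives_coind _ _ (pull_closure B)); last exact: pull_closure1.
move=> {u Bu} w; elim=> {w} [|u Bu|c u _ [du Bu Pu]|u v _ [du Bu Pu] _ [dv Bv Pv]].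
- split=> // [e x|j]; first exact: (cdifferentiable_cst 0).
  by rewrite (npartial_cst j 0); exact: pull_closure0.
- have du := all_derivatives_diff Bu.
  split; first by move=> e x; exact/cdifferentiable_linear/du.
    by apply: BL; exact: all_derivatives_nil.
  move=> j.
  have -> : npartial j (npull u) = \sum_k
      (fun _ _ => (L (delta_mx 0 j) 0 k)%:C%C) * npull (npartial k u).
    apply/funext => e; rewrite /npartial (partial_linear L j (du e)).
    by rewrite fct_sumE; apply/funext => x; rewrite fct_sumE.
  elim/big_ind: _ => [|? ?|k _]; [exact: pull_closure0|exact: pull_closureD|].
  by apply: pull_closureZ; apply: pull_closure1; exact: all_derivatives_partial.
- split; [|exact: BZ|].
    by move=> e x; apply: cdifferentiableM; [exact: cdifferentiable_cst|exact: du].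
  move=> j; rewrite npartialM //.
  rewrite npartial_cst [X in X + _](_ : _ = 0); last exact: mul0r.
  by rewrite add0r; exact: pull_closureZ.
- split; [exact: ndiffD|exact: BD|].
  by move=> j; rewrite npartialD //; exact: pull_closureD.
Qed.

Lemma O_on_pull K (u : net R d) g :
  O_on (L @` K) u g -> O_on K (npull u) g.
Proof.
move=> [C [eta [C0 eta0 H]]]; exists C, eta; split=> // e ee x Kx.
by apply: H => //; exists x.
Qed.

Lemma compact_linear K : compact K -> compact (L @` K).
Proof.
move=> cK; apply: continuous_compact => //; apply: continuous_subspaceT.
exact: linear_rV_continuous.
Qed.

Lemma O_on0 K (g : eps_index R -> R) : (forall e, 0 <= g e) -> O_on K (0 : net R m) g.
Proof.
move=> g0; exists 1, 1; split=> // e _ x _.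
by rewrite mul1r [X in X <= _](_ : _ = 0) ?g0 //; exact: Normc.normc0.
Qed.

Lemma moderate_cst0 (c : R[i]) : @moderate0 R m (fun _ _ => c).
Proof. by have /moderateE[_ /(_ [::])] := @moderate_cst R m c; exact. Qed.

Lemma moderate_pull u : moderate u -> moderate (npull u).
Proof.
move=> /moderateE Mu; apply/moderateE; apply: all_derivatives_pull Mu.
- exact: moderate0D.
- by move=> c u' Mu'; apply: moderate0M => //; exact: moderate_cst0.
- move=> {}u Mu K cK; have [N HN] := Mu _ (compact_linear cK).
  by exists N; exact: O_on_pull.
- exact: moderate_cst0.
Qed.

Definition mpull (u : moderate_net R d) : moderate_net R m :=
  ModerateNet (moderate_in (moderate_pull (moderate_netP u))).

Definition gpull (a : colombeau R d) : colombeau R m := gclass (mpull (repr a)).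

Lemma gpull_class u : gpull (gclass u) = gclass (mpull u).
Proof.
rewrite /gpull; apply/gclass_eq.
have -> : mpull (repr (gclass u)) - mpull u = mpull (repr (gclass u) - u).
  exact: val_inj.
have /negligibleE : negligible (repr (gclass u) - u).
  by apply/gclass_eq; rewrite /gclass reprK.
move=> N; apply/negligibleE; apply: all_derivatives_pull N.
- exact: negligible0D.
- by move=> c u' Nu'; apply: negligible0M => //; exact: moderate_cst0.
- by move=> w Nw K cK q; apply: O_on_pull; apply: Nw; exact: compact_linear.
- by move=> K cK q; apply: O_on0 => e; rewrite exprn_ge0 // ltW // eps_gt0.
Qed.

End Pullback.

Section Regularity.
Context {R : realType} {d : nat}.
Implicit Types (u : net R d) (a : colombeau R d) (mu : eps_index R -> R[i]).

Definition real_net u := forall e x, complex.Im (u e x) = 0.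

Definition real_valued a := exists2 u, represents u a & real_net u.

Definition log_type a := exists2 u, represents u a &
  forall K, compact K -> O_on K u (fun e => ln (sval e)^-1).

Definition slow_scale mu := forall q : R, 0 <= q -> exists C eta : R,
  [/\ 0 < C, 0 < eta & forall e : eps_index R, sval e < eta ->
    Normc.normc (mu e) `^ q <= C * (sval e)^-1].

(* The bound is by log|mu_e| and not by its absolute value: nets tending to 0
   arbitrarily fast are slow scale too, so that a bound by |log|mu_e|| would be
   no restriction at all. *)
Definition slow_scale_log_type a := exists2 u, represents u a &
  forall K, compact K -> exists2 mu, slow_scale mu &
    O_on K u (fun e => ln (Normc.normc (mu e))).

Definition slow_scale_regular a := exists2 u, represents u a &
  forall K s, compact K -> exists2 mu, slow_scale mu &
    O_on K (nipartial s u) (fun e => Normc.normc (mu e)).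

(* The restriction of a to the open set V is zero. *)
Definition vanishes_on (V : set 'rV[R]_d) a := exists2 u, represents u a &
  forall K s (q : nat), compact K -> K `<=` V ->
    O_on K (nipartial s u) (fun e => sval e ^+ q).

Definition support a : set 'rV[R]_d :=
  ~` \bigcup_(V in [set V | open V /\ vanishes_on V a]) V.

End Regularity.

Section CauchyProblem.
Context {R : realType} {n : nat}.

(* Generalised functions of (t,x) live on R^(1+n) and those of (x,t,s) on
   R^(n+2), the coordinates being in this order. *)
Definition time_idx : 'I_(1 + n) := lshift n ord0.
Definition space_idx (j : 'I_n) : 'I_(1 + n) := rshift 1 j.

Definition tx (t : R) (x : 'rV[R]_n) : 'rV[R]_(1 + n) := row_mx (const_mx t) x.

Definition xts (x : 'rV[R]_n) (t s : R) : 'rV[R]_(n + 2) :=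
  row_mx x (\row_i (if i == ord0 then t else s)).

Definition compact_in_x (a : colombeau R (1 + n)) :=
  exists2 K : set 'rV[R]_n, compact K &
    support a `<=` [set p | K (rsubmx p)].

(* x |-> (0,x) *)
Definition initial_slice (x : 'rV[R]_n) : 'rV[R]_(1 + n) := tx 0 x.

(* (t,x) |-> (x,t,t) *)
Definition diagonal_slice (p : 'rV[R]_(1 + n)) : 'rV[R]_(n + 2) :=
  xts (rsubmx p) (p 0 time_idx) (p 0 time_idx).

Lemma initial_slice_linear : linear initial_slice.
Proof.
move=> c x y; rewrite /initial_slice /tx scale_row_mx add_row_mx.
by congr row_mx; apply/rowP => i; rewrite !mxE mulr0 addr0.
Qed.
HB.instance Definition _ :=
  GRing.isLinear.Build R 'rV[R]_n 'rV[R]_(1 + n) *:%R initial_slice initial_slice_linear.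

Lemma diagonal_slice_linear : linear diagonal_slice.
Proof.
move=> c p q; rewrite /diagonal_slice /xts scale_row_mx add_row_mx.
by congr row_mx; apply/rowP => i; rewrite !mxE ?if_same.
Qed.
HB.instance Definition _ :=
  GRing.isLinear.Build R 'rV[R]_(1 + n) 'rV[R]_(n + 2) *:%R diagonal_slice diagonal_slice_linear.

(* D_t b = \sum_j a_{1,j} D_j b + a_0 b and b(0,.) = 1 *)
Definition cauchy_solution (a1 : 'I_n -> colombeau R (1 + n))
    (a0 b : colombeau R (1 + n)) :=
  gD time_idx b = \sum_j a1 j * gD (space_idx j) b + a0 * b /\
  gpull initial_slice b = 1.

(* c(x,t,s) = a(s, gamma(x,t,s)).  This composition is only defined for some
   gamma; it is required to be independent of the representatives. *)
Definition along_curve (gamma : 'I_n -> colombeau R (n + 2))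
    (a : colombeau R (1 + n)) (c : colombeau R (n + 2)) :=
  (forall h, real_valued (gamma h)) /\
  forall (A : net R (1 + n)) (g : 'I_n -> net R (n + 2)),
    represents A a ->
    (forall h, represents (g h) (gamma h) /\ real_net (g h)) ->
    represents (fun e p =>
      A e (tx (p 0 (rshift n ord_max)) (\row_h complex.Re (g h e p)))) c.

Definition characteristic_curve (a1 : 'I_n -> colombeau R (1 + n))
    (gamma : 'I_n -> colombeau R (n + 2)) :=
  forall h,
    (exists2 c, along_curve gamma (a1 h) c &
      gpartial (rshift n ord_max) (gamma h) = - c) /\
    gpull diagonal_slice (gamma h) = gcoord (space_idx h).

Definition oriented_integral (a b : R) (f : R -> R) : R :=
  if a <= b then \int[lebesgue_measure]_(s in `[a, b]) f s
  else - \int[lebesgue_measure]_(s in `[b, a]) f s.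

Definition coriented_integral (a b : R) (f : R -> R[i]) : R[i] :=
  Complex (oriented_integral a b (fun s => complex.Re (f s)))
          (oriented_integral a b (fun s => complex.Im (f s))).

(* beta(t,x) = \int_0^t c(x,t,s) ds *)
Definition is_time_integral (c : colombeau R (n + 2)) (beta : colombeau R (1 + n)) :=
  forall C : net R (n + 2), represents C c ->
    represents (fun e p => coriented_integral 0 (p 0 time_idx)
      (fun s => C e (xts (rsubmx p) (p 0 time_idx) s))) beta.

End CauchyProblem.

Definition cexp (R : realType) (z : R[i]) : R[i] :=
  Complex (expR (complex.Re z) * cos (complex.Im z))
          (expR (complex.Re z) * sin (complex.Im z)).

(* b = exp(i beta); again a partial operation, independent of representatives. *)
Definition is_exp_i (R : realType) d (beta b : colombeau R d) :=
  forall B : net R d, represents B beta ->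
    represents (fun e p => cexp (Complex 0 1 * B e p)) b.

Section Hypotheses.
Context {R : realType} {n : nat}.
Variables (a1 : 'I_n -> colombeau R (1 + n)) (a0 : colombeau R (1 + n)).

Definition log_type_coefficients :=
  (forall j, real_valued (a1 j) /\ compact_in_x (a1 j)) /\
  (forall j k, log_type (gpartial (space_idx k) (a1 j))) /\
  compact_in_x a0 /\ log_type a0.

Definition slow_scale_coefficients :=
  (forall j, [/\ real_valued (a1 j), slow_scale_regular (a1 j) &
                 compact_in_x (a1 j)]) /\
  (forall j k, slow_scale_log_type (gpartial (space_idx k) (a1 j))) /\
  [/\ slow_scale_regular a0, compact_in_x a0 & slow_scale_log_type a0].

End Hypotheses.

(* Main.v *)
(* Along the flow of the principal part the equation becomes an ordinary differential
   equation, solved by exp(i beta).  The coefficients a_{1,j} are first replaced by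
   representatives cut off in x, so that the flow is stationary outside a large ball and
   its Lipschitz constants in x are of logarithmic type, uniformly in x.

   Moderate and slow scale regular nets are treated together: in both cases all
   derivatives are bounded by constants from a class that is closed under sums and
   products (bound_class).  Gronwall's inequality turns a logarithmic bound L of the
   linearised equation into exp(T L), which lies in that class.  Derivatives with respect
   to parameters solve the linearised equation again, with the same matrix, so that
   regularity of the solutions follows by induction on the order.

   For uniqueness, Gronwall's inequality along the flow shows that the difference of two
   solutions is negligible at order zero, and Landau's trick extends this to all
   derivatives.  *)
From HB Require Import structures.
Require Import Defs.
From mathcomp Require Import all_boot all_order all_algebra.
From mathcomp Require Import ring_quotient complex.
From mathcomp Require Import all_classical all_reals all_analysis.
From mathcomp Require Import ring lra.
Import Order.TTheory GRing.Theory Num.Theory numFieldNormedType.Exports.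
Import ComplexField.

Set Implicit Arguments.
Unset Strict Implicit.
Unset Printing Implicit Defensive.

Local Open Scope classical_set_scope.
Local Open Scope ring_scope.

(** * Growth classes and local bounds *)

(** The bulk of the work is smoothness of solutions in their parameters, with constants controlled
    in eps. It is not obtained by differentiating solutions: [regular] replaces derivatives by
    Lipschitz estimates and Taylor expansions with quadratic remainder. A candidate gradient is
    produced by solving an equation for it, and Gronwall's inequality, applied to the Taylor
    remainder, shows that it is the gradient. Lemmas of a separate section translate between these
    estimates and partial derivatives.

    Two obstacles shape the hypotheses. Composition of nets is controlled when the inner net stays
    in a fixed ball as eps -> 0, although the a_{1,j} may themselves grow like powers of 1/eps; the
    cut-off in x serves to confine the flow. And exp(i beta) is kept under control by a logarithmic
    bound on Im beta, which is where the growth of a_0 enters.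

    The flow acts on space-time points (t,x) and so obeys a group law, from which the equation for
    beta follows. As the operations are defined on classes, the composition, the integral and the
    exponential are also shown to be insensitive to negligible changes. *)

Record bound_class (R : realType) := BoundClass {
  bounds :> (eps_index R -> R) -> Prop;
  bounds_ge0 : forall C, bounds C -> forall e, 0 <= C e;
  bounds_le : forall C D eta, 0 < eta -> bounds D -> (forall e, 0 <= C e) ->
    (forall e, sval e < eta -> C e <= D e) -> bounds C;
  bounds_cst : forall c, 0 <= c -> bounds (fun=> c);
  boundsD : forall C D, bounds C -> bounds D -> bounds (fun e => C e + D e);
  boundsM : forall C D, bounds C -> bounds D -> bounds (fun e => C e * D e) }.

Section BoundClasses.
Context {R : realType}.
Implicit Types (B : bound_class R) (C D : eps_index R -> R).

Lemma bounds_le1 B C D : B D -> (forall e, 0 <= C e) -> (forall e, C e <= D e) -> B C.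
Proof. by move=> BD C0 CD; apply: (bounds_le ltr01 BD). Qed.

Lemma bounds_max B C D : B C -> B D -> B (fun e => Num.max (C e) (D e)).
Proof.
move=> BC BD; apply: (bounds_le1 (boundsD BC BD)) => e.
  by rewrite le_max (bounds_ge0 BC).
by rewrite ge_max lerDl lerDr (bounds_ge0 BC) (bounds_ge0 BD).
Qed.

(** The least growth class, see [bdd_sub]: bounds independent of eps near 0. It singles out the nets
    that may be inserted into other nets. *)
Definition bdd (C : eps_index R -> R) := (forall e, 0 <= C e) /\
  exists c eta : R, 0 < eta /\ forall e, sval e < eta -> C e <= c.

Lemma bdd_class : exists B : bound_class R, bounds B = bdd.
Proof.
unshelve eexists (@BoundClass R bdd _ _ _ _ _) => //.
- by move=> C [].
- move=> C D eta eta0 [D0 [c [eta' [eta'0 H]]]] C0 CD; split=> //.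
  exists c, (Num.min eta eta'); split; first by rewrite lt_min eta0.
  by move=> e; rewrite lt_min => /andP[e1 e2]; rewrite (le_trans (CD _ e1)) ?H.
- by move=> c c0; split=> //; exists c, 1.
- move=> C D [C0 [c [eta [eta0 H]]]] [D0 [c' [eta' [eta'0 H']]]].
  split; first by move=> e; rewrite addr_ge0.
  exists (c + c'), (Num.min eta eta'); split; first by rewrite lt_min eta0.
  by move=> e; rewrite lt_min => /andP[e1 e2]; rewrite lerD ?H ?H'.
- move=> C D [C0 [c [eta [eta0 H]]]] [D0 [c' [eta' [eta'0 H']]]].
  split; first by move=> e; rewrite mulr_ge0.
  exists (c * c'), (Num.min eta eta'); split; first by rewrite lt_min eta0.
  by move=> e; rewrite lt_min => /andP[e1 e2]; rewrite ler_pM ?H ?H'.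
Qed.

Definition bddB := projT1 (cid bdd_class).
Lemma bddE C : bddB C <-> bdd C.
Proof. by rewrite /bddB; case: cid => B /= ->. Qed.

Lemma bdd_sub B C : bddB C -> B C.
Proof.
move=> /bddE[C0 [c [eta [eta0 H]]]].
apply: (bounds_le eta0 (@bounds_cst _ B `|c| _)) => // e ee.
by rewrite (le_trans (H _ ee)) // ler_norm.
Qed.

(* L is of logarithmic type relative to B: these exponentials are what Gronwall's
   inequality produces. *)
Definition exp_bounds B (L : eps_index R -> R) :=
  (forall e, 0 <= L e) /\ forall T, 0 <= T -> B (fun e => expR (T * L e)).

Lemma exp_boundsD B C D : exp_bounds B C -> exp_bounds B D ->
  exp_bounds B (fun e => C e + D e).
Proof.
move=> [C0 HC] [D0 HD]; split=> [e|T T0]; first exact: addr_ge0.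
under eq_fun do rewrite mulrDr expRD.
by apply: boundsM; [exact: HC|exact: HD].
Qed.

Lemma exp_bounds_cst B c : 0 <= c -> exp_bounds B (fun=> c).
Proof.
by move=> c0; split=> // T T0; apply: bounds_cst; exact: expR_ge0.
Qed.

Lemma exp_bounds_le B C D eta : 0 < eta -> exp_bounds B D -> (forall e, 0 <= C e) ->
  (forall e, sval e < eta -> C e <= D e) -> exp_bounds B C.
Proof.
move=> eta0 [D0 HD] C0 CD; split=> // T T0.
apply: (bounds_le eta0 (HD T T0)) => [e|e ee]; first exact: expR_ge0.
by rewrite ler_expR ler_wpM2l // CD.
Qed.

Lemma exp_boundsZ B c D : 0 <= c -> exp_bounds B D -> exp_bounds B (fun e => c * D e).
Proof.
move=> c0 [D0 HD]; split=> [e|T T0]; first exact: mulr_ge0.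
by under eq_fun do rewrite mulrA; apply: HD; exact: mulr_ge0.
Qed.

End BoundClasses.

Section LocalBigO.
Context {R : realType} (B : bound_class R).

(** The estimate is required for every eps, not only for small ones; by [bounds_le] the constant is
    unrestricted at the other eps. The space [T] is general because the estimates range over points,
    pairs of points, and pairs of points together with a time. *)
Definition locO {T : normedModType R} (X Y : eps_index R -> T -> R) :=
  forall r, exists2 C, B C & forall e t, `|t| <= r -> `|X e t| <= C e * Y e t.

Section Calculus.
Context {T : normedModType R}.
Implicit Types X Y Z : eps_index R -> T -> R.

Lemma locO_eq X X' Y : (forall e t, X e t = X' e t) -> locO X Y -> locO X' Y.
Proof.
by move=> XX' H r; have [C BC HC] := H r; exists C => // e t tr; rewrite -XX' HC.
Qed.

Lemma locO_trans X Y Z : locO X Y -> locO Y Z -> locO X Z.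
Proof.
move=> H1 H2 r; have [C BC HC] := H1 r; have [D BD HD] := H2 r.
exists (fun e => C e * D e); first exact: boundsM.
move=> e t tr; rewrite (le_trans (HC e t tr)) // -mulrA ler_wpM2l ?(bounds_ge0 BC) //.
by rewrite (le_trans (ler_norm _)) ?HD.
Qed.

Lemma locO_add X X' Y : locO X Y -> locO X' Y -> locO (fun e t => X e t + X' e t) Y.
Proof.
move=> H1 H2 r; have [C BC HC] := H1 r; have [D BD HD] := H2 r.
exists (fun e => C e + D e); first exact: boundsD.
move=> e t tr; rewrite mulrDl (le_trans (ler_normD _ _)) // lerD ?HC ?HD //.
Qed.

Lemma locO_opp X Y : locO X Y -> locO (fun e t => - X e t) Y.
Proof.
by move=> H r; have [C BC HC] := H r; exists C => // e t tr; rewrite normrN HC.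
Qed.

Lemma locO_sub X X' Y : locO X Y -> locO X' Y -> locO (fun e t => X e t - X' e t) Y.
Proof. by move=> H1 H2; apply: locO_add => //; exact: locO_opp. Qed.

Lemma locO0 Y : (forall e t, 0 <= Y e t) -> locO (fun _ _ => 0) Y.
Proof.
move=> Y0 r; exists (fun=> 0); first exact: bounds_cst.
by move=> e t _; rewrite normr0 mul0r.
Qed.

Lemma locO_le X Y : (forall e t, `|X e t| <= Y e t) -> locO X Y.
Proof.
move=> H r; exists (fun=> 1); first exact: bounds_cst.
by move=> e t _; rewrite mul1r.
Qed.

Lemma locO_refl Y : (forall e t, 0 <= Y e t) -> locO Y Y.
Proof. by move=> Y0; apply: locO_le => e t; rewrite ger0_norm. Qed.

Lemma locO_sum N (X : 'I_N -> eps_index R -> T -> R) Y : (forall e t, 0 <= Y e t) ->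
  (forall i, locO (X i) Y) -> locO (fun e t => \sum_i X i e t) Y.
Proof.
move=> Y0 H; elim: (index_enum _) => [|k r IH].
  by apply: (locO_eq _ (locO0 Y0)) => e t; rewrite big_nil.
by apply: (locO_eq _ (locO_add (H k) IH)) => e t; rewrite big_cons.
Qed.

Lemma locO_mul X X' Y Y' : locO X Y -> locO X' Y' ->
  locO (fun e t => X e t * X' e t) (fun e t => Y e t * Y' e t).
Proof.
move=> H1 H2 r; have [C BC HC] := H1 r; have [D BD HD] := H2 r.
exists (fun e => C e * D e); first exact: boundsM.
by move=> e t tr; rewrite mulrACA normrM ler_pM ?HC ?HD.
Qed.

Lemma locO_mulr X X' Y : locO X Y -> locO X' (fun _ _ => 1) ->
  locO (fun e t => X e t * X' e t) Y.
Proof.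
move=> H1 H2 r; have [C BC HC] := locO_mul H1 H2 r.
by exists C => // e t tr; have := HC e t tr; rewrite mulr1.
Qed.

Lemma locO_mull X X' Y : locO X (fun _ _ => 1) -> locO X' Y ->
  locO (fun e t => X e t * X' e t) Y.
Proof.
move=> H1 H2; apply: (locO_eq _ (locO_mulr H2 H1)) => e t; exact: mulrC.
Qed.

Lemma locO_cst (c : R) : locO (T := T) (fun _ _ => c) (fun _ _ => 1).
Proof.
move=> r; exists (fun=> `|c|); first exact: bounds_cst.
by move=> e t _; rewrite mulr1.
Qed.

Lemma locO_norm X Y : locO X Y -> locO (fun e t => `|X e t|) Y.
Proof.
by move=> H r; have [C BC HC] := H r; exists C => // e t tr; rewrite normr_id HC.
Qed.

(* For small eps the values of phi stay in a ball of fixed radius c; for the other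
   eps the constant may depend on eps, as it does not affect membership in B. *)
Lemma locO_comp {T' : normedModType R} (phi : eps_index R -> T' -> T) X Y :
  (forall r, exists2 C, bddB C & forall e t, `|t| <= r -> `|phi e t| <= C e) ->
  locO X Y -> locO (fun e t => X e (phi e t)) (fun e t => Y e (phi e t)).
Proof.
move=> Hphi H r; have [rho /bddE[_ [c [eta [eta0 rhoc]]]] Hrho] := Hphi r.
(* One constant is chosen for each radius, so that the radius [rho e], which varies with eps, can be
   substituted. *)
have [F HF] : {F : R -> eps_index R -> R & forall r, B (F r) /\
    forall e t, `|t| <= r -> `|X e t| <= F r e * Y e t}.
  apply: (choice (P := fun r C => B C /\ forall e t, `|t| <= r -> `|X e t| <= C e * Y e t)).
  by move=> s; have [C BC HC] := H s; exists C.
exists (fun e => if rho e <= c then F c e else F (rho e) e).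
  apply: (bounds_le eta0 (HF c).1) => [e|e ee].
    by case: ifP => _; exact: (bounds_ge0 (HF _).1).
  by rewrite rhoc.
move=> e t tr; case: ifP => H1.
  by apply: (HF c).2; rewrite (le_trans (Hrho _ _ tr)).
by apply: (HF (rho e)).2; exact: Hrho.
Qed.

Lemma locO_pull {T' : normedModType R} (phi : T' -> T) X Y :
  (forall r, exists r', forall t, `|t| <= r -> `|phi t| <= r') ->
  locO X Y -> locO (fun e t => X e (phi t)) (fun e t => Y e (phi t)).
Proof.
move=> Hphi; apply: (@locO_comp _ (fun=> phi)) => r.
have [r' Hr'] := Hphi r; exists (fun=> `|r'|); first exact: bounds_cst.
by move=> e t tr; rewrite (le_trans (Hr' _ tr)) // ler_norm.
Qed.

End Calculus.

Definition bigO1 {T : normedModType R} (X : eps_index R -> T -> R) :=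
  locO X (fun _ _ => 1).

End LocalBigO.

(** * Regularity with constants in a growth class *)

Section RowNorm.
Context {R : realType} {d : nat}.
Implicit Types v : 'rV[R]_d.

Lemma coord_le_norm v i : `|v 0 i| <= `|v|.
Proof.
rewrite [leRHS]/Num.Def.normr /= mx_normrE.
by apply: (le_bigmax _ (fun ij : 'I_1 * 'I_d => `|v ij.1 ij.2|) (0, i)).
Qed.

Lemma row_norm_le v r : 0 <= r -> (forall i, `|v 0 i| <= r) -> `|v| <= r.
Proof.
move=> r0 H; rewrite [leLHS]/Num.Def.normr /= mx_normrE.
by apply: bigmax_le => // -[i j] _; rewrite ord1.
Qed.

Lemma row_norm_le_sum v : `|v| <= \sum_i `|v 0 i|.
Proof.
apply: row_norm_le => [|i]; first by apply: sumr_ge0.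
by rewrite (bigD1 i) //= lerDl sumr_ge0.
Qed.

End RowNorm.

Section Regularity.
Context {R : realType} (B : bound_class R).

Local Notation rnet d := (eps_index R -> 'rV[R]_d -> R).

Definition locLip {d} (f : rnet d) :=
  @locO R B ('rV[R]_d * 'rV[R]_d)%type (fun e t => f e t.2 - f e t.1)
    (fun _ t => `|t.2 - t.1|).

(** Taylor expansion of first order with a locally uniform quadratic remainder. Unlike a limit it
    can be fed to Gronwall's inequality, and it still determines the derivative ([locD1_derive]). *)
Definition locD1 {d} (f : rnet d) (g : 'I_d -> rnet d) :=
  @locO R B ('rV[R]_d * 'rV[R]_d)%type
    (fun e t => f e t.2 - f e t.1 - \sum_i (t.2 - t.1) 0 i * g i e t.1)
    (fun _ t => `|t.2 - t.1| ^+ 2).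

(* Local C^{k,1} regularity with constants in B; g is the gradient of f. *)
Fixpoint regular {d} (k : nat) (f : rnet d) : Prop :=
  [/\ bigO1 B f, locLip f &
    if k is k'.+1 then exists2 g, (forall i, regular k' (g i)) & locD1 f g
    else True].

Definition regularoo {d} (f : rnet d) := forall k, regular k f.

Section Closure.
Context {d : nat}.
Implicit Types (f g : rnet d).
Local Notation V := 'rV[R]_d.

Lemma regular_O1 k f : regular k f -> bigO1 B f.
Proof. by case: k => [|k] []. Qed.

Lemma regular_Lip k f : regular k f -> locLip f.
Proof. by case: k => [|k] []. Qed.

Lemma regularS k f : regular k.+1 f -> regular k f.
Proof.
elim: k f => [|k IH] f [f0 f1 [g gk fg]]; first by [].
by split=> //; exists g => // i; apply: IH; exact: gk.
Qed.

Lemma regular_le k l f : (k <= l)%N -> regular l f -> regular k f.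
Proof.
by move=> /subnK <-; elim: (l - k)%N => //= m IH /regularS.
Qed.

Lemma locO_fst (T T' : normedModType R) X Y : @locO R B T X Y ->
  @locO R B (T * T')%type (fun e t => X e t.1) (fun e t => Y e t.1).
Proof.
apply: (locO_pull (phi := fst)) => r; exists r => -[a b] /=.
by rewrite prod_normE /= ge_max => /andP[].
Qed.

Lemma locO_snd (T T' : normedModType R) X Y : @locO R B T X Y ->
  @locO R B (T' * T)%type (fun e t => X e t.2) (fun e t => Y e t.2).
Proof.
apply: (locO_pull (phi := snd)) => r; exists r => -[a b] /=.
by rewrite prod_normE /= ge_max => /andP[].
Qed.

Lemma incr_locO (i : 'I_d) :
  @locO R B (V * V)%type (fun e t => (t.2 - t.1) 0 i) (fun _ t => `|t.2 - t.1|).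
Proof. by apply: locO_le => e t; exact: coord_le_norm. Qed.

(** On a ball the increment is bounded, so the quadratic remainder is also linearly bounded; the
    gradient term is linear in the increment. *)
Lemma locD1_Lip f Df : locD1 f Df -> (forall i, bigO1 B (Df i)) -> locLip f.
Proof.
move=> fg g0.
have small : @locO R B (V * V)%type (fun _ t => `|t.2 - t.1| ^+ 2) (fun _ t => `|t.2 - t.1|).
  apply: (@locO_mulr R B (V * V)%type (fun _ t => `|t.2 - t.1|) (fun _ t => `|t.2 - t.1|)).
    exact: locO_refl.
  move=> r; exists (fun=> `|r| + `|r|); first by apply: bounds_cst; exact: addr_ge0.
  move=> e -[p q]; rewrite prod_normE /= ge_max => /andP[pr qr].
  rewrite normr_id mulr1 (le_trans (ler_normB _ _)) // lerD //.
    exact: le_trans qr (ler_norm _).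
  exact: le_trans pr (ler_norm _).
have H : @locO R B (V * V)%type
    (fun e t => \sum_i (t.2 - t.1) 0 i * Df i e t.1) (fun _ t => `|t.2 - t.1|).
  apply: locO_sum => // i; apply: locO_mulr; first exact: incr_locO.
  exact: locO_fst (g0 i).
by apply: (locO_eq _ (locO_add (locO_trans fg small) H)) => e t; rewrite subrK.
Qed.

Lemma regularSI k f Df : bigO1 B f -> (forall i, regular k (Df i)) -> locD1 f Df ->
  regular k.+1 f.
Proof.
move=> f0 gk fg; split=> //; last by exists Df.
by apply: locD1_Lip fg _ => i; exact: regular_O1 (gk i).
Qed.

Lemma regular_cst k c : regular k ((fun _ _ => c) : rnet d).
Proof.
elim: k c => [|k IH] c; (split; first exact: locO_cst).
- by apply: (locO_eq _ (@locO0 R B _ (fun _ _ => _) _)) => // e t; rewrite subrr.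
- by [].
- by apply: (locO_eq _ (@locO0 R B _ (fun _ _ => _) _)) => // e t; rewrite subrr.
- exists (fun _ _ _ => 0) => //.
  apply: (locO_eq _ (@locO0 R B _ (fun _ _ => _) _)) => [e t|e t]; last exact: sqr_ge0.
  by rewrite subrr big1 ?subrr // => i _; rewrite mulr0.
Qed.

Lemma regularD k f g : regular k f -> regular k g -> regular k (fun e p => f e p + g e p).
Proof.
have LD f' g' : locLip f' -> locLip g' -> locLip (fun e p => f' e p + g' e p).
  move=> lf lg; apply: (locO_eq _ (locO_add lf lg)) => e t /=.
  by rewrite opprD addrACA.
elim: k f g => [|k IH] f g.
  by move=> [f0 lf _] [g0 lg _]; split=> //; [exact: locO_add|exact: LD].
move=> [f0 lf [f' f'k ff']] [g0 lg [g' g'k gg']]; split; [exact: locO_add|exact: LD|].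
exists (fun i e p => f' i e p + g' i e p).
  by move=> i; apply: IH; [exact: f'k|exact: g'k].
apply: (locO_eq _ (locO_add ff' gg')) => e t /=.
under [X in _ = _ - X]eq_bigr do rewrite mulrDr.
by rewrite big_split /=; ring.
Qed.

Lemma regularM k f g : regular k f -> regular k g -> regular k (fun e p => f e p * g e p).
Proof.
have LM f' g' : bigO1 B f' -> bigO1 B g' -> locLip f' -> locLip g' ->
    locLip (fun e p => f' e p * g' e p).
  move=> f0 g0 lf lg.
  have := locO_add (locO_mulr lf (locO_snd _ g0)) (locO_mull (locO_fst _ f0) lg).
  by apply: locO_eq => e t /=; ring.
elim: k f g => [|k IH] f g.
  move=> [f0 lf _] [g0 lg _]; split=> //; [exact: locO_mulr|exact: LM].
move=> Hf Hg; have [fk gk] := (regularS Hf, regularS Hg).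
move: Hf Hg => [f0 lf [f' f'k ff']] [g0 lg [g' g'k gg']].
split; [exact: locO_mulr|exact: LM|].
exists (fun i e p => f' i e p * g e p + f e p * g' i e p).
  move=> i; apply: regularD; apply: IH => //; [exact: f'k|exact: g'k].
(* The remainder of a product: the remainder of each factor times the other factor at the base
   point, plus the product of both increments. *)
have := locO_add (locO_add (locO_mulr ff' (locO_fst _ g0)) (locO_mull (locO_fst _ f0) gg'))
  (locO_mul lf lg).
apply: locO_eq => e t /=.
under [X in _ = _ - X]eq_bigr => i _ do
  rewrite mulrDr mulrA [X in _ + X]mulrCA.
by rewrite big_split /= -mulr_suml -mulr_sumr; ring.
Qed.

Lemma regularN k f : regular k f -> regular k (fun e p => - f e p).
Proof.
move=> fk; have := regularM (regular_cst k (-1)) fk.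
by congr regular; apply/funext => e; apply/funext => p; rewrite mulN1r.
Qed.

Lemma regularB k f g : regular k f -> regular k g -> regular k (fun e p => f e p - g e p).
Proof. by move=> fk gk; apply: regularD => //; exact: regularN. Qed.

Lemma regular_sum k N (f : 'I_N -> rnet d) : (forall j, regular k (f j)) ->
  regular k (fun e p => \sum_j f j e p).
Proof.
move=> H; elim: (index_enum _) => [|j r IH].
  have := regular_cst k 0; congr regular.
  by apply/funext => e; apply/funext => p; rewrite big_nil.
have := regularD (H j) IH; congr regular.
by apply/funext => e; apply/funext => p; rewrite big_cons.
Qed.

Lemma regular_coord k i : regular k ((fun _ v => v 0 i) : rnet d).
Proof.
have L : locLip ((fun _ v => v 0 i) : rnet d).
  by apply: (locO_eq _ (incr_locO i)) => e t; rewrite !mxE.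
have O : bigO1 B ((fun _ v => v 0 i) : rnet d).
  move=> r; exists (fun=> `|r|); first exact: bounds_cst.
  move=> e t tr; rewrite mulr1 (le_trans (coord_le_norm _ _)) // (le_trans tr) //.
  exact: ler_norm.
case: k => [|k]; split=> //.
exists (fun j _ _ => (j == i)%:R); first by move=> j; exact: regular_cst.
apply: (locO_eq _ (@locO0 R B _ (fun _ _ => _) _)) => [e t|e t]; last exact: sqr_ge0.
rewrite (bigD1 i) //= eqxx mulr1 big1 => [|j /negPf ->]; last by rewrite mulr0.
by rewrite !mxE addr0 subrr.
Qed.

End Closure.

(** * Composition of regular nets *)

Section Composition.
Context {d N : nat}.
Implicit Types (F : rnet N) (u : 'I_N -> rnet d).
Local Notation V := 'rV[R]_d.
Local Notation W := 'rV[R]_N.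

Definition bounded_net {T : normedModType R} (f : eps_index R -> T -> R) :=
  bigO1 (@bddB R) f.

Lemma bounded_row (T : normedModType R) (u : 'I_N -> eps_index R -> T -> R) r :
  (forall j, bounded_net (u j)) ->
  exists2 C, bddB C & forall e t, `|t| <= r -> `|\row_j u j e t| <= C e.
Proof.
move=> bu; have [C BC HC] := @locO_sum R (@bddB R) T N (fun j e t => `|u j e t|)
  (fun _ _ => 1) (fun _ _ => ler01) (fun j => locO_norm (bu j)) r.
exists C => // e t tr; rewrite (le_trans (row_norm_le_sum _)) //.
under eq_bigr do rewrite mxE.
by rewrite (le_trans (ler_norm _)) // (le_trans (HC e t tr)) ?mulr1.
Qed.

Lemma bounded_row_pair (u : 'I_N -> rnet d) r :
  (forall j, bounded_net (u j)) ->
  exists2 C, bddB C & forall e (t : V * V), `|t| <= r ->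
    `|(\row_j u j e t.1, \row_j u j e t.2)| <= C e.
Proof.
move=> bu; have [C BC HC] := bounded_row r bu; exists C => // e [p q].
rewrite !prod_normE /= ge_max => /andP[pr qr].
by rewrite ge_max !HC.
Qed.

Lemma incr_row (u : 'I_N -> rnet d) : (forall j, locLip (u j)) ->
  @locO R B (V * V)%type (fun e t => `|\row_j u j e t.2 - \row_j u j e t.1|)
    (fun _ t => `|t.2 - t.1|).
Proof.
move=> lu.
apply: (locO_trans (Y := fun e t => \sum_j `|u j e t.2 - u j e t.1|)).
  apply: locO_le => e t; rewrite normr_id (le_trans (row_norm_le_sum _)) //.
  by apply: ler_sum => j _; rewrite !mxE.
by apply: locO_sum => // j; exact: locO_norm (lu j).
Qed.

Lemma locO_compO1 (T : normedModType R) F (u : 'I_N -> eps_index R -> T -> R) :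
  (forall j, bounded_net (u j)) -> bigO1 B F ->
  bigO1 B (fun e t => F e (\row_j u j e t)).
Proof.
by move=> bu; apply: (locO_comp (phi := fun e t => \row_j u j e t)) => r; exact: bounded_row.
Qed.

(** Bounds on [F] are available on balls of fixed radius, hence the requirement that the inner
    functions be bounded independently of small eps; their derivatives may grow within [B]. *)
Lemma regular_comp k F u : (forall j, bounded_net (u j)) ->
  regular k F -> (forall j, regular k (u j)) ->
  regular k (fun e p => F e (\row_j u j e p)).
Proof.
move=> bu.
have O1 F' : bigO1 B F' -> bigO1 B (fun e p => F' e (\row_j u j e p)).
  exact: locO_compO1.
have Lip F' : (forall j, locLip (u j)) -> locLip F' ->
    locLip (fun e p => F' e (\row_j u j e p)).
  move=> lu lF; apply: (locO_trans _ (incr_row lu)).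
  apply: (locO_comp (phi := fun e (t : V * V) => (\row_j u j e t.1, \row_j u j e t.2))) lF => r.
  exact: bounded_row_pair.
elim: k F => [|k IH] F.
  move=> [F0 lF _] uk; split=> //; first exact: O1.
  by apply: Lip => // j; exact: regular_Lip (uk j).
move=> [F0 lF [F' F'k FF']] uk; have lu j := regular_Lip (uk j).
have uk' j := regularS (uk j).
have [u' Hu'] : {u' : 'I_N -> 'I_d -> rnet d & forall j,
    (forall i, regular k (u' j i)) /\ locD1 (u j) (u' j)}.
  apply: (choice (P := fun j g => (forall i, regular k (g i)) /\ locD1 (u j) g)) => j.
  have [_ _ [g gk gg]] := uk j; by exists g.
split; [exact: O1|exact: Lip|].
exists (fun i e p => \sum_j F' j e (\row_j u j e p) * u' j i e p).
  move=> i; apply: regular_sum => j; apply: regularM; last exact: (Hu' j).1.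
  by apply: IH => //; exact: F'k.
(* Remainder of the chain rule: the remainder of [F] at the inner values ([H1]), quadratic in their
   increment and so in the given one ([H2]), plus the gradient of [F] applied to the inner
   remainders ([H4]). *)
have H1 := @locO_comp R B _ _ (fun e (t : V * V) => (\row_j u j e t.1, \row_j u j e t.2))
  _ _ (fun r => bounded_row_pair r bu) FF'.
have H2 := locO_mul (incr_row lu) (incr_row lu).
have H3 j := locO_mull (locO_fst _ (O1 (F' j) (regular_O1 (F'k j)))) (Hu' j).2.
have H4 := locO_sum (Y := fun _ (t : V * V) => `|t.2 - t.1| ^+ 2) (fun e t => sqr_ge0 _) H3.
have := locO_add (locO_trans H1 H2) H4.
apply: locO_eq => e t /=.
under [X in _ + X = _]eq_bigr do rewrite mulrBr.
rewrite sumrB.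
under [X in _ - X + _ = _]eq_bigr do rewrite !mxE mulrC.
under [X in _ = _ - X]eq_bigr do rewrite mulr_sumr.
rewrite exchange_big /=.
under [X in _ = _ - X]eq_bigr do under eq_bigr do rewrite mulrCA.
under [X in _ = _ - X]eq_bigr do rewrite -mulr_sumr.
by rewrite addrA subrK.
Qed.

End Composition.

End Regularity.

Lemma regular_sub {R : realType} (B B' : bound_class R) d k (f : eps_index R -> 'rV[R]_d -> R) :
  (forall C, B C -> B' C) -> regular B k f -> regular B' k f.
Proof.
move=> BB'.
have sub (T : normedModType R) (X Y : eps_index R -> T -> R) : locO B X Y -> locO B' X Y.
  by move=> H r; have [C BC HC] := H r; exists C => //; exact: BB'.
elim: k f => [|k IH] f; first by move=> [f0 lf _]; split=> //; exact: sub.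
move=> [f0 lf [g gk fg]]; split; [exact: sub|exact: sub|].
exists g; last exact: sub.
by move=> i; apply: IH; exact: gk.
Qed.

(** * Gronwall's inequality *)

Section RealFunctions.
Context {R : realType}.
Implicit Types (f g F df dE E : R -> R) (a b x y s T K c : R).

Lemma is_derive_val f x a b : is_derive x 1 f a -> a = b -> is_derive x 1 f b.
Proof. by move=> ? <-. Qed.

Lemma is_derive_add f g x a b : is_derive x 1 f a -> is_derive x 1 g b ->
  is_derive x 1 (fun y => f y + g y) (a + b).
Proof. exact: is_deriveD. Qed.

Lemma is_derive_opp f x a : is_derive x 1 f a -> is_derive x 1 (fun y => - f y) (- a).
Proof. exact: is_deriveN. Qed.

Lemma is_derive_sub f g x a b : is_derive x 1 f a -> is_derive x 1 g b ->
  is_derive x 1 (fun y => f y - g y) (a - b).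
Proof. exact: is_deriveB. Qed.

Lemma is_derive_mul f g x a b : is_derive x 1 f a -> is_derive x 1 g b ->
  is_derive x 1 (fun y => f y * g y) (a * g x + f x * b).
Proof.
move=> fa gb; apply: is_derive_val (is_deriveM fa gb) _.
by rewrite /GRing.scale /= addrC [a * _]mulrC.
Qed.

Lemma is_derive_const x c : is_derive x 1 (fun=> c) 0.
Proof. exact: is_derive_cst. Qed.

Lemma is_derive_bigsum N (f : 'I_N -> R -> R) (a : 'I_N -> R) x :
  (forall i, is_derive x 1 (f i) (a i)) ->
  is_derive x 1 (fun y => \sum_i f i y) (\sum_i a i).
Proof.
move=> H; have -> : (fun y => \sum_i f i y) = \sum_i f i.
  by apply/funext => z; rewrite fct_sumE.
exact: is_derive_sum.
Qed.

Lemma is_derive_scale f x k a : is_derive x 1 f a -> is_derive x 1 (fun y => k * f y) (k * a).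
Proof. exact: is_deriveZ. Qed.

Lemma mvt f df a b : a <= b -> (forall x, a <= x <= b -> is_derive x 1 f (df x)) ->
  exists2 c, a <= c <= b & f b - f a = df c * (b - a).
Proof.
move=> ab fdf.
have [|x|c cab ->] := @MVT_segment R f df a b ab.
- by move=> x; rewrite in_itv /= => /andP[ax xb]; apply: fdf; rewrite !ltW.
- apply: derivable_within_continuous => y; rewrite in_itv /= => /fdf ?.
  exact: ex_derive.
- by exists c => //; move: cab; rewrite in_itv.
Qed.

Lemma derive_continuous f df : (forall x, is_derive x 1 f (df x)) -> continuous f.
Proof.
move=> fdf x; apply: differentiable_continuous; apply/derivable1_diffP.
exact: ex_derive.
Qed.

Lemma itv_norm_le (x y T z : R) : `|x| <= T -> `|y| <= T -> x <= z <= y -> `|z| <= T.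
Proof.
rewrite !ler_norml => /andP[? ?] /andP[? ?] /andP[? ?].
by apply/andP; split; lra.
Qed.

Lemma mvt_norm f df T M : (forall x, is_derive x 1 f (df x)) ->
  (forall x, `|x| <= T -> `|df x| <= M) ->
  forall x y, `|x| <= T -> `|y| <= T -> `|f y - f x| <= M * `|y - x|.
Proof.
move=> fdf bM x y; wlog xy : x y / x <= y => [H xT yT|xT yT].
  by case/orP: (le_total x y) => xy; [|rewrite distrC (distrC y)]; exact: H.
have [c cxy ->] := mvt xy (fun x _ => fdf x).
by rewrite normrM ler_wpM2r // bM // (itv_norm_le xT yT).
Qed.

Lemma derive0_cst f : (forall x, is_derive x 1 f 0) -> forall x y, f x = f y.
Proof.
move=> f0 x y; apply/eqP; rewrite -subr_eq0 -normr_le0.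
have -> : 0 = 0 * `|x - y| by rewrite mul0r.
apply: (@mvt_norm f (fun=> 0) (`|x| + `|y|)) => //.
- by move=> z _; rewrite normr0.
- by rewrite lerDr.
- by rewrite lerDl.
Qed.

Lemma is_derive_reflect f df : (forall x, is_derive x 1 f (df x)) ->
  forall x, is_derive x 1 (fun y => f (- y)) (- df (- x)).
Proof.
move=> fdf x.
have := @is_derive1_comp R f (fun y => - y) x (df (- x)) (-1) (fdf _) _.
by rewrite mulrN1; apply; exact: is_deriveNid.
Qed.

Lemma is_derive_shift_arg f df a : (forall x, is_derive x 1 f (df x)) ->
  forall x, is_derive x 1 (fun y => f (a + y)) (df (a + x)).
Proof.
move=> fdf x.
have := @is_derive1_comp R f (fun y => a + y) x (df (a + x)) 1 (fdf _) _.
rewrite mulr1; apply.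
apply: is_derive_val (is_derive_add (is_derive_const x a) (is_derive_id x 1)) _.
by rewrite add0r.
Qed.

Lemma ger0_derive_le f df a b : a <= b ->
  (forall x, a <= x <= b -> is_derive x 1 f (df x)) ->
  (forall x, a <= x <= b -> 0 <= df x) -> f a <= f b.
Proof.
move=> ab fdf df0; have [c cab H] := mvt ab fdf.
by rewrite -subr_ge0 H mulr_ge0 ?df0 // subr_ge0.
Qed.

Lemma is_derive_expRM K x : is_derive x 1 (fun s => expR (K * s)) (K * expR (K * x)).
Proof.
have := @is_derive1_comp R expR (fun s => K * s) x (expR (K * x)) K (is_derive_expR _) _.
rewrite mulrC; apply.
by apply: is_derive_val (is_derive_scale K (is_derive_id x 1)) _; rewrite mulr1.
Qed.

(** [(E s + c) * expR (- K * s)] does not increase, because [dE s <= K * E s + c <= K * (E s + c)]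
    when [1 <= K]. *)
Lemma gronwall_pos E dE K c T : 1 <= K -> 0 <= c ->
  (forall s, is_derive s 1 E (dE s)) ->
  (forall s, 0 <= s <= T -> dE s <= K * E s + c) ->
  forall s, 0 <= s <= T -> E s <= (E 0 + c) * expR (K * s).
Proof.
move=> K1 c0 EdE HE s /andP[s0 sT].
have K0 : 0 < K by exact: lt_le_trans K1.
suff H : - ((E 0 + c) * expR (- K * 0)) <= - ((E s + c) * expR (- K * s)).
  move: H; rewrite lerN2 mulr0 expR0 mulr1 mulNr expRN ler_pdivrMr ?expR_gt0 //.
  by apply: le_trans; rewrite lerDl.
pose dh s := - ((dE s) * expR (- K * s) + (E s + c) * (- K * expR (- K * s))).
apply: (@ger0_derive_le (fun s => - ((E s + c) * expR (- K * s))) dh) => // x xs.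
  apply: is_derive_opp; apply: is_derive_mul; last exact: is_derive_expRM.
  by apply: is_derive_val (is_derive_add (EdE x) (is_derive_const x c)) _; rewrite addr0.
have xT : 0 <= x <= T by move/andP: xs => [-> /le_trans]; apply.
have := HE x xT => H.
rewrite /dh (_ : - _ = (K * (E x + c) - dE x) * expR (- K * x)); last by ring.
rewrite mulr_ge0 ?expR_ge0 // subr_ge0 (le_trans H) // mulrDr lerD2l.
by rewrite ler_peMl.
Qed.

Lemma gronwall_scalar E dE K c T : 1 <= K -> 0 <= c ->
  (forall s, is_derive s 1 E (dE s)) ->
  (forall s, `|s| <= T -> `|dE s| <= K * E s + c) ->
  forall s, `|s| <= T -> E s <= (E 0 + c) * expR (K * `|s|).
Proof.
move=> K1 c0 EdE HE s sT; have [s0|s0] := leP 0 s.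
  move: sT; rewrite ger0_norm // => sT; apply: (gronwall_pos (T := T) K1 c0 EdE); last by rewrite s0.
  by move=> x /andP[x0 xT]; rewrite (le_trans (ler_norm _)) // HE // ger0_norm.
move: sT; rewrite ltr0_norm // => sT.
have := @gronwall_pos (fun y => E (- y)) (fun y => - dE (- y)) K c T K1 c0
  (is_derive_reflect EdE) _ (- s).
rewrite oppr0 opprK; apply; last by rewrite sT oppr_ge0 ltW.
move=> x /andP[x0 xT]; rewrite (le_trans (ler_norm _)) // normrN HE //.
by rewrite normrN ger0_norm.
Qed.

(** The energy, the sum of the squares of the [D j], is differentiable where a sum of absolute
    values is not. By 2ab <= a^2 + b^2 its derivative is at most (2NL + 1) times the energy plus N
    c^2, which explains the rate in the exponential. The square root is taken crudely, using that N
    and the exponential are at least 1. *)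
Lemma gronwall (N : nat) (D dD : 'I_N -> R -> R) (L c D0 T : R) : 0 <= L -> 0 <= c -> 0 <= D0 ->
  (forall j s, is_derive s 1 (D j) (dD j s)) ->
  (forall j s, `|s| <= T -> `|dD j s| <= L * \sum_k `|D k s| + c) ->
  (forall j, `|D j 0| <= D0) ->
  forall j s, `|s| <= T ->
    `|D j s| <= N%:R * (D0 + c) * expR ((2 * N%:R * L + 1) * T).
Proof.
move=> L0 c0 D00 DdD HD HD0 j s sT.
have N1 : 1 <= N%:R :> R by rewrite ler1n; case: N j {D dD DdD HD HD0} => // -[].
have T0 : 0 <= T by exact: le_trans (normr_ge0 _) sT.
pose E s := \sum_j D j s ^+ 2.
pose dE s := \sum_j 2 * (D j s * dD j s).
have EdE x : is_derive x 1 E (dE x).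
  rewrite /E /dE.
  apply: is_derive_bigsum => i; apply: is_derive_val (is_derive_mul (DdD i x) (DdD i x)) _.
  by ring.
have E0 x : 0 <= E x by apply: sumr_ge0 => i _; exact: sqr_ge0.
set K := 2 * N%:R * L + 1.
have K1 : 1 <= K by rewrite lerDr !mulr_ge0.
have HE x : `|x| <= T -> `|dE x| <= K * E x + N%:R * c ^+ 2.
  move=> xT; rewrite /dE (le_trans (ler_norm_sum _ _ _)) //.
  apply: (@le_trans _ _ (\sum_j (\sum_k L * (D j x ^+ 2 + D k x ^+ 2) + (D j x ^+ 2 + c ^+ 2)))).
    apply: ler_sum => i _; rewrite !normrM ger0_norm //.
    apply: (@le_trans _ _ (2 * (`|D i x| * (L * (\sum_k `|D k x|) + c)))).
      by rewrite ler_pM2l // ler_wpM2l // HD.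
    rewrite mulrDr mulrDr; apply: lerD.
      rewrite mulr_sumr mulr_sumr mulr_sumr; apply: ler_sum => k _.
      rewrite -(real_normK (num_real (D i x))) -(real_normK (num_real (D k x))).
      have -> : 2 * (`|D i x| * (L * `|D k x|)) = L * (2 * (`|D i x| * `|D k x|)) by ring.
      rewrite ler_wpM2l //; have := sqr_ge0 (`|D i x| - `|D k x|); rewrite sqrrB; lra.
    rewrite -(real_normK (num_real (D i x))).
    have := sqr_ge0 (`|D i x| - c); rewrite sqrrB; lra.
  rewrite big_split /= big_split /=.
  under eq_bigr do rewrite -mulr_sumr big_split /=.
  have -> : K * E x + N%:R * c ^+ 2 = L * (N%:R * E x + N%:R * E x) + (E x + N%:R * c ^+ 2).
    by rewrite /K; ring.
  rewrite le_eqVlt; apply/orP; left; apply/eqP.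
  congr (_ + (_ + _)); last by rewrite sumr_const card_ord mulr_natl.
  rewrite -mulr_sumr big_split /=; congr (L * (_ + _)).
    by rewrite /E mulr_sumr; apply: eq_bigr => i _; rewrite sumr_const card_ord mulr_natl.
  by rewrite sumr_const card_ord mulr_natl.
have c2 : 0 <= N%:R * c ^+ 2 by rewrite mulr_ge0 ?sqr_ge0.
have H := gronwall_scalar K1 c2 EdE HE sT.
have HE0 : E 0 <= N%:R * D0 ^+ 2.
  rewrite /E mulr_natl -[X in _ *+ X](card_ord N) -sumr_const.
  apply: ler_sum => i _; rewrite -(real_normK (num_real (D i 0))).
  by rewrite ler_pXn2r // nnegrE.
have X0 : 0 <= N%:R * (D0 + c) * expR (K * T) by rewrite !mulr_ge0 ?addr_ge0 ?expR_ge0.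
rewrite -(ler_pXn2r (n := 2)) // ?nnegrE // (@real_normK _ (D j s)) ?num_real //.
apply: (@le_trans _ _ (E s)).
  by rewrite /E (bigD1 j) //= lerDl sumr_ge0 // => i _; exact: sqr_ge0.
apply: le_trans H _.
have eT : expR (K * `|s|) <= expR (K * T).
  by rewrite ler_expR ler_wpM2l // (le_trans ler01).
have e1 : 1 <= expR (K * T) by rewrite -expR0 ler_expR mulr_ge0 // (le_trans ler01).
apply: (@le_trans _ _ ((N%:R * D0 ^+ 2 + N%:R * c ^+ 2) * expR (K * T))).
  by apply: ler_pM => //; rewrite ?addr_ge0 ?expR_ge0 ?lerD2r.
rewrite exprMn ler_pM // ?addr_ge0 ?mulr_ge0 ?sqr_ge0 ?expR_ge0 //; last first.
  by rewrite expr2 ler_peMl ?expR_ge0.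
rewrite -mulrDr exprMn ler_pM // ?addr_ge0 ?sqr_ge0 //.
  by rewrite expr2 ler_peMl.
by rewrite sqrrD lerD2r lerDl mulrn_wge0 // mulr_ge0.
Qed.

End RealFunctions.

(** * Primitives and Picard iteration *)

Section Antiderivative.
Context {R : realType}.
Implicit Types (f F : R -> R) (a b t x M : R).

Lemma is_derive_continuous f x c : is_derive x 1 f c -> {for x, continuous f}.
Proof.
by move=> ?; apply: differentiable_continuous; apply/derivable1_diffP; exact: ex_derive.
Qed.

Lemma integral_antiderivative f F a b : continuous f ->
  (forall x, a <= x <= b -> is_derive x 1 F (f x)) ->
  a <= b -> (\int[lebesgue_measure]_(x in `[a, b]) f x)%R = F b - F a.
Proof.
move=> cf Ff; rewrite le_eqVlt => /orP[/eqP ->|ab].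
  by rewrite set_itv1 Rintegral_set1 subrr.
have aab : a <= a <= b by rewrite lexx ltW.
have bab : a <= b <= b by rewrite lexx ltW.
rewrite /Rintegral (@continuous_FTC2 R f F a b ab) //.
- exact: continuous_subspaceT.
- split=> [x||].
  + by rewrite in_itv /= => /andP[ax xb]; have := Ff x; rewrite !ltW // => /(_ isT) ?; exact: ex_derive.
  + by apply: cvg_at_right_filter; exact: is_derive_continuous (Ff _ aab).
  + by apply: cvg_at_left_filter; exact: is_derive_continuous (Ff _ bab).
- move=> x; rewrite in_itv /= => /andP[ax xb]; have := Ff x; rewrite !ltW // => /(_ isT) ?.
  by rewrite derive1E; exact: derive_val.
Qed.

Lemma oriented_integral_local f F t M : `|t| < M -> continuous f ->
  (forall x, `|x| < M -> is_derive x 1 F (f x)) ->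
  oriented_integral 0 t f = F t - F 0.
Proof.
rewrite ltr_norml => /andP[Mt tM] cf Ff; rewrite /oriented_integral; case: ifPn => [t0|].
  apply: integral_antiderivative => // x /andP[x0 xt]; apply: Ff.
  by rewrite ltr_norml; apply/andP; split; lra.
rewrite -ltNge => /ltW t0.
rewrite (@integral_antiderivative f F t 0 cf _ t0) ?opprB // => x /andP[x0 xt]; apply: Ff.
by rewrite ltr_norml; apply/andP; split; lra.
Qed.

Lemma oriented_integralE f F t : continuous f -> (forall x, is_derive x 1 F (f x)) ->
  oriented_integral 0 t f = F t - F 0.
Proof.
by move=> cf Ff; apply: (@oriented_integral_local f F t (`|t| + 1)) => //; rewrite ltrDl.
Qed.

(** Integrating from -M instead of 0 lets a single integral serve on both sides of 0. *)
Lemma local_antiderivative f M : 0 < M -> continuous f ->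
  exists F, forall x, `|x| < M -> is_derive x 1 F (f x).
Proof.
move=> M0 cf; exists (fun x => (\int[lebesgue_measure]_(t in `[(- M)%R, x]) f t)%R) => x.
rewrite ltr_norml => /andP[Mx xM].
have fi : lebesgue_measure.-integrable `[- M, M] (EFin \o f).
  apply: continuous_compact_integrable; first exact: segment_compact.
  exact: continuous_subspaceT.
have [|dF <-] := continuous_FTC1_closed xM fi Mx; first exact: cf.
by rewrite derive1E; exact: derivableP.
Qed.

Lemma near_norm_lt x M : `|x| < M -> \forall t \near x, `|t| < M.
Proof. by move=> xM; have := @norm_continuous R R x => /cvgr_lt; exact. Qed.

Lemma oriented_integral_derive f : continuous f ->
  forall x, is_derive x 1 (fun t => oriented_integral 0 t f) (f x).
Proof.
move=> cf x; have M0 : 0 < `|x| + 1 by rewrite ltr_wpDl.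
have [F HF] := local_antiderivative M0 cf.
have xM : `|x| < `|x| + 1 by rewrite ltrDl.
apply: (@near_eq_is_derive _ _ _ (fun t => F t - F 0)).
- near=> t; apply/esym; apply: (oriented_integral_local _ cf HF).
  by near: t; exact: near_norm_lt.
- by apply: is_derive_val (is_derive_sub (HF x xM) (is_derive_const x (F 0))) _; rewrite subr0.
Unshelve. all: by end_near. Qed.

Lemma oriented_integral0 f : oriented_integral 0 0 f = 0.
Proof. by rewrite /oriented_integral lexx set_itv1 Rintegral_set1. Qed.

End Antiderivative.

Section Picard.
Context {R : realType} {N : nat}.

Lemma row_subE (u v : 'rV[R]_N) j : (u - v) 0 j = u 0 j - v 0 j.
Proof. by rewrite !mxE. Qed.

(** [u k - 2 * D / 2 ^+ k] increases and [u k + 2 * D / 2 ^+ k] decreases, so the limit is the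
    supremum of the former and is enclosed between the two. *)
Lemma geometric_lim (u : R^nat) (D : R) :
  (forall k, `|u k.+1 - u k| <= D / 2 ^+ k) ->
  forall k, `|limn u - u k| <= 2 * D / 2 ^+ k.
Proof.
move=> H.
have D0 : 0 <= D by have := H 0%N; rewrite expr0 divr1; exact: le_trans.
pose v k := u k - 2 * D / 2 ^+ k.
have step k : 2 * D / 2 ^+ k = 2 * D / 2 ^+ k.+1 + D / 2 ^+ k.
  by rewrite exprS invfM; field.
have vS k : v k <= v k.+1.
  by have := H k; rewrite ler_norml /v (step k) => /andP[]; lra.
have vle k l : (k <= l)%N -> v k <= v l.
  by move=> /subnK <-; elim: (l - k)%N => // m IH; exact: le_trans IH (vS _).
have e0 k : 0 <= 2 * D / 2 ^+ k by rewrite divr_ge0 ?mulr_ge0 // exprn_ge0.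
have wS k : u k.+1 + 2 * D / 2 ^+ k.+1 <= u k + 2 * D / 2 ^+ k.
  by have := H k; rewrite ler_norml (step k) => /andP[]; lra.
have wle k l : (k <= l)%N -> u l + 2 * D / 2 ^+ l <= u k + 2 * D / 2 ^+ k.
  by move=> /subnK <-; elim: (l - k)%N => // m IH; exact: le_trans (wS _) IH.
have vw k l : v k <= u l + 2 * D / 2 ^+ l.
  apply: (@le_trans _ _ (v (maxn k l))); first by apply: vle; exact: leq_maxl.
  apply: (@le_trans _ _ (u (maxn k l) + 2 * D / 2 ^+ maxn k l)).
    by rewrite /v; have := e0 (maxn k l); lra.
  by apply: wle; exact: leq_maxr.
have ubw l : ubound (range v) (u l + 2 * D / 2 ^+ l) by move=> _ [k _ <-]; exact: vw.
have supv : has_sup (range v).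
  by split; [exists (v 0%N), 0%N|exists (u 0%N + 2 * D / 2 ^+ 0); exact: ubw].
have Hl k : `|sup (range v) - u k| <= 2 * D / 2 ^+ k.
  rewrite ler_norml; apply/andP; split.
    have : v k <= sup (range v) by apply: ub_le_sup; [case: supv|exists k].
    by rewrite /v; lra.
  have : sup (range v) <= u k + 2 * D / 2 ^+ k by apply: ge_sup; [case: supv|exact: ubw].
  lra.
suff -> : limn u = sup (range v) by [].
apply: cvg_lim => //; apply/cvgrPdist_le => e e_gt0.
have : (fun k => 2 * D / 2 ^+ k) @ \oo --> (0 : R).
  have := @cvg_geometric R (2 * D) (2^-1) _; rewrite /geometric /=.
  under eq_fun do rewrite exprVn; apply.
  by rewrite ger0_norm // invf_lt1 // ltr1n.
move=> /cvgrPdist_le /(_ e e_gt0) [m _ Hm]; exists m => // k /Hm /=.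
rewrite sub0r normrN ger0_norm //; exact: le_trans (Hl k).
Qed.

(** Integration against the weight exp(K|s|) gains a factor 1/K. This gain makes the Picard map
    contract on time intervals of any length. *)
Lemma norm_le_expR (g dg : R -> R) (K C T : R) : 0 < K -> 0 <= C -> g 0 = 0 ->
  (forall s : R, is_derive s 1 g (dg s)) ->
  (forall s, `|s| <= T -> `|dg s| <= C * (K * expR (K * `|s|))) ->
  forall s : R, `|s| <= T -> `|g s| <= C * expR (K * `|s|).
Proof.
move=> K0 C0.
have pos (h dh : R -> R) : h 0 = 0 -> (forall s : R, is_derive s 1 h (dh s)) ->
  (forall s, `|s| <= T -> `|dh s| <= C * (K * expR (K * `|s|))) ->
  forall s, 0 <= s -> s <= T -> h s <= C * expR (K * s).
  move=> h0 hdh Hh s s0 sT.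
  rewrite -subr_ge0; apply: (@le_trans _ _ (C * expR (K * 0) - h 0)).
    by rewrite h0 subr0 mulr0 expR0 mulr1.
  apply: (@ger0_derive_le _ (fun x => C * expR (K * x) - h x)
    (fun x => C * (K * expR (K * x)) - dh x)) => // x /andP[x0 xs].
    apply: is_derive_sub => //; apply: is_derive_scale; exact: is_derive_expRM.
  rewrite subr_ge0 (le_trans (ler_norm _)) //.
  have := Hh x; rewrite ger0_norm //; apply; exact: le_trans sT.
have pos' (h dh : R -> R) : h 0 = 0 -> (forall s : R, is_derive s 1 h (dh s)) ->
  (forall s, `|s| <= T -> `|dh s| <= C * (K * expR (K * `|s|))) ->
  forall s, 0 <= s -> s <= T -> `|h s| <= C * expR (K * s).
  move=> h0 hdh Hh s s0 sT; rewrite ler_norml (pos h dh) // andbT lerNl.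
  apply: (pos (fun x => - h x) (fun x => - dh x)) => //; first by rewrite h0 oppr0.
  by move=> x xT; rewrite normrN Hh.
move=> g0 gdg Hg s sT; have [s0|s0] := leP 0 s.
  by move: sT; rewrite ger0_norm // => sT; exact: pos' gdg _ _ _ _.
move: sT; rewrite ltr0_norm // => sT; rewrite -[s in `|g s|]opprK.
apply: (pos' (fun x => g (- x)) (fun x => - dg (- x))); rewrite ?oppr0 //.
- exact: is_derive_reflect.
- by move=> x xT; rewrite normrN -(normrN x) Hg // normrN.
- by rewrite oppr_ge0 ltW.
Qed.

(** The Lipschitz constant is uniform in the state on each time interval, so the solution exists for
    all times. Continuity is asked only along continuous curves, which is the form in which the
    equations at hand provide it. *)
Lemma picard (F : R -> 'rV[R]_N -> 'rV[R]_N) (y0 : 'rV[R]_N) :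
  (forall y : R -> 'rV[R]_N, (forall j, continuous (fun s => y s 0 j)) ->
    forall j, continuous (fun s => F s (y s) 0 j)) ->
  (forall T : R, exists L : R, forall s y y', `|s| <= T -> `|F s y' - F s y| <= L * `|y' - y|) ->
  exists y : R -> 'rV[R]_N, y 0 = y0 /\
    forall j (s : R), is_derive s 1 (fun s => y s 0 j) (F s (y s) 0 j).
Proof.
move=> cF lipF.
pose step (y : R -> 'rV[R]_N) s : 'rV[R]_N :=
  \row_j (y0 0 j + oriented_integral 0 s (fun s => F s (y s) 0 j)).
pose cont (y : R -> 'rV[R]_N) := forall j, continuous (fun s => y s 0 j).
have step_derive y : cont y -> forall j (s : R), is_derive s 1 (fun s => step y s 0 j) (F s (y s) 0 j).
  move=> cy j s.
  have -> : (fun s => step y s 0 j) =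
      fun s => y0 0 j + oriented_integral 0 s (fun s => F s (y s) 0 j).
    by apply/funext => z; rewrite mxE.
  apply: is_derive_val (is_derive_add (is_derive_const _ _) (oriented_integral_derive (cF y cy j) s)) _.
  by rewrite add0r.
have step_cont y : cont y -> cont (step y).
  by move=> cy j; exact: derive_continuous (step_derive y cy j).
have step0 y : step y 0 = y0 by apply/rowP => j; rewrite mxE oriented_integral0 addr0.
pose Y k := iter k step (fun=> y0).
have Yc k : cont (Y k) by elim: k => [|k IH]; [move=> j; exact: cst_continuous|exact: step_cont].
have Y0 k : Y k 0 = y0 by case: k => //= k.
have bnd (T : R) : exists D : R, forall s, `|s| <= T -> forall k, `|Y k.+1 s - Y k s| <= D / 2 ^+ k.
  have [L' HL'] := lipF T; pose L := `|L'| + 1.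
  have L0 : 0 < L by rewrite ltr_wpDl.
  have HL s y y' : `|s| <= T -> `|F s y' - F s y| <= L * `|y' - y|.
    by move=> sT; rewrite (le_trans (HL' s y y' sT)) // ler_wpM2r // (le_trans (ler_norm _)) // lerDl.
  have [M HM] : exists M, forall s, `|s| <= T -> `|Y 1%N s - Y 0%N s| <= M.
    have Hj j : exists M, forall s, `|s| <= T -> `|(Y 1%N s - Y 0%N s) 0 j| <= M.
      have cj : {within `[- T, T], continuous (fun s => `|Y 1%N s 0 j - Y 0%N s 0 j|)}.
        apply: continuous_subspaceT => s; apply: cvg_norm.
        by apply: cvgB; exact: Yc.
      have [T0|T0] := leP 0 T; last first.
        by exists 0 => s sT; have := le_lt_trans sT T0; rewrite ltNge normr_ge0.
      have TT : - T <= T by lra.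
      have [c _ Hc] := EVT_max TT cj.
      exists `|Y 1%N c 0 j - Y 0%N c 0 j| => s sT; rewrite row_subE; apply: Hc.
      by rewrite in_itv /= -ler_norml.
    have [M HM] := choice Hj; exists (\sum_j `|M j|) => s sT.
    apply: row_norm_le => [|j]; first exact: sumr_ge0.
    rewrite (le_trans (HM j s sT)) // (le_trans (ler_norm _)) // (bigD1 j) //= lerDl.
    exact: sumr_ge0.
  exists (`|M| * expR (2 * L * T)) => s sT k.
  have T0 : 0 <= T by exact: le_trans sT.
  (* With the weight exp(2L|s|), integration gains 1/(2L) and the field loses L, so that each
     iteration halves the distance. *)
  suff H : `|Y k.+1 s - Y k s| <= `|M| / 2 ^+ k * expR (2 * L * `|s|).
    rewrite (le_trans H) // mulrAC ler_wpM2r ?invr_ge0 ?exprn_ge0 // ler_wpM2l //.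
    by rewrite ler_expR ler_wpM2l // mulr_ge0 // ltW.
  elim: k s sT => [|k IH] s sT.
    rewrite expr0 divr1 (le_trans (HM s sT)) // (le_trans (ler_norm _)) // ler_peMr //.
    by rewrite -expR0 ler_expR !mulr_ge0 // ltW.
  have C0 m : 0 <= `|M| / 2 ^+ m by rewrite mulr_ge0 ?invr_ge0 ?exprn_ge0.
  apply: row_norm_le => [|j]; first by rewrite mulr_ge0 ?expR_ge0.
  rewrite row_subE.
  apply: (@norm_le_expR (fun s => Y k.+2 s 0 j - Y k.+1 s 0 j)
    (fun s => F s (Y k.+1 s) 0 j - F s (Y k s) 0 j) _ _ T) => //.
  - by rewrite mulr_gt0.
  - by rewrite !Y0 subrr.
  - move=> x; exact: is_derive_sub (step_derive (Y k.+1) (Yc _) j x) (step_derive (Y k) (Yc _) j x).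
  - move=> x xT.
    have -> : F x (Y k.+1 x) 0 j - F x (Y k x) 0 j = (F x (Y k.+1 x) - F x (Y k x)) 0 j.
      by rewrite row_subE.
    rewrite (le_trans (coord_le_norm _ _)) // (le_trans (HL _ _ _ xT)) //.
    rewrite exprS invfM [leRHS](_ : _ = L * (`|M| / 2 ^+ k * expR (2 * L * `|x|)));
      last by field; rewrite expf_neq0.
    by rewrite ler_wpM2l ?(ltW L0) // IH.
pose y s : 'rV[R]_N := \row_j limn (fun k => Y k s 0 j).
have lim (T : R) : exists D : R, 0 <= D /\ forall s, `|s| <= T -> forall k, `|y s - Y k s| <= D / 2 ^+ k.
  have [D HD] := bnd T; exists (2 * `|D|); split=> [|s sT k]; first by rewrite mulr_ge0.
  apply: row_norm_le => [|j]; first by rewrite mulr_ge0 ?invr_ge0 ?exprn_ge0 ?mulr_ge0.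
  rewrite row_subE [y s 0 j]mxE; apply: (@geometric_lim (fun k => Y k s 0 j)) => m.
  have := HD s sT m; rewrite (_ : Y m.+1 s 0 j - _ = (Y m.+1 s - Y m s) 0 j); last by rewrite row_subE.
  move=> H; apply: (le_trans (coord_le_norm _ _)); apply: (le_trans H).
  by rewrite ler_wpM2r ?invr_ge0 ?exprn_ge0 // ler_norm.
have small (D e : R) : 0 <= D -> 0 < e -> exists k : nat, D / 2 ^+ k <= e.
  move=> D0 e0.
  have : (fun k => D / 2 ^+ k) @ \oo --> (0 : R).
    have := @cvg_geometric R D (2^-1) _; rewrite /geometric /=.
    under eq_fun do rewrite exprVn; apply.
    by rewrite ger0_norm // invf_lt1 // ltr1n.
  move=> /cvgrPdist_le /(_ e e0) [m _ /(_ m (leqnn m))] /=.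
  by rewrite sub0r normrN => Hm; exists m; exact: le_trans (ler_norm _) Hm.
have yc : cont y.
  move=> j s0; apply/cvgrPdist_le => e e0.
  have [D [D0 HD]] := lim (`|s0| + 1).
  have e3 : 0 < e / 3 by rewrite divr_gt0.
  have [k Hk] := small D (e / 3) D0 e3.
  have := Yc k j s0 => /cvgrPdist_le /(_ (e / 3) e3) HY.
  near=> s.
  have sT : `|s| <= `|s0| + 1.
    by apply: ltW; near: s; apply: near_norm_lt; rewrite ltrDl.
  have s0T : `|s0| <= `|s0| + 1 by rewrite lerDl.
  have H1 := le_trans (coord_le_norm _ j) (le_trans (HD s0 s0T k) Hk).
  have H2 := le_trans (coord_le_norm _ j) (le_trans (HD s sT k) Hk).
  have H3 : `|Y k s0 0 j - Y k s 0 j| <= e / 3 by near: s.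
  move: H1 H2 H3; rewrite !row_subE !ler_norml.
  by move=> /andP[? ?] /andP[? ?] /andP[? ?]; apply/andP; split; lra.
have yE s : y s = step y s.
  apply/eqP; rewrite -subr_eq0 -normr_le0; apply/ler_addgt0Pr => e e0; rewrite add0r.
  have [D [D0 HD]] := lim `|s|; have [L' HL'] := lipF `|s|; pose L := `|L'|.
  have HL x z z' : `|x| <= `|s| -> `|F x z' - F x z| <= L * `|z' - z|.
    by move=> xs; rewrite (le_trans (HL' x z z' xs)) // ler_wpM2r // ler_norm.
  have L0 : 0 <= L by exact: normr_ge0.
  have [k Hk] := small (D + L * D * `|s|) e (addr_ge0 D0 (mulr_ge0 (mulr_ge0 L0 D0) (normr_ge0 _))) e0.
  apply: le_trans Hk.
  (* [Y k.+1] is [step (Y k)]: the first difference is the distance of an iterate from the limit,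
     the second is controlled by integrating the Lipschitz bound over a time [|s|]. *)
  have -> : y s - step y s = (y s - Y k.+1 s) - (step y s - step (Y k) s).
    by rewrite /= opprB addrA subrK.
  rewrite (le_trans (ler_normB _ _)) // mulrDl lerD //.
    rewrite (le_trans (HD s (lexx _) k.+1)) // ler_wpM2l // lef_pV2 ?posrE ?exprn_gt0 //.
    by rewrite ler_weXn2l // ler1n.
  apply: row_norm_le => [|j]; first by rewrite !mulr_ge0 ?invr_ge0 ?exprn_ge0.
  rewrite row_subE.
  pose g (s : R) := step y s 0 j - step (Y k) s 0 j.
  have gd (x : R) : is_derive x 1 g (F x (y x) 0 j - F x (Y k x) 0 j).
    exact: is_derive_sub (step_derive y yc j x) (step_derive (Y k) (Yc k) j x).
  have bg (x : R) : `|x| <= `|s| -> `|F x (y x) 0 j - F x (Y k x) 0 j| <= L * D / 2 ^+ k.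
    move=> xs; have -> : F x (y x) 0 j - F x (Y k x) 0 j = (F x (y x) - F x (Y k x)) 0 j.
      by rewrite row_subE.
    rewrite (le_trans (coord_le_norm _ _)) // (le_trans (HL _ _ _ xs)) // -mulrA ler_wpM2l //.
    exact: HD.
  have := mvt_norm gd bg (x := 0) (y := s); rewrite normr0 => /(_ (normr_ge0 _) (lexx _)).
  rewrite /g !step0 subrr !subr0 => /le_trans; apply.
  by rewrite mulrAC.
exists y; split; first by rewrite yE step0.
move=> j s; have -> : (fun s => y s 0 j) = (fun s => step y s 0 j).
  by apply/funext => z; rewrite -yE.
exact: (step_derive y yc j s).
Unshelve. all: by end_near. Qed.

End Picard.

(** * Linear equations with parameters *)

Section JointVariable.
Context {R : realType} {m : nat}.
Implicit Types (q : 'rV[R]_m) (s : R) (p : 'rV[R]_(m + 1)).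

(** Parameters first and time last. For the flow the parameter [q] is itself a space-time point, the
    starting point, and [s] is the time elapsed since. *)
Definition joint q s : 'rV[R]_(m + 1) := row_mx q (const_mx s).
Definition space_part p : 'rV[R]_m := lsubmx p.
Definition time_part p : R := p 0 (rshift m ord0).

Lemma space_joint q s : space_part (joint q s) = q.
Proof. exact: row_mxKl. Qed.

Lemma time_joint q s : time_part (joint q s) = s.
Proof. by rewrite /time_part row_mxEr mxE. Qed.

Lemma joint_split p : joint (space_part p) (time_part p) = p.
Proof.
rewrite -[RHS]hsubmxK; congr row_mx; apply/rowP => i.
by rewrite !mxE ord1; congr (p 0 _); apply: val_inj.
Qed.

Lemma norm_joint q s : `|joint q s| = `|(q, s)|.
Proof.
rewrite prod_normE /=; apply/eqP; rewrite eq_le; apply/andP; split.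
  apply: row_norm_le => [|i]; first by rewrite le_max normr_ge0.
  rewrite -(splitK i); case: (fintype.split i) => j /=; rewrite le_max.
    by rewrite row_mxEl coord_le_norm.
  by rewrite row_mxEr mxE lexx orbT.
rewrite ge_max; apply/andP; split.
  apply: row_norm_le => // i.
  by have := coord_le_norm (joint q s) (lshift 1 i); rewrite row_mxEl.
by have := coord_le_norm (joint q s) (rshift m ord0); rewrite row_mxEr mxE.
Qed.

Lemma joint_sub q q' s : joint q' s - joint q s = joint (q' - q) 0.
Proof.
rewrite /joint opp_row_mx add_row_mx; congr row_mx; apply/rowP => i.
by rewrite !mxE subrr.
Qed.

Lemma norm_joint0 q : `|joint q 0| = `|q|.
Proof. by rewrite norm_joint prod_normE /= normr0 max_l. Qed.

Lemma sum_joint q s (f : 'I_(m + 1) -> R) :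
  \sum_i joint q s 0 i * f i = \sum_i q 0 i * f (lshift 1 i) + s * f (rshift m ord0).
Proof.
rewrite big_split_ord /= big_ord_recl big_ord0 addr0 row_mxEr mxE.
by congr (_ + _); apply: eq_bigr => i _; rewrite row_mxEl.
Qed.

Lemma space_part_norm p : `|space_part p| <= `|p|.
Proof. by rewrite -[p in leRHS]joint_split norm_joint prod_normE /= le_max lexx. Qed.

Lemma time_part_norm p : `|time_part p| <= `|p|.
Proof. by rewrite -[p in leRHS]joint_split norm_joint prod_normE /= le_max lexx orbT. Qed.

Lemma space_partB p p' : space_part p' - space_part p = space_part (p' - p).
Proof. by rewrite /space_part linearB. Qed.

Lemma time_partB p p' : time_part p' - time_part p = time_part (p' - p).
Proof. by rewrite /time_part !mxE. Qed.

End JointVariable.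

(** * Regularity jointly in parameters and time *)

Section JointRegularity.
Context {R : realType} (B : bound_class R) {m : nat}.
Local Notation V := 'rV[R]_m.
Local Notation rnet d := (eps_index R -> 'rV[R]_d -> R).
Implicit Types (u rho : eps_index R -> V -> R -> R).

Definition uncurry_time u : rnet (m + 1) := fun e p => u e (space_part p) (time_part p).

Lemma locO_uncurry u :
  @locO R B (V * R)%type (fun e t => u e t.1 t.2) (fun _ _ => 1) -> bigO1 B (uncurry_time u).
Proof.
apply: (locO_pull (phi := fun p => (space_part p, time_part p))) => r; exists r => p pr.
by rewrite prod_normE ge_max /= !(le_trans _ pr) ?space_part_norm ?time_part_norm.
Qed.

Lemma locO_curry f : bigO1 B f ->
  @locO R B (V * R)%type (fun e t => f e (joint t.1 t.2)) (fun _ _ => 1).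
Proof.
apply: (locO_pull (phi := fun t => joint t.1 t.2)) => r; exists r => -[q s] /=.
by rewrite norm_joint.
Qed.

Definition space_incr (u : eps_index R -> V -> R -> R) :
  eps_index R -> (V * V) * R -> R := fun e t => u e t.1.2 t.2 - u e t.1.1 t.2.

Lemma joint_pair_norm r (t : (V * V) * R) : `|t| <= r ->
  `|(joint t.1.1 t.2, joint t.1.2 t.2)| <= r.
Proof.
move: t => [[q q'] s]; rewrite !prod_normE /= !norm_joint !prod_normE /= !ge_max.
by move=> /andP[/andP[-> ->] ->].
Qed.

Lemma locLip_space (f : rnet (m + 1)) : locLip B f ->
  @locO R B ((V * V) * R)%type (fun e t => f e (joint t.1.2 t.2) - f e (joint t.1.1 t.2))
    (fun _ t => `|t.1.2 - t.1.1|).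
Proof.
move=> lf.
have := locO_pull (T' := ((V * V) * R)%type)
  (phi := fun t => (joint t.1.1 t.2, joint t.1.2 t.2)) _ lf => /=.
move=> /(_ (fun r => ex_intro _ r (@joint_pair_norm r))).
move=> H; apply: (locO_trans H); apply: locO_le => e t.
by rewrite joint_sub norm_joint0 normr_id.
Qed.

Lemma locD1_space (f : rnet (m + 1)) g : locD1 B f g ->
  @locO R B ((V * V) * R)%type (fun e t => f e (joint t.1.2 t.2) - f e (joint t.1.1 t.2) -
      \sum_i (t.1.2 - t.1.1) 0 i * g (lshift 1 i) e (joint t.1.1 t.2))
    (fun _ t => `|t.1.2 - t.1.1| ^+ 2).
Proof.
move=> lf.
have := locO_pull (T' := ((V * V) * R)%type)
  (phi := fun t => (joint t.1.1 t.2, joint t.1.2 t.2)) _ lf => /=.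
move=> /(_ (fun r => ex_intro _ r (@joint_pair_norm r))).
move=> H; apply: (@locO_eq _ _ _ _ _ _ _ (locO_trans H _)); last first.
  apply: (@locO_le _ _ _ _ (fun _ t => `|t.1.2 - t.1.1| ^+ 2)) => e t.
  by rewrite joint_sub norm_joint0 normrX normr_id.
by move=> e t /=; rewrite joint_sub sum_joint mul0r addr0.
Qed.

Lemma mvt_between (f df : R -> R) (x y : R) : (forall z : R, is_derive z 1 f (df z)) ->
  exists c, [/\ `|c - x| <= `|y - x|, (forall T, `|x| <= T -> `|y| <= T -> `|c| <= T)
    & f y - f x = df c * (y - x)].
Proof.
move=> fdf; have [xy|/ltW yx] := leP x y.
  have [c cxy E] := mvt xy (fun z _ => fdf z); exists c; split=> //.
    by move/andP: cxy => [xc cy]; rewrite !ger0_norm ?subr_ge0 // lerB.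
  by move=> T xT yT; exact: itv_norm_le xT yT cxy.
have [c cxy E] := mvt yx (fun z _ => fdf z); exists c; split=> //.
- by move/andP: cxy => [xc cy]; rewrite distrC (distrC y) !ger0_norm ?subr_ge0 // lerB.
- by move=> T xT yT; exact: itv_norm_le yT xT cxy.
- by apply: oppr_inj; rewrite opprB E -mulrN opprB.
Qed.

Section TimeDerivative.
Variables u rho : eps_index R -> V -> R -> R.
Hypothesis urho : forall e q (s : R), is_derive s 1 (u e q) (rho e q s).

(** The increment is split into a step in time at the new parameter, bounded through [rho] by the
    mean value theorem, and a step in the parameter at the old time. *)
Lemma locLip_uncurry : bigO1 B (uncurry_time rho) ->
  @locO R B ((V * V) * R)%type (space_incr u) (fun _ t => `|t.1.2 - t.1.1|) ->
  locLip B (uncurry_time u).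
Proof.
move=> rho0 lu.
pose phi (t : 'rV[R]_(m + 1) * 'rV[R]_(m + 1)) := ((space_part t.1, space_part t.2), time_part t.1).
have Hphi r : exists r', forall t, `|t| <= r -> `|phi t| <= r'.
  exists r => -[p p']; rewrite !prod_normE /= !ge_max => /andP[pr p'r].
  by rewrite (le_trans (space_part_norm p) pr) (le_trans (space_part_norm p') p'r)
    (le_trans (time_part_norm p) pr).
have H1 := locO_pull (phi := phi) Hphi lu.
have H2 : @locO R B ('rV[R]_(m + 1) * 'rV[R]_(m + 1))%type
    (fun e t => u e (space_part t.2) (time_part t.2) - u e (space_part t.2) (time_part t.1))
    (fun _ t => `|t.2 - t.1|).
  move=> r; have [C BC HC] := rho0 r; exists C => // e [p p'].
  rewrite prod_normE ge_max /= => /andP[pr p'r].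
  have [c [_ cr ->]] := mvt_between (time_part p) (time_part p') (urho e (space_part p')).
  rewrite normrM ler_pM // ?time_partB ?time_part_norm //.
  have := HC e (joint (space_part p') c); rewrite /uncurry_time space_joint time_joint mulr1; apply.
  rewrite norm_joint prod_normE ge_max /= (le_trans (space_part_norm _) p'r) /=.
  by apply: cr; exact: le_trans (time_part_norm _) _.
apply: (locO_eq _ (locO_add H2 (locO_trans H1 _))) => [e t|].
  by rewrite /space_incr /= addrA subrK.
apply: locO_le => e t; rewrite normr_id /= space_partB; exact: space_part_norm.
Qed.

Definition joint_gradient (g : 'I_m -> eps_index R -> V -> R -> R)
    (i : 'I_(m + 1)) : rnet (m + 1) :=
  match fintype.split i with inl j => uncurry_time (g j) | inr _ => uncurry_time rho end.

(** Three quadratic errors add up: the time remainder at the new parameter, the time increment times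
    the change of [rho] between the two parameters, and the parameter remainder at the old time. *)
Lemma locD1_uncurry (g : 'I_m -> eps_index R -> V -> R -> R) :
  locLip B (uncurry_time rho) ->
  @locO R B ((V * V) * R)%type
    (fun e t => space_incr u e t - \sum_i (t.1.2 - t.1.1) 0 i * g i e t.1.1 t.2)
    (fun _ t => `|t.1.2 - t.1.1| ^+ 2) ->
  locD1 B (uncurry_time u) (joint_gradient g).
Proof.
move=> lrho lu.
pose W := 'rV[R]_(m + 1).
pose phi (t : W * W) := ((space_part t.1, space_part t.2), time_part t.1).
have Hphi r : exists r', forall t, `|t| <= r -> `|phi t| <= r'.
  exists r => -[p p']; rewrite !prod_normE /= !ge_max => /andP[pr p'r].
  by rewrite (le_trans (space_part_norm p) pr) (le_trans (space_part_norm p') p'r)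
    (le_trans (time_part_norm p) pr).
have H1 := locO_pull (phi := phi) Hphi lu.
have small : @locO R B (W * W)%type (fun _ t => `|space_part t.2 - space_part t.1|)
    (fun _ t => `|t.2 - t.1|).
  by apply: locO_le => e t; rewrite normr_id space_partB; exact: space_part_norm.
have tsmall : @locO R B (W * W)%type (fun _ t => time_part t.2 - time_part t.1)
    (fun _ t => `|t.2 - t.1|).
  by apply: locO_le => e t; rewrite time_partB; exact: time_part_norm.
have H2 := locO_mul tsmall (locO_trans (locO_pull (phi := phi) Hphi (locLip_space lrho)) small).
have H3 : @locO R B (W * W)%type
    (fun e t => u e (space_part t.2) (time_part t.2) - u e (space_part t.2) (time_part t.1) -
      (time_part t.2 - time_part t.1) * rho e (space_part t.2) (time_part t.1))
    (fun _ t => `|t.2 - t.1| ^+ 2).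
  move=> r; have [C BC HC] := lrho r; exists C => // e [p p'].
  rewrite prod_normE ge_max /= => /andP[pr p'r].
  have [c [cp cr ->]] := mvt_between (time_part p) (time_part p') (urho e (space_part p')).
  rewrite mulrC -mulrBr normrM expr2 mulrA mulrAC [leRHS]mulrC ler_pM //.
    by rewrite time_partB time_part_norm.
  have := HC e (joint (space_part p') (time_part p), joint (space_part p') c).
  rewrite /uncurry_time !space_joint !time_joint => H.
  apply: (le_trans (H _)).
    have p1 := le_trans (time_part_norm p) pr; have p2 := le_trans (time_part_norm p') p'r.
    rewrite prod_normE ge_max /= !norm_joint !prod_normE !ge_max /=.
    by rewrite (le_trans (space_part_norm _) p'r) p1 (cr _ p1 p2).
  rewrite ler_wpM2l ?(bounds_ge0 BC) // /joint opp_row_mx add_row_mx subrr.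
  have -> : row_mx 0 (const_mx c - const_mx (time_part p)) = joint (0 : V) (c - time_part p).
    by congr row_mx; apply/rowP => i; rewrite !mxE.
  rewrite norm_joint prod_normE /= normr0 max_r // (le_trans cp) // time_partB.
  exact: time_part_norm.
have small2 := locO_mul small small.
apply: (locO_eq _ (locO_add (locO_add H3 H2) (locO_trans H1 small2))) => e [p p'] /=.
rewrite /space_incr /=.
have -> : \sum_i (p' - p) 0 i * joint_gradient g i e p =
    \sum_i (space_part p' - space_part p) 0 i * g i e (space_part p) (time_part p) +
    (time_part p' - time_part p) * rho e (space_part p) (time_part p).
  rewrite space_partB time_partB -{1}[p' - p]joint_split sum_joint.
  congr (_ + _); last first.
    rewrite /joint_gradient.
    by have -> : fintype.split (rshift m ord0) = inr (ord0 : 'I_1) by exact: (unsplitK (inr ord0)).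
  apply: eq_bigr => i _; congr (_ * _); rewrite /joint_gradient.
  have -> : fintype.split (lshift 1 i) = inl i by exact: (unsplitK (inl i)).
  by [].
rewrite /uncurry_time !space_joint !time_joint; ring.
Qed.

End TimeDerivative.

(** Since [L] is logarithmic relative to [B], the factor exp((2NL + 1) r) of [gronwall] lies in [B].
    The weight [Y] does not depend on time; with [Y] equal to 1, to the parameter increment and to
    its square, the same statement yields bounds, Lipschitz estimates and Taylor remainders. *)
Lemma gronwall_loc (T : normedModType R) N (D dD rho : 'I_N -> eps_index R -> T -> R -> R)
    (Y : eps_index R -> T -> R) :
  (forall e t, 0 <= Y e t) ->
  (forall j e t (s : R), is_derive s 1 (D j e t) (dD j e t s)) ->
  (forall r, exists2 L, exp_bounds B L & forall e t s j, `|t| <= r -> `|s| <= r ->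
    `|dD j e t s| <= L e * \sum_k `|D k e t s| + `|rho j e t s|) ->
  (forall j, @locO R B (T * R)%type (fun e t => rho j e t.1 t.2) (fun e t => Y e t.1)) ->
  (forall j, locO B (fun e t => D j e t 0) Y) ->
  forall j, @locO R B (T * R)%type (fun e t => D j e t.1 t.2) (fun e t => Y e t.1).
Proof.
move=> Y0 DdD HL Hrho HD j r.
have [L [L0 HL1] HL2] := HL r.
have [C0 BC0 HC0] := locO_sum Y0 (fun j => locO_norm (HD j)) r.
have [C1 BC1 HC1] := locO_sum (Y := fun e (t : T * R) => Y e t.1)
  (fun e t => Y0 e t.1) (fun j => locO_norm (Hrho j)) r.
exists (fun e => N%:R * (C0 e + C1 e) * (expR (2 * N%:R * `|r| * L e) * expR `|r|)).
  apply: boundsM; first apply: boundsM; last apply: boundsM.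
  - exact: bounds_cst.
  - exact: boundsD.
  - by apply: HL1; rewrite !mulr_ge0.
  - by apply: bounds_cst; exact: expR_ge0.
move=> e [t s]; rewrite prod_normE ge_max /= => /andP[tr sr].
have r0 : 0 <= r by exact: le_trans sr.
have c0 := bounds_ge0 BC0 e; have c1 := bounds_ge0 BC1 e.
have := @gronwall R N (fun j => D j e t) (fun j => dD j e t) (L e) (C1 e * Y e t) (C0 e * Y e t) r
  (L0 e) (mulr_ge0 c1 (Y0 e t)) (mulr_ge0 c0 (Y0 e t)) (fun j => DdD j e t) _ _ j s sr.
have -> : N%:R * (C0 e * Y e t + C1 e * Y e t) * expR ((2 * N%:R * L e + 1) * r) =
    N%:R * (C0 e + C1 e) * (expR (2 * N%:R * `|r| * L e) * expR `|r|) * Y e t.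
  rewrite -expRD ger0_norm // (_ : (2 * N%:R * L e + 1) * r = 2 * N%:R * r * L e + r); last by ring.
  by ring.
apply.
- move=> k x xr; rewrite (le_trans (HL2 e t x k tr xr)) // lerD2l.
  have xtr : `|(t, x)| <= r by rewrite prod_normE ge_max /= tr.
  apply: le_trans (HC1 e (t, x) xtr); rewrite /= [leRHS]ger0_norm ?sumr_ge0 //.
  by rewrite (bigD1 k) //= lerDl sumr_ge0.
- move=> k; apply: le_trans (HC0 e t tr); rewrite [leRHS]ger0_norm ?sumr_ge0 //.
  by rewrite (bigD1 k) //= lerDl sumr_ge0.
Qed.

End JointRegularity.

Section LinearEquation.
Context {R : realType} (B : bound_class R) {m N : nat}.
Local Notation V := 'rV[R]_m.
Local Notation rnet d := (eps_index R -> 'rV[R]_d -> R).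

Lemma near_dist_le (x d : R) : 0 < d -> \forall t \near x, `|x - t| <= d.
Proof.
by move=> d0; have /cvgrPdist_le /(_ d d0) : id @ x --> x by exact: cvg_id.
Qed.

Lemma continuous_bigsum (T : topologicalType) M (f : 'I_M -> T -> R) : (forall k, continuous (f k)) ->
  continuous (fun s => \sum_k f k s).
Proof.
move=> cf; elim: (index_enum _) => [|k r IH].
  rewrite (_ : (fun _ => _) = fun=> 0); first exact: cst_continuous.
  by apply/funext => s; rewrite big_nil.
rewrite (_ : (fun _ => _) = (fun s => f k s + \sum_(i <- r) f i s)).
  by move=> s; apply: cvgD; [exact: cf|exact: IH].
by apply/funext => s; rewrite big_cons.
Qed.

Lemma regular_continuous_time k (f : rnet (m + 1)) e q : regular B k f ->
  continuous (fun s => f e (joint q s)).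
Proof.
move=> /regular_Lip lf s.
have [C BC HC] := lf (`|q| + (`|s| + 1)).
apply/cvgrPdist_le => d d0.
have C1 : 0 < C e + 1 by rewrite ltr_wpDl ?(bounds_ge0 BC).
have dC : 0 < d / (C e + 1) by rewrite divr_gt0.
near=> s'.
have s'1 : `|s'| <= `|s| + 1.
  by apply: ltW; near: s'; apply: near_norm_lt; rewrite ltrDl.
have H := HC e (joint q s', joint q s).
rewrite (le_trans (H _)) //.
  rewrite prod_normE ge_max /= !norm_joint !prod_normE !ge_max /=.
  have q0 := normr_ge0 q; have s0 := normr_ge0 s.
  by do ![apply/andP; split]; lra.
have -> : joint q s - joint q s' = joint 0 (s - s').
  rewrite /joint opp_row_mx add_row_mx subrr; congr row_mx.
  by apply/rowP => i; rewrite !mxE.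
rewrite norm_joint prod_normE /= normr0 max_r //.
apply: (@le_trans _ _ ((C e + 1) * `|s - s'|)); first by rewrite ler_wpM2r // lerDl.
by rewrite mulrC -ler_pdivlMr //; near: s'; exact: near_dist_le.
Unshelve. all: by end_near. Qed.

Definition linear_ode (A : 'I_N -> 'I_N -> rnet (m + 1)) (r : 'I_N -> rnet (m + 1))
    (w0 : 'I_N -> rnet m) (w : 'I_N -> eps_index R -> V -> R -> R) :=
  (forall j e q, w j e q 0 = w0 j e q) /\
  forall j e q (s : R), is_derive s 1 (w j e q)
    (\sum_k A j k e (joint q s) * w k e q s + r j e (joint q s)).

Lemma linear_ode_exists A r w0 : (forall j k, regular B 0 (A j k)) ->
  (forall j, regular B 0 (r j)) -> exists w, linear_ode A r w0 w.
Proof.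
move=> regA regr.
pose F e q s (v : 'rV[R]_N) : 'rV[R]_N :=
  \row_j (\sum_k A j k e (joint q s) * v 0 k + r j e (joint q s)).
have H e q : exists y : R -> 'rV[R]_N, y 0 = \row_j w0 j e q /\
    forall j (s : R), is_derive s 1 (fun s => y s 0 j) (F e q s (y s) 0 j).
  apply: (@picard R N (F e q)) => [y cy j|T].
    rewrite (_ : (fun _ => _) = fun s =>
        \sum_k A j k e (joint q s) * y s 0 k + r j e (joint q s)); last first.
      by apply/funext => s; rewrite mxE.
    move=> s; apply: cvgD; last exact: regular_continuous_time (regr j) s.
    apply: (continuous_bigsum (f := fun k s => A j k e (joint q s) * y s 0 k)) => k {}s.
    by apply: cvgM; [exact: regular_continuous_time (regA j k) s|exact: cy].
  have HA j k : exists M, forall s, `|s| <= T -> `|A j k e (joint q s)| <= M.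
    have [C BC HC] := regular_O1 (regA j k) (`|q| + `|T|).
    exists (C e) => s sT; rewrite -[C e]mulr1; apply: HC.
    rewrite norm_joint prod_normE ge_max /= lerDl normr_ge0 /=.
    by rewrite ler_wpDl // (le_trans sT) // ler_norm.
  have [M HM] := choice (fun jk : 'I_N * 'I_N => HA jk.1 jk.2).
  exists (\sum_j \sum_k `|M (j, k)|) => s y y' sT; rewrite /F.
  apply: row_norm_le => [|j].
    by rewrite mulr_ge0 // sumr_ge0 // => j _; apply: sumr_ge0.
  rewrite !mxE opprD addrACA subrr addr0 -sumrB.
  rewrite (le_trans (ler_norm_sum _ _ _)) //.
  apply: (@le_trans _ _ (\sum_k `|M (j, k)| * `|y' - y|)).
    apply: ler_sum => k _; rewrite -mulrBr normrM ler_pM //.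
      by rewrite (le_trans (HM (j, k) s sT)) // ler_norm.
    by rewrite -row_subE coord_le_norm.
  rewrite -mulr_suml ler_wpM2r // [leRHS](bigD1 j) //= lerDl sumr_ge0 // => i _.
  exact: sumr_ge0.
have [Y HY] : {Y : eps_index R * V -> R -> 'rV[R]_N & forall eq,
    Y eq 0 = \row_j w0 j eq.1 eq.2 /\
    forall j (s : R), is_derive s 1 (fun s => Y eq s 0 j) (F eq.1 eq.2 s (Y eq s) 0 j)}.
  by apply: (choice (P := fun eq (y : R -> 'rV[R]_N) => y 0 = \row_j w0 j eq.1 eq.2 /\
    forall j (s : R), is_derive s 1 (fun s => y s 0 j) (F eq.1 eq.2 s (y s) 0 j)))
    => -[e q]; exact: H.
exists (fun j e q s => Y (e, q) s 0 j); split=> [j e q|j e q s].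
  by rewrite (HY (e, q)).1 mxE.
by apply: is_derive_val ((HY (e, q)).2 j s) _; rewrite mxE.
Qed.

End LinearEquation.

Section LinearRegularity.
Context {R : realType} (B : bound_class R) {m N : nat}.
Local Notation V := 'rV[R]_m.
Local Notation rnet d := (eps_index R -> 'rV[R]_d -> R).

Definition log_bounded {d} (f : rnet d) :=
  forall r, exists2 L, exp_bounds B L & forall e p, `|p| <= r -> `|f e p| <= L e.

Lemma log_bounded_uniform {d} (I : finType) (f : I -> rnet d) r :
  (forall i, log_bounded (f i)) ->
  exists2 L, exp_bounds B L & forall i e p, `|p| <= r -> `|f i e p| <= L e.
Proof.
move=> Hf.
have [L HL] := choice (P := fun i L => exp_bounds B L /\
    forall e p, `|p| <= r -> `|f i e p| <= L e)
  (fun i => let: ex_intro2 L H1 H2 := Hf i r in ex_intro _ L (conj H1 H2)).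
exists (fun e => \sum_i L i e).
  elim: (index_enum _) => [|i s IH].
    by under eq_fun do rewrite big_nil; exact: exp_bounds_cst.
  by under eq_fun do rewrite big_cons; apply: exp_boundsD => //; exact: (HL _).1.
move=> i e p pr; apply: (le_trans ((HL i).2 e _ pr)).
by rewrite (bigD1 i) //= lerDl sumr_ge0 // => j _; exact: (HL j).1.1.
Qed.

Lemma log_bounded_joint (A : 'I_N -> 'I_N -> rnet (m + 1)) r :
  (forall j k, log_bounded (A j k)) ->
  exists2 L, exp_bounds B L & forall j k e q s, `|q| <= r -> `|s| <= r ->
    `|A j k e (joint q s)| <= L e.
Proof.
move=> HA.
have [L BL HL] := log_bounded_uniform r (fun jk : 'I_N * 'I_N => HA jk.1 jk.2).
exists L => // j k e q s qr sr; apply: (HL (j, k)).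
by rewrite norm_joint prod_normE ge_max /= qr.
Qed.

Lemma uncurry_joint (u : eps_index R -> V -> R -> R) e q s :
  uncurry_time u e (joint q s) = u e q s.
Proof. by rewrite /uncurry_time space_joint time_joint. Qed.

Lemma joint_gradient_regular k (rho : eps_index R -> V -> R -> R) g :
  regular B k (uncurry_time rho) -> (forall i, regular B k (uncurry_time (g i))) ->
  forall i, regular B k (joint_gradient rho g i).
Proof.
by move=> Hrho Hg i; rewrite /joint_gradient; case: fintype.split.
Qed.

Section Estimates.
Variables (A : 'I_N -> 'I_N -> rnet (m + 1)) (r : 'I_N -> rnet (m + 1)) (w0 : 'I_N -> rnet m).
Variable w : 'I_N -> eps_index R -> V -> R -> R.
Hypothesis logA : forall j k, log_bounded (A j k).
Hypothesis w_ode : linear_ode A r w0 w.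
Hypothesis regA : forall j k, regular B 0 (A j k).
Hypothesis regr : forall j, regular B 0 (r j).
Hypothesis regw0 : forall j, regular B 0 (w0 j).

Let rhs j e q s := \sum_k A j k e (joint q s) * w k e q s + r j e (joint q s).

Lemma linear_row_le j e q s (u : 'I_N -> R) (L : R) :
  (forall k, `|A j k e (joint q s)| <= L) ->
  `|\sum_k A j k e (joint q s) * u k| <= L * \sum_k `|u k|.
Proof.
move=> HL; rewrite (le_trans (ler_norm_sum _ _ _)) // mulr_sumr ler_sum // => k _.
by rewrite normrM ler_wpM2r.
Qed.

Lemma linear_O1 j : bigO1 B (uncurry_time (w j)).
Proof.
apply: locO_uncurry.
apply: (@gronwall_loc R B V N w rhs (fun j e q s => r j e (joint q s)) (fun _ _ => 1)).
- by [].
- by move=> k e q s; exact: w_ode.2.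
- move=> T; have [L eL HL] := log_bounded_joint T logA; exists L => // e q s k qT sT.
  rewrite (le_trans (ler_normD _ _)) // lerD2r linear_row_le // => l; exact: HL.
- by move=> k; exact: locO_curry (regular_O1 (regr k)).
- by move=> k; apply: (locO_eq _ (regular_O1 (regw0 k))) => e q; rewrite w_ode.1.
Qed.

Lemma linear_rhs_O1 j : bigO1 B (uncurry_time (rhs j)).
Proof.
apply: locO_add.
  apply: locO_sum => // k; apply: locO_mulr; last exact: linear_O1.
  by apply: (locO_eq _ (regular_O1 (regA j k))) => e p; rewrite joint_split.
by apply: (locO_eq _ (regular_O1 (regr j))) => e p; rewrite joint_split.
Qed.

Lemma locO_incr_snd k : @locO R B ((V * V) * R)%type (fun e t => w k e t.1.2 t.2) (fun _ _ => 1).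
Proof.
have := locO_curry (linear_O1 k).
move=> /(locO_pull (T' := ((V * V) * R)%type) (phi := fun t => (t.1.2, t.2))) H.
apply: (locO_eq _ (H _)) => [e t|T]; first by rewrite uncurry_joint.
exists T => -[[q q'] s]; rewrite !prod_normE /= !ge_max => /andP[/andP[_ ->] ->] //.
Qed.

Lemma locO_incr_fst k : @locO R B ((V * V) * R)%type (fun e t => w k e t.1.1 t.2) (fun _ _ => 1).
Proof.
have := locO_curry (linear_O1 k).
move=> /(locO_pull (T' := ((V * V) * R)%type) (phi := fun t => (t.1.1, t.2))) H.
apply: (locO_eq _ (H _)) => [e t|T]; first by rewrite uncurry_joint.
exists T => -[[q q'] s]; rewrite !prod_normE /= !ge_max => /andP[/andP[-> _] ->] //.
Qed.

(** The difference of two solutions solves the equation with the matrix at the first parameter; the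
    increments of the matrix and of [r] go into the inhomogeneity. So only the size of [A], which is
    logarithmic, enters the exponential. *)
Lemma linear_incr j :
  @locO R B ((V * V) * R)%type (space_incr (w j)) (fun _ t => `|t.1.2 - t.1.1|).
Proof.
apply: (@gronwall_loc R B (V * V)%type N (fun j e t s => w j e t.2 s - w j e t.1 s)
  (fun j e t s => rhs j e t.2 s - rhs j e t.1 s)
  (fun j e t s => \sum_k (A j k e (joint t.2 s) - A j k e (joint t.1 s)) * w k e t.2 s +
     (r j e (joint t.2 s) - r j e (joint t.1 s))) (fun _ t => `|t.2 - t.1|)).
- by [].
- by move=> k e t s; apply: is_derive_sub; exact: w_ode.2.
- move=> T; have [L eL HL] := log_bounded_joint T logA; exists L => // e [q q'] s k.
  rewrite prod_normE ge_max /= => /andP[qT q'T] sT.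
  rewrite (_ : rhs k e q' s - rhs k e q s =
      \sum_l A k l e (joint q s) * (w l e q' s - w l e q s) +
      (\sum_l (A k l e (joint q' s) - A k l e (joint q s)) * w l e q' s +
      (r k e (joint q' s) - r k e (joint q s)))).
    rewrite (le_trans (ler_normD _ _)) // lerD2r.
    by apply: (@linear_row_le k e q s (fun l => w l e q' s - w l e q s)) => l; exact: HL.
  rewrite /rhs addrA -big_split /=.
  under [X in _ = X + _]eq_bigr do rewrite mulrBr mulrBl addrC addrA subrK.
  by rewrite sumrB; ring.
- move=> k; apply: locO_add; last exact: locLip_space (regular_Lip (regr k)).
  apply: locO_sum => // l; apply: locO_mulr; last exact: locO_incr_snd.
  exact: locLip_space (regular_Lip (regA k l)).
- move=> k; apply: (locO_eq _ (regular_Lip (regw0 k))) => e t /=.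
  by rewrite !w_ode.1.
Qed.

Lemma linear_Lip j : locLip B (uncurry_time (w j)).
Proof.
apply: (locLip_uncurry (rho := rhs j)).
- by move=> e q s; exact: w_ode.2.
- exact: linear_rhs_O1.
- exact: linear_incr.
Qed.

Lemma linear_regular0 j : regular B 0 (uncurry_time (w j)).
Proof. by split=> //; [exact: linear_O1|exact: linear_Lip]. Qed.

Lemma linear_rhs_regular k j : (forall j l, regular B k (A j l)) ->
  (forall j, regular B k (r j)) -> (forall j, regular B k (uncurry_time (w j))) ->
  regular B k (uncurry_time (rhs j)).
Proof.
move=> kA kr kw.
have -> : uncurry_time (rhs j) = fun e p => \sum_l A j l e p * uncurry_time (w l) e p + r j e p.
  by apply/funext => e; apply/funext => p; rewrite /uncurry_time /rhs joint_split.
by apply: regularD => //; apply: regular_sum => l; exact: regularM.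
Qed.

(* The derivatives of w in the parameters solve the equation obtained by
   differentiating the given one. *)
Lemma linear_D1 (dA : 'I_N -> 'I_N -> 'I_(m + 1) -> rnet (m + 1))
    (dr : 'I_N -> 'I_(m + 1) -> rnet (m + 1)) (dw0 : 'I_N -> 'I_m -> rnet m)
    (W : 'I_m -> 'I_N -> eps_index R -> V -> R -> R) :
  (forall j k, locD1 B (A j k) (dA j k)) -> (forall j, locD1 B (r j) (dr j)) ->
  (forall j, locD1 B (w0 j) (dw0 j)) ->
  (forall i, linear_ode A (fun j e p => \sum_k dA j k (lshift 1 i) e p *
       uncurry_time (w k) e p + dr j (lshift 1 i) e p) (fun j => dw0 j i) (W i)) ->
  forall j, @locO R B ((V * V) * R)%type
    (fun e t => space_incr (w j) e t - \sum_i (t.1.2 - t.1.1) 0 i * W i j e t.1.1 t.2)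
    (fun _ t => `|t.1.2 - t.1.1| ^+ 2).
Proof.
(* The Taylor remainder solves the equation with the matrix at the base point. Its inhomogeneity
   consists of the remainders of [A] applied to [w], products of increments of [A] and [w], and the
   remainder of [r], all quadratic. *)
move=> HA Hr Hw0 HW.
apply: (@gronwall_loc R B (V * V)%type N
  (fun j e t s => w j e t.2 s - w j e t.1 s - \sum_i (t.2 - t.1) 0 i * W i j e t.1 s)
  (fun j e t s => rhs j e t.2 s - rhs j e t.1 s - \sum_i (t.2 - t.1) 0 i *
     (\sum_k A j k e (joint t.1 s) * W i k e t.1 s +
      (\sum_k dA j k (lshift 1 i) e (joint t.1 s) * w k e t.1 s + dr j (lshift 1 i) e (joint t.1 s))))
  (fun j e t s =>
     \sum_k (A j k e (joint t.2 s) - A j k e (joint t.1 s) -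
        \sum_i (t.2 - t.1) 0 i * dA j k (lshift 1 i) e (joint t.1 s)) * w k e t.1 s +
     (\sum_k (A j k e (joint t.2 s) - A j k e (joint t.1 s)) * (w k e t.2 s - w k e t.1 s) +
     (r j e (joint t.2 s) - r j e (joint t.1 s) -
        \sum_i (t.2 - t.1) 0 i * dr j (lshift 1 i) e (joint t.1 s))))
  (fun _ t => `|t.2 - t.1| ^+ 2)).
- by move=> e t; exact: sqr_ge0.
- move=> k e t s; apply: is_derive_sub; first by apply: is_derive_sub; exact: w_ode.2.
  apply: is_derive_bigsum => i; apply: is_derive_scale.
  apply: is_derive_val ((HW i).2 k e t.1 s) _.
  by congr (_ + (_ + _)); apply: eq_bigr => l _; rewrite uncurry_joint.
- move=> T; have [L eL HL] := log_bounded_joint T logA; exists L => // e [q q'] s k.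
  rewrite prod_normE ge_max /= => /andP[qT q'T] sT.
  set rho := (X in _ <= _ + `|X|).
  set dd := (X in `|X| <= _).
  have -> : dd = \sum_l A k l e (joint q s) *
      (w l e q' s - w l e q s - \sum_i (q' - q) 0 i * W i l e q s) + rho.
    rewrite /dd /rho /rhs.
    under [X in _ = X + _]eq_bigr do rewrite mulrBr mulr_sumr.
    rewrite sumrB exchange_big /=.
    under [X in _ = _ + (X + _)]eq_bigr do rewrite mulrBl mulr_suml.
    rewrite sumrB [X in _ = _ + (_ - X + _)]exchange_big /=.
    have E i : (q' - q) 0 i * (\sum_l A k l e (joint q s) * W i l e q s +
        (\sum_l dA k l (lshift 1 i) e (joint q s) * w l e q s + dr k (lshift 1 i) e (joint q s))) =
      \sum_l A k l e (joint q s) * ((q' - q) 0 i * W i l e q s) +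
      \sum_l (q' - q) 0 i * dA k l (lshift 1 i) e (joint q s) * w l e q s +
      (q' - q) 0 i * dr k (lshift 1 i) e (joint q s).
      rewrite !mulrDr addrA !mulr_sumr; congr (_ + _ + _); apply: eq_bigr => l _.
        by rewrite mulrCA.
      by rewrite mulrA.
    under [X in _ - X = _]eq_bigr do rewrite E.
    rewrite !big_split /=.
    have E2 : \sum_l A k l e (joint q' s) * w l e q' s - \sum_l A k l e (joint q s) * w l e q s =
      \sum_l A k l e (joint q s) * (w l e q' s - w l e q s) +
      \sum_l (A k l e (joint q' s) - A k l e (joint q s)) * w l e q s +
      \sum_l (A k l e (joint q' s) - A k l e (joint q s)) * (w l e q' s - w l e q s).
      by rewrite -sumrB -!big_split /=; apply: eq_bigr => l _; ring.
    rewrite opprD addrACA E2; ring.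
  rewrite (le_trans (ler_normD _ _)) // lerD2r.
  by apply: (@linear_row_le k e q s (fun l => w l e q' s - w l e q s -
    \sum_i (q' - q) 0 i * W i l e q s)) => l; exact: HL.
- move=> k; apply: locO_add.
    apply: locO_sum => [e t|l]; first exact: sqr_ge0.
    apply: locO_mulr; last exact: locO_incr_fst.
    exact: locD1_space (HA k l).
  apply: locO_add; last exact: locD1_space (Hr k).
  apply: locO_sum => [e t|l]; first exact: sqr_ge0.
  exact: locO_mul (locLip_space (regular_Lip (regA k l))) (linear_incr l).
- move=> k; apply: (locO_eq _ (Hw0 k)) => e t /=.
  by rewrite !w_ode.1; congr (_ - _); apply: eq_bigr => i _; rewrite (HW i).1.
Qed.

End Estimates.

(** Induction on [k]. The candidate derivatives [W] solve equations with the same matrix [A];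
    derivatives of [A] occur only in the inhomogeneity, multiplied by [w], which is [k]-regular by
    induction. Thus the exponential factor is the same at every order. *)
Theorem linear_ode_regular k (A : 'I_N -> 'I_N -> rnet (m + 1)) r w0 w :
  (forall j l, log_bounded (A j l)) ->
  linear_ode A r w0 w ->
  (forall j l, regular B k (A j l)) -> (forall j, regular B k (r j)) ->
  (forall j, regular B k (w0 j)) -> forall j, regular B k (uncurry_time (w j)).
Proof.
move=> logA; elim: k r w0 w => [|k IH] r w0 w ode regA regr regw0 j.
  exact: linear_regular0 ode _ _ _ _.
have regA' j l := regularS (regA j l); have regr' j := regularS (regr j).
have regw0' j := regularS (regw0 j).
have le0 d (f : rnet d) : regular B k f -> regular B 0 f by exact: regular_le.
have regA0 j l := le0 _ _ (regA' j l); have regr0 j := le0 _ _ (regr' j).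
have regw00 j := le0 _ _ (regw0' j).
have kw := IH r w0 w ode regA' regr' regw0'.
have [dA HdA] : {dA : 'I_N * 'I_N -> 'I_(m + 1) -> rnet (m + 1) & forall jl,
    (forall i, regular B k (dA jl i)) /\ locD1 B (A jl.1 jl.2) (dA jl)}.
  apply: (choice (P := fun jl dA => (forall i, regular B k (dA i)) /\ locD1 B (A jl.1 jl.2) dA)).
  by move=> jl; have [_ _ [g gk gA]] := regA jl.1 jl.2; exists g.
have [dr Hdr] : {dr : 'I_N -> 'I_(m + 1) -> rnet (m + 1) & forall j,
    (forall i, regular B k (dr j i)) /\ locD1 B (r j) (dr j)}.
  apply: (choice (P := fun j dr => (forall i, regular B k (dr i)) /\ locD1 B (r j) dr)).
  by move=> l; have [_ _ [g gk gA]] := regr l; exists g.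
have [dw0 Hdw0] : {dw0 : 'I_N -> 'I_m -> rnet m & forall j,
    (forall i, regular B k (dw0 j i)) /\ locD1 B (w0 j) (dw0 j)}.
  apply: (choice (P := fun j dr => (forall i, regular B k (dr i)) /\ locD1 B (w0 j) dr)).
  by move=> l; have [_ _ [g gk gA]] := regw0 l; exists g.
pose r1 i j e p := \sum_l dA (j, l) (lshift 1 i) e p * uncurry_time (w l) e p + dr j (lshift 1 i) e p.
have kr1 i l : regular B k (r1 i l).
  apply: regularD; last exact: (Hdr l).1.
  by apply: regular_sum => l'; apply: regularM; [exact: (HdA (l, l')).1|exact: kw].
have exW i : exists W, linear_ode A (r1 i) (fun j => dw0 j i) W.
  by apply: (@linear_ode_exists R B) => // l; exact: le0 (kr1 i l).
have [W HW] := choice exW.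
have kW i l : regular B k (uncurry_time (W i l)).
  by apply: (IH (r1 i) (fun j => dw0 j i)) => // l'; exact: (Hdw0 l').1.
have krhs := @linear_rhs_regular A r w k j regA' regr' kw.
apply: (@regularSI R B _ k _ (joint_gradient _ (fun i => W i j))); last first.
- apply: locD1_uncurry; last first.
    apply: (linear_D1 logA ode regA0 regr0 regw00 (dA := fun j l => dA (j, l)) (dr := dr)
      (dw0 := dw0)) => //.
    + by move=> j' l; exact: (HdA (j', l)).2.
    + by move=> j'; exact: (Hdr j').2.
    + by move=> j'; exact: (Hdw0 j').2.
  + exact: regular_Lip krhs.
  + by move=> e q s; exact: ode.2.
- by apply: joint_gradient_regular => // i; exact: kW.
- exact: regular_O1 (kw j).
Qed.

End LinearRegularity.

(** * Nonlinear equations with parameters *)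

Section NonlinearRegularity.
Context {R : realType} (B : bound_class R) {m N : nat}.
Local Notation V := 'rV[R]_m.
Local Notation W := 'rV[R]_(m + 1).
Local Notation rnet d := (eps_index R -> 'rV[R]_d -> R).

Lemma norm_row_mx a b (u : 'rV[R]_a) (v : 'rV[R]_b) : `|row_mx u v| <= Num.max `|u| `|v|.
Proof.
apply: row_norm_le => [|i]; first by rewrite le_max normr_ge0.
rewrite -(splitK i); case: (fintype.split i) => j /=; rewrite le_max.
  by rewrite row_mxEl coord_le_norm.
by rewrite row_mxEr coord_le_norm orbT.
Qed.

Variables (G : 'I_N -> rnet (m + 1 + N)) (y0 : 'I_N -> rnet m).
Variable y : 'I_N -> eps_index R -> V -> R -> R.

(** Parameters, time and solution are gathered into one point, so that [G] along a solution is a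
    composition of nets. *)
Definition state_coord (c : 'I_(m + 1 + N)) : rnet (m + 1) := fun e p =>
  match fintype.split c with inl a => p 0 a | inr b => uncurry_time (y b) e p end.

Definition state e (p : W) : 'rV[R]_(m + 1 + N) := \row_c state_coord c e p.

Lemma stateE e q s : state e (joint q s) = row_mx (joint q s) (\row_b y b e q s).
Proof.
apply/rowP => c; rewrite mxE /state_coord -{2}(splitK c).
case: (fintype.split c) => a /=; first by rewrite row_mxEl.
by rewrite row_mxEr mxE uncurry_joint.
Qed.

Hypothesis regG : forall k j, regular B k (G j).
(** The constant is uniform over all states [v]. It also bounds the matrix of the linearised
    equation, see [gradient_le_Lip]. *)
Hypothesis lipG : forall r, exists2 L, exp_bounds B L &
  forall e p v v' j, `|p| <= r ->
    `|G j e (row_mx p v') - G j e (row_mx p v)| <= L e * \sum_k `|v' 0 k - v 0 k|.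
Hypothesis y_init : forall j e q, y j e q 0 = y0 j e q.
Hypothesis y_ode : forall j e q (s : R), is_derive s 1 (y j e q) (G j e (state e (joint q s))).
Hypothesis y_bounded : forall j, bounded_net (uncurry_time (y j)).
Hypothesis regy0 : forall k j, regular B k (y0 j).

Let rho j e q s := G j e (state e (joint q s)).

Lemma state_coord_bounded c : bounded_net (state_coord c).
Proof.
rewrite /state_coord; case: (fintype.split c) => a //.
exact: regular_O1 (regular_coord (@bddB R) 0 a).
Qed.

Lemma nonlinear_rhs_O1 j : bigO1 B (uncurry_time (rho j)).
Proof.
apply: (locO_eq _ (locO_compO1 state_coord_bounded (regular_O1 (regG 0 j)))) => e p.
by rewrite /uncurry_time /rho joint_split.
Qed.

Lemma nonlinear_O1 j : bigO1 B (uncurry_time (y j)).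
Proof.
by move=> r; have [C bC HC] := y_bounded j r; exists C => //; exact: bdd_sub.
Qed.

Lemma pair_comp_bounded r : exists2 C, bddB C & forall e (t : (V * V) * R), `|t| <= r ->
  `|(row_mx (joint t.1.1 t.2) (\row_b y b e t.1.2 t.2),
     row_mx (joint t.1.2 t.2) (\row_b y b e t.1.2 t.2))| <= C e.
Proof.
have [C bC HC] := bounded_row (u := fun b e p => uncurry_time (y b) e p) r y_bounded.
exists (fun e => Num.max `|r| (C e)); first exact: bounds_max (bounds_cst _ _) bC.
move=> e [[q q'] s]; rewrite !prod_normE !ge_max /=.
move=> /andP[/andP[qr q'r] sr].
have jq (x : V) : `|x| <= r -> `|joint x s| <= r by move=> xr; rewrite norm_joint prod_normE ge_max xr.
have yC : `|\row_b y b e q' s| <= C e.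
  have := HC e (joint q' s) (jq _ q'r).
  by congr (`|_| <= _); apply/rowP => b; rewrite !mxE uncurry_joint.
have rr : r <= `|r| by exact: ler_norm.
by apply/andP; split; apply: (le_trans (norm_row_mx _ _));
  rewrite ge_max !le_max yC orbT andbT (le_trans (jq _ _) rr).
Qed.

Lemma nonlinear_incr j :
  @locO R B ((V * V) * R)%type (space_incr (y j)) (fun _ t => `|t.1.2 - t.1.1|).
Proof.
apply: (@gronwall_loc R B (V * V)%type N (fun j e t s => y j e t.2 s - y j e t.1 s)
  (fun j e t s => rho j e t.2 s - rho j e t.1 s)
  (fun j e t s => G j e (row_mx (joint t.2 s) (\row_b y b e t.2 s)) -
     G j e (row_mx (joint t.1 s) (\row_b y b e t.2 s))) (fun _ t => `|t.2 - t.1|)).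
- by [].
- move=> T; have [L eL HL] := lipG T; exists L => // e [q q'] s k.
  rewrite prod_normE ge_max /= => /andP[qT q'T] sT.
  rewrite /rho !stateE /=; set a := G k e (row_mx (joint q' s) (\row_b y b e q' s)).
  set b := G k e (row_mx (joint q s) (\row_b y b e q s)).
  set c := G k e (row_mx (joint q s) (\row_b y b e q' s)).
  have -> : a - b = (c - b) + (a - c) by ring.
  rewrite (le_trans (ler_normD _ _)) // lerD2r.
  have jT : `|joint q s| <= T by rewrite norm_joint prod_normE ge_max qT.
  apply: (le_trans (HL e _ _ _ k jT)); rewrite ler_wpM2l ?eL.1 //.
  by apply: ler_sum => l _; rewrite !mxE.
- move=> k.
  have := @locO_comp R B _ _ _ _ _ pair_comp_bounded (regular_Lip (regG 0 k)).
  move=> /= H; apply: (locO_trans H); apply: locO_le => e t; rewrite normr_id.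
  rewrite opp_row_mx add_row_mx subrr (le_trans (norm_row_mx _ _)) // normr0 joint_sub norm_joint0.
  by rewrite ge_max lexx normr_ge0.
- move=> k; apply: (locO_eq _ (regular_Lip (regy0 0 k))) => e t /=.
  by rewrite !y_init.
Qed.

Lemma nonlinear_Lip j : locLip B (uncurry_time (y j)).
Proof.
apply: (locLip_uncurry (rho := rho j)) => //.
- exact: nonlinear_rhs_O1.
- exact: nonlinear_incr.
Qed.

(** A difference quotient in a state direction is at most [L e], and its distance from the
    derivative tends to 0 with the step. Thus the linearised matrix is logarithmic, although
    [regular] alone only bounds it within [B]. *)
Lemma gradient_le_Lip (dG : 'I_N -> 'I_(m + 1 + N) -> rnet (m + 1 + N)) j k r L :
  locD1 B (G j) (dG j) ->
  (forall e p v v' j, `|p| <= r ->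
    `|G j e (row_mx p v') - G j e (row_mx p v)| <= L e * \sum_k `|v' 0 k - v 0 k|) ->
  forall e p v, `|p| <= r -> `|dG j (rshift (m + 1) k) e (row_mx p v)| <= L e.
Proof.
move=> HD HL e p v pr; apply/ler_addgt0Pr => d d0.
have [C BC HC] := HD (Num.max `|p| `|v| + 1).
(* The step keeps both points in the ball of [HC] and makes the remainder divided by [h] at most
   [d]. *)
pose h := Num.min 1 (d / (C e + 1)).
have C0 := bounds_ge0 BC e.
have h0 : 0 < h by rewrite lt_min ltr01 divr_gt0 // ltr_wpDl.
have h1 : h <= 1 by rewrite ge_min lexx.
have hC : C e * h <= d.
  apply: (@le_trans _ _ ((C e + 1) * h)); first by rewrite ler_wpM2r ?lerDl // ltW.
  by rewrite mulrC -ler_pdivlMr ?ltr_wpDl // ge_min lexx orbT.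
pose v' := v + h *: delta_mx 0 k.
have vv' : v' - v = h *: delta_mx 0 k by rewrite addrAC subrr add0r.
have dn : `|row_mx p v' - row_mx p v| <= h.
  rewrite opp_row_mx add_row_mx subrr vv' (le_trans (norm_row_mx _ _)) // normr0 ge_max (ltW h0) /=.
  apply: row_norm_le => [|i]; first exact: ltW.
  by rewrite !mxE eqxx; case: (i == k) => /=; rewrite ?mulr1 ?mulr0 ?normr0 ?gtr0_norm // ltW.
have pv : `|row_mx p v| <= Num.max `|p| `|v| by exact: norm_row_mx.
have := HC e (row_mx p v, row_mx p v'); rewrite prod_normE ge_max /= => H.
have {H} := H _; rewrite (le_trans pv) ?lerDl //=.
have -> : `|row_mx p v'| <= Num.max `|p| `|v| + 1.
  rewrite -(subrK (row_mx p v) (row_mx p v')) addrC (le_trans (ler_normD _ _)) // lerD //.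
  exact: le_trans dn h1.
move=> /(_ isT).
have -> : \sum_i (row_mx p v' - row_mx p v) 0 i * dG j i e (row_mx p v) =
    h * dG j (rshift (m + 1) k) e (row_mx p v).
  rewrite opp_row_mx add_row_mx subrr vv' big_split_ord /= big1 ?add0r => [|i _]; last first.
    by rewrite row_mxEl mxE mul0r.
  rewrite (bigD1 k) //= row_mxEr !mxE !eqxx mulr1 big1 ?addr0 // => i /negPf ik.
  by rewrite row_mxEr !mxE ik andbF mulr0 mul0r.
set x := G _ _ _ - G _ _ _; set D := dG _ _ _ _ => H.
have Hx : `|x| <= L e * h.
  apply: (le_trans (HL e p v v' j pr)); rewrite (bigD1 k) //= big1 => [|i /negPf ik].
    by rewrite -row_subE vv' !mxE !eqxx mulr1 addr0 gtr0_norm.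
  by rewrite -row_subE vv' !mxE ik andbF mulr0 normr0.
have : `|h * D| <= L e * h + C e * h ^+ 2.
  rewrite -(subrK x (h * D)) (le_trans (ler_normD _ _)) // addrC lerD // distrC (le_trans H) //.
  by rewrite ler_wpM2l // ler_pXn2r // nnegrE // ltW.
rewrite normrM gtr0_norm // expr2 mulrA -mulrDl mulrC ler_pM2r //.
by move=> /le_trans; apply; rewrite lerD2l.
Qed.

(** The Taylor remainder of [y] solves the linearised equation up to the Taylor remainder of [G]
    between the two states, which is quadratic in the parameter increment because the states are
    Lipschitz. *)
Lemma nonlinear_D1 (dG : 'I_N -> 'I_(m + 1 + N) -> rnet (m + 1 + N))
    (dy0 : 'I_N -> 'I_m -> rnet m) (v : 'I_m -> 'I_N -> eps_index R -> V -> R -> R) :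
  (forall j, locD1 B (G j) (dG j)) -> (forall j, locD1 B (y0 j) (dy0 j)) ->
  (forall i, linear_ode (fun j k e p => dG j (rshift (m + 1) k) e (state e p))
    (fun j e p => dG j (lshift N (lshift 1 i)) e (state e p)) (fun j => dy0 j i) (v i)) ->
  forall j, @locO R B ((V * V) * R)%type
    (fun e t => space_incr (y j) e t - \sum_i (t.1.2 - t.1.1) 0 i * v i j e t.1.1 t.2)
    (fun _ t => `|t.1.2 - t.1.1| ^+ 2).
Proof.
move=> HG Hy0 Hv.
apply: (@gronwall_loc R B (V * V)%type N
  (fun j e t s => y j e t.2 s - y j e t.1 s - \sum_i (t.2 - t.1) 0 i * v i j e t.1 s)
  (fun j e t s => rho j e t.2 s - rho j e t.1 s - \sum_i (t.2 - t.1) 0 i *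
     (\sum_k dG j (rshift (m + 1) k) e (state e (joint t.1 s)) * v i k e t.1 s +
      dG j (lshift N (lshift 1 i)) e (state e (joint t.1 s))))
  (fun j e t s => G j e (state e (joint t.2 s)) - G j e (state e (joint t.1 s)) -
     \sum_c (state e (joint t.2 s) - state e (joint t.1 s)) 0 c * dG j c e (state e (joint t.1 s)))
  (fun _ t => `|t.2 - t.1| ^+ 2)).
- by move=> e t; exact: sqr_ge0.
- move=> k e t s; apply: (is_derive_sub (is_derive_sub (y_ode k e t.2 s) (y_ode k e t.1 s))).
  by apply: is_derive_bigsum => i; apply: is_derive_scale; exact: (Hv i).2.
- move=> T; have [L eL HL] := lipG T; exists L => // e [q q'] s k.
  rewrite prod_normE ge_max /= => /andP[qT q'T] sT.
  set err := (X in _ <= _ + `|X|).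
  set dd := (X in `|X| <= _).
  pose A l := dG k (rshift (m + 1) l) e (state e (joint q s)).
  have AL l : `|A l| <= L e.
    rewrite /A stateE; apply: (gradient_le_Lip l (HG k) HL).
    by rewrite norm_joint prod_normE ge_max qT.
  have -> : dd = \sum_l A l * (y l e q' s - y l e q s - \sum_i (q' - q) 0 i * v i l e q s) + err.
    rewrite /dd /err /rho.
    have -> : \sum_c (state e (joint q' s) - state e (joint q s)) 0 c *
        dG k c e (state e (joint q s)) =
      \sum_i (q' - q) 0 i * dG k (lshift N (lshift 1 i)) e (state e (joint q s)) +
      \sum_l (y l e q' s - y l e q s) * A l.
      rewrite big_split_ord /= !stateE; congr (_ + _).
        rewrite opp_row_mx add_row_mx joint_sub.
        under eq_bigr do rewrite row_mxEl.
        by rewrite sum_joint mul0r addr0.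
      by apply: eq_bigr => l _; rewrite opp_row_mx add_row_mx row_mxEr !mxE /A stateE.
    under [X in _ = X + _]eq_bigr do rewrite mulrBr mulr_sumr.
    rewrite sumrB exchange_big /=.
    under [X in _ - X = _]eq_bigr do rewrite mulrDr mulr_sumr.
    rewrite big_split /=.
    under [X in _ = X - _ + _]eq_bigr do rewrite mulrC.
    under [X in _ = _ - X + _]eq_bigr do under eq_bigr do rewrite mulrCA.
    rewrite /A; ring.
  rewrite (le_trans (ler_normD _ _)) // lerD2r.
  rewrite (le_trans (ler_norm_sum _ _ _)) // mulr_sumr ler_sum // => l _.
  by rewrite normrM ler_wpM2r.
- move=> k.
  have Hs c : locLip B (state_coord c).
    rewrite /state_coord; case: (fintype.split c) => a; last exact: nonlinear_Lip.
    exact: regular_Lip (regular_coord B 0 a).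
  have H1 := @locO_comp R B _ _ (fun e (t : W * W) => (state e t.1, state e t.2))
    _ _ (fun r => bounded_row_pair r state_coord_bounded) (HG k).
  have H2 := locO_trans H1 (locO_mul (incr_row Hs) (incr_row Hs)).
  have := locO_pull (T' := ((V * V) * R)%type)
    (phi := fun t => (joint t.1.1 t.2, joint t.1.2 t.2)) _ H2 => /=.
  move=> /(_ (fun r => ex_intro _ r (@joint_pair_norm _ _ r))).
  move=> H; apply: (locO_trans H); apply: locO_le => e t.
  by rewrite joint_sub norm_joint0 ger0_norm ?mulr_ge0.
- move=> k; apply: (locO_eq _ (Hy0 k)) => e t /=.
  by rewrite !y_init; congr (_ - _); apply: eq_bigr => i _; rewrite (Hv i).1.
Qed.

(** Regularity climbs one order at a time: if the states are [k]-regular, so are the coefficients of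
    the linearised equation, hence by [linear_ode_regular] its solutions, which form the gradient of
    [y] in the parameters. *)
Theorem nonlinear_ode_regular k j : regular B k (uncurry_time (y j)).
Proof.
elim: k j => [|k IH] j.
  by split=> //; [exact: nonlinear_O1|exact: nonlinear_Lip].
have [dG HdG] : {dG : 'I_N -> 'I_(m + 1 + N) -> rnet (m + 1 + N) & forall j,
    (forall i, regular B k (dG j i)) /\ locD1 B (G j) (dG j)}.
  apply: (choice (P := fun j dr => (forall i, regular B k (dr i)) /\ locD1 B (G j) dr)).
  by move=> l; have [_ _ [g gk gA]] := regG k.+1 l; exists g.
have [dy0 Hdy0] : {dy0 : 'I_N -> 'I_m -> rnet m & forall j,
    (forall i, regular B k (dy0 j i)) /\ locD1 B (y0 j) (dy0 j)}.
  apply: (choice (P := fun j dr => (forall i, regular B k (dr i)) /\ locD1 B (y0 j) dr)).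
  by move=> l; have [_ _ [g gk gA]] := regy0 k.+1 l; exists g.
have ks c : regular B k (state_coord c).
  by rewrite /state_coord; case: (fintype.split c) => a; [exact: regular_coord|exact: IH].
have kcomp F : regular B k F -> regular B k (fun e p => F e (state e p)).
  by move=> kF; apply: regular_comp => // c; exact: state_coord_bounded.
have le0 d (f : rnet d) : regular B k f -> regular B 0 f by exact: regular_le.
pose A j k e p := dG j (rshift (m + 1) k) e (state e p).
pose r i j e p := dG j (lshift N (lshift 1 i)) e (state e p).
have kA j' l : regular B k (A j' l) by apply: kcomp; exact: (HdG j').1.
have kr i j' : regular B k (r i j') by apply: kcomp; exact: (HdG j').1.
have exv i : exists v, linear_ode A (r i) (fun j => dy0 j i) v.
  by apply: (@linear_ode_exists R B) => *; apply: le0; [exact: kA|exact: kr].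
have [v Hv] := choice exv.
have logA j' l : log_bounded B (A j' l).
  move=> T; have [L eL HL] := lipG T; exists L => // e p pT.
  rewrite /A -[p]joint_split stateE joint_split.
  exact: (gradient_le_Lip l (HdG j').2 HL).
have kv i : regular B k (uncurry_time (v i j)).
  by apply: (linear_ode_regular logA (Hv i)) => // j'; exact: (Hdy0 j').1.
have krho : regular B k (uncurry_time (rho j)).
  have -> : uncurry_time (rho j) = fun e p => G j e (state e p).
    by apply/funext => e; apply/funext => p; rewrite /uncurry_time /rho joint_split.
  exact: kcomp.
apply: (@regularSI R B _ k _ (joint_gradient (rho j) (fun i => v i j))).
- exact: nonlinear_O1.
- exact: joint_gradient_regular.
- apply: locD1_uncurry.
  + exact: regular_Lip krho.
  + apply: (nonlinear_D1 (dG := dG) (dy0 := dy0)) => //.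
    * by move=> j'; exact: (HdG j').2.
    * by move=> j'; exact: (Hdy0 j').2.
Qed.

End NonlinearRegularity.

(** * Smooth complex nets *)

Section LinearCombination.
Context {R : realType} {d : nat}.
Variable c : 'I_d -> R.

Definition lincomb (h : 'rV[R]_d) : R := \sum_i h 0 i * c i.

Lemma lincomb_linear : linear (lincomb : 'rV[R]_d -> R^o).
Proof.
move=> k u v; rewrite /lincomb /GRing.scale /= mulr_sumr -big_split /=.
by apply: eq_bigr => i _; rewrite !mxE; ring.
Qed.
HB.instance Definition _ := GRing.isLinear.Build R 'rV[R]_d R^o *:%R lincomb lincomb_linear.

Lemma lincomb_continuous : continuous lincomb.
Proof.
apply: (@continuous_bigsum R _ d (fun i (v : 'rV[R]_d) => v 0 i * c i)) => i v.
by apply: continuousM; [exact: (@coord_continuous R 1 d 0 i v)|exact: cst_continuous].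
Qed.

End LinearCombination.

(** * Passage between Taylor estimates and partial derivatives *)

Section Bridge.
Context {R : realType} {d : nat}.
Local Notation V := 'rV[R]_d.

Lemma quadratic_differentiable (f : V -> R) (x : V) (c : 'I_d -> R) (C : R) : 0 <= C ->
  (forall h : V, `|h| <= 1 -> `|f (h + x) - f x - \sum_i h 0 i * c i| <= C * `|h| ^+ 2) ->
  differentiable f x /\ forall v, 'D_v f x = \sum_i v 0 i * c i.
Proof.
move=> C0 H.
have dfx : f \o shift x = cst (f x) + (lincomb c : V -> R) +o_ (0 : V) id.
  apply/eqaddoP => _/posnumP[e].
  have eC : 0 < Num.min 1 (e%:num / (C + 1)).
    by rewrite lt_min ltr01 divr_gt0 // ltr_wpDl.
  near=> h.
  have hn : `|h| <= Num.min 1 (e%:num / (C + 1)).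
    have : `|0 - h| <= Num.min 1 (e%:num / (C + 1)).
      near: h; have /cvgrPdist_le : id @ (0 : V) --> (0 : V) by exact: cvg_id.
      by apply.
    by rewrite sub0r normrN.
  move: hn; rewrite le_min => /andP[h1 hC].
  rewrite [X in `|X|](_ : _ = f (h + x) - f x - \sum_i h 0 i * c i); last first.
    by rewrite /= opprD addrA.
  rewrite (le_trans (H h h1)) // expr2 mulrA ler_wpM2r //.
  rewrite (@le_trans _ _ ((C + 1) * `|h|)) // ?ler_wpM2r ?lerDl //.
  by rewrite mulrC -ler_pdivlMr // ltr_wpDl.
have dE : 'd f x = lincomb c :> (V -> R).
  exact: (@diff_unique R V R^o f (lincomb c) x (@lincomb_continuous R d c) dfx).
have df : differentiable f x.
  apply/diff_locallyP; split; last by rewrite dE.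
  by rewrite dE; exact: lincomb_continuous.
by split=> // v; rewrite deriveE // dE.
Unshelve. all: by end_near. Qed.

Lemma is_derive_segment (f : V -> R) (p v : V) (t : R) : differentiable f (t *: v + p) ->
  is_derive t 1 (fun s : R => f (s *: v + p))
    (\sum_i v 0 i * 'D_(delta_mx 0 i) f (t *: v + p)).
Proof.
move=> df.
have E : (fun h : R => h^-1 *: (f (shift t (h *: 1) *: v + p) - f (t *: v + p))) =
  (fun h : R => h^-1 *: (f (shift (t *: v + p) (h *: v)) - f (t *: v + p))).
  apply/funext => h; rewrite /shift /=.
  by rewrite scalerDl addrA [h *: 1]mulr1.
have dv : derivable f (t *: v + p) v by exact: diff_derivable.
apply: DeriveDef; first by move: dv; rewrite /derivable /= -E.
rewrite -derive_sum_delta //.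
by rewrite /derive -E.
Qed.

Lemma mvt_segment (f : V -> R) (p q : V) : (forall x, differentiable f x) ->
  exists2 c, 0 <= c <= 1 & f q - f p =
    \sum_i (q - p) 0 i * 'D_(delta_mx 0 i) f (c *: (q - p) + p).
Proof.
move=> df.
have [c c01 H] := @mvt R (fun s => f (s *: (q - p) + p)) _ 0 1 ler01
  (fun t _ => is_derive_segment (df (t *: (q - p) + p))).
by exists c => //; move: H; rewrite scale1r scale0r add0r subrK subr0 mulr1.
Qed.

Lemma norm_segment (p q : V) (c r : R) : 0 <= c <= 1 -> `|p| <= r -> `|q| <= r ->
  `|c *: (q - p) + p| <= r.
Proof.
move=> /andP[c0 c1] pr qr.
have -> : c *: (q - p) + p = c *: q + (1 - c) *: p.
  by rewrite scalerBr scalerBl scale1r addrAC addrA.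
rewrite (le_trans (ler_normD _ _)) // !normrZ ger0_norm // ger0_norm ?subr_ge0 //.
rewrite (@le_trans _ _ (c * r + (1 - c) * r)) ?lerD ?ler_wpM2l ?subr_ge0 //.
by rewrite -mulrDl addrC subrK mul1r.
Qed.

Section Family.
Variables (B : bound_class R) (f : eps_index R -> V -> R).
Hypothesis df : forall e x, differentiable (f e) x.
Let g i e x := 'D_(delta_mx 0 i) (f e) x.

Lemma derivatives_Lip : (forall i, bigO1 B (g i)) -> locLip B f.
Proof.
move=> g0.
have H := locO_sum (Y := fun _ _ => 1) (fun _ _ => ler01) (fun i => locO_norm (g0 i)).
move=> r; have [C BC HC] := H r; exists C => // e [p q].
rewrite prod_normE ge_max /= => /andP[pr qr].
have [c c01 ->] := mvt_segment p q (df e).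
have := HC e _ (norm_segment c01 pr qr); rewrite mulr1 => HCe.
apply: le_trans (_ : `|q - p| * \sum_i `|g i e (c *: (q - p) + p)| <= _).
  rewrite (le_trans (ler_norm_sum _ _ _)) // mulr_sumr ler_sum // => i _.
  by rewrite normrM ler_wpM2r // coord_le_norm.
by rewrite mulrC ler_wpM2r // (le_trans (ler_norm _)).
Qed.

(** By the mean value theorem the remainder is the difference of the gradients at a point of the
    segment and at its start, applied to the increment; Lipschitz gradients make it quadratic. *)
Lemma derivatives_D1 : (forall i, locLip B (g i)) -> locD1 B f g.
Proof.
move=> g0.
have H := locO_sum (Y := fun _ (t : V * V) => `|t.2 - t.1|) (fun _ _ => normr_ge0 _)
  (fun i => locO_norm (g0 i)).
move=> r; have [C BC HC] := H r; exists C => // e [p q].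
rewrite prod_normE ge_max /= => /andP[pr qr].
have [c c01 ->] := mvt_segment p q (df e).
set z := c *: (q - p) + p.
have zr := norm_segment c01 pr qr.
have := HC e (p, z); rewrite prod_normE ge_max /= pr zr => /(_ isT) HCe.
rewrite -sumrB.
apply: (@le_trans _ _ (`|q - p| * \sum_i `|g i e z - g i e p|)).
  rewrite (le_trans (ler_norm_sum _ _ _)) // mulr_sumr ler_sum // => i _.
  by rewrite -mulrBr normrM ler_wpM2r // coord_le_norm.
rewrite expr2 mulrA mulrC ler_wpM2r // (le_trans (ler_norm _)) // (le_trans HCe) //.
rewrite ler_wpM2l ?(bounds_ge0 BC) // /z addrK normrZ.
by move/andP: c01 => [c0 c1]; rewrite ger0_norm // ler_piMl.
Qed.

End Family.

Lemma locD1_derive (B : bound_class R) (f : eps_index R -> V -> R) g : locD1 B f g ->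
  forall e x, differentiable (f e) x /\ forall i, 'D_(delta_mx 0 i) (f e) x = g i e x.
Proof.
move=> H e x; have [C BC HC] := H (`|x| + 1).
have [|df dE] := @quadratic_differentiable (f e) x (fun i => g i e x) (C e) (bounds_ge0 BC e).
  move=> h h1; have := HC e (x, h + x); rewrite prod_normE ge_max /= addrK; apply.
  by rewrite lerDl ler01 /= (le_trans (ler_normD _ _)) // addrC lerD2l.
split=> // i; rewrite dE (bigD1 i) //= !mxE !eqxx mul1r big1 ?addr0 // => j /negPf ji.
by rewrite !mxE ji andbF mul0r.
Qed.

Implicit Types u : net R d.
Definition re_net u : eps_index R -> V -> R := fun e x => complex.Re (u e x).
Definition im_net u : eps_index R -> V -> R := fun e x => complex.Im (u e x).

Definition cregular (B : bound_class R) u :=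
  regularoo B (re_net u) /\ regularoo B (im_net u).

Lemma cregular_diff B u : cregular B u -> forall e x, cdifferentiable (u e) x.
Proof.
move=> [ru iu] e x.
by split; [have [_ _ [g _ H]] := ru 1%N|have [_ _ [g _ H]] := iu 1%N];
  have [] := locD1_derive H e x.
Qed.

Lemma regularoo_derive B (f : eps_index R -> V -> R) i : regularoo B f ->
  regularoo B (fun e x => 'D_(delta_mx 0 i) (f e) x).
Proof.
move=> rf k; have [_ _ [g gk H]] := rf k.+1.
have -> : (fun e x => 'D_(delta_mx 0 i) (f e) x) = g i; last exact: gk.
by apply/funext => e; apply/funext => x; have [_ ->] := locD1_derive H e x.
Qed.

Lemma cregular_partial B u j : cregular B u -> cregular B (npartial j u).
Proof. by move=> [ru iu]; split; exact: regularoo_derive. Qed.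

Lemma cregular_ipartial B u s : cregular B u -> cregular B (nipartial s u).
Proof.
elim: s u => // j s IH u Hu; exact: (IH (npartial j u) (cregular_partial j Hu)).
Qed.

Lemma cregular_smooth B u : cregular B u -> forall e, smooth (u e).
Proof.
by move=> Hu e s x; exact: cregular_diff (cregular_ipartial s Hu) e x.
Qed.

(** Bounds alone suffice because they are given for all multi-indices: each Lipschitz constant comes
    from the bounds one order higher, each Taylor remainder from the Lipschitz constants of the
    gradient. *)
Lemma smooth_cregular (B : bound_class R) u : (forall e, smooth (u e)) ->
  (forall s, bigO1 B (re_net (nipartial s u)) /\ bigO1 B (im_net (nipartial s u))) ->
  cregular B u.
Proof.
move=> su Hu; suff H k : regular B k (re_net u) /\ regular B k (im_net u).
  by split=> k; have [] := H k.
elim: k u su Hu => [|k IH] u su Hu.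
  have du e x : cdifferentiable (u e) x by exact: (su e [::] x).
  have [ru iu] := Hu [::].
  split; split=> //; apply: derivatives_Lip.
  + by move=> e x; have [] := du e x.
  + by move=> i; have [] := Hu [:: i].
  + by move=> e x; have [] := du e x.
  + by move=> i; have [] := Hu [:: i].
have du e x : cdifferentiable (u e) x by exact: (su e [::] x).
have [ru iu] := Hu [::].
have sp j e : smooth (npartial j u e) by move=> s x; exact: (su e (j :: s) x).
have Hp j s := Hu (j :: s).
have IHp j := IH (npartial j u) (sp j) (Hp j).
split.
- apply: (@regularSI _ _ _ _ _ (fun j => re_net (npartial j u))) => //.
    by move=> j; have [] := IHp j.
  apply: derivatives_D1; first by move=> e x; have [] := du e x.
  by move=> j; have [H _] := IHp j; exact: regular_Lip H.
- apply: (@regularSI _ _ _ _ _ (fun j => im_net (npartial j u))) => //.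
    by move=> j; have [] := IHp j.
  apply: derivatives_D1; first by move=> e x; have [] := du e x.
  by move=> j; have [_ H] := IHp j; exact: regular_Lip H.
Qed.

End Bridge.

(** * Moderate and slow scale constants *)

Section BoundClassInstances.
Context {R : realType}.
Implicit Types (C D : eps_index R -> R) (e : eps_index R).

Definition moderate_bound C := (forall e, 0 <= C e) /\ exists N c eta,
  [/\ 0 <= c, 0 < eta & forall e, sval e < eta -> C e <= c * (sval e) ^- N].

Lemma eps_expV_le e (m n : nat) : (m <= n)%N -> sval e ^- m <= sval e ^- n.
Proof.
move=> mn; rewrite -!exprVn ler_weXn2l // invf_ge1 ?eps_gt0 ?eps_le1 //.
Qed.

Lemma moderate_class : exists B : bound_class R, bounds B = moderate_bound.
Proof.
unshelve eexists (@BoundClass R moderate_bound _ _ _ _ _) => //.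
- by move=> C [].
- move=> C D eta eta0 [D0 [N [c [eta' [c0 eta'0 H]]]]] C0 CD; split=> //.
  exists N, c, (Num.min eta eta'); split=> //; first by rewrite lt_min eta0.
  by move=> e; rewrite lt_min => /andP[e1 e2]; rewrite (le_trans (CD _ e1)) ?H.
- move=> c c0; split=> //; exists 0%N, c, 1; split=> // e _.
  by rewrite expr0 invr1 mulr1.
- move=> C D [C0 [N [c [eta [c0 eta0 H]]]]] [D0 [N' [c' [eta' [c'0 eta'0 H']]]]].
  split; first by move=> e; rewrite addr_ge0.
  exists (maxn N N'), (c + c'), (Num.min eta eta').
  split; [exact: addr_ge0|by rewrite lt_min eta0|].
  move=> e; rewrite lt_min => /andP[e1 e2]; rewrite mulrDl lerD //.
    by rewrite (le_trans (H _ e1)) // ler_wpM2l // eps_expV_le // leq_maxl.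
  by rewrite (le_trans (H' _ e2)) // ler_wpM2l // eps_expV_le // leq_maxr.
- move=> C D [C0 [N [c [eta [c0 eta0 H]]]]] [D0 [N' [c' [eta' [c'0 eta'0 H']]]]].
  split; first by move=> e; rewrite mulr_ge0.
  exists (N + N')%N, (c * c'), (Num.min eta eta').
  split; [exact: mulr_ge0|by rewrite lt_min eta0|].
  move=> e; rewrite lt_min => /andP[e1 e2].
  by rewrite exprD invfM mulrACA ler_pM ?H ?H'.
Qed.

Definition modB := projT1 (cid moderate_class).
Lemma modE C : modB C <-> moderate_bound C.
Proof. by rewrite /modB; case: cid => B /= ->. Qed.

(** Natural exponents replace the real ones of [slow_scale], since x^q <= 1 + x^n for q <= n
    ([powR_le_expn]). *)
Definition slow_bound C := (forall e, 0 <= C e) /\ forall n : nat, exists c eta,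
  [/\ 0 <= c, 0 < eta & forall e, sval e < eta -> C e ^+ n <= c * (sval e)^-1].

Lemma slow_class : exists B : bound_class R, bounds B = slow_bound.
Proof.
unshelve eexists (@BoundClass R slow_bound _ _ _ _ _) => //.
- by move=> C [].
- move=> C D eta eta0 [D0 H] C0 CD; split=> // n; have [c [eta' [c0 eta'0 Hn]]] := H n.
  exists c, (Num.min eta eta'); split=> //; first by rewrite lt_min eta0.
  move=> e; rewrite lt_min => /andP[e1 e2]; apply: le_trans (Hn _ e2).
  by rewrite lerXn2r ?nnegrE ?CD.
- move=> c c0; split=> // n; exists (c ^+ n), 1; split=> // [|e _]; first exact: exprn_ge0.
  by rewrite ler_peMr ?exprn_ge0 // invf_ge1 ?eps_gt0 ?eps_le1.
- move=> C D [C0 H] [D0 H']; split=> [e|n]; first exact: addr_ge0.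
  have [c [eta [c0 eta0 Hn]]] := H n; have [c' [eta' [c'0 eta'0 Hn']]] := H' n.
  (* From (C + D)^n <= (2 max(C, D))^n <= 2^n (C^n + D^n). *)
  exists (2 ^+ n * (c + c')), (Num.min eta eta').
  split; [by rewrite mulr_ge0 ?exprn_ge0 ?addr_ge0|by rewrite lt_min eta0|].
  move=> e; rewrite lt_min => /andP[e1 e2].
  apply: (@le_trans _ _ ((2 * Num.max (C e) (D e)) ^+ n)).
    rewrite lerXn2r ?nnegrE ?addr_ge0 ?mulr_ge0 ?le_max ?C0 //.
    by rewrite mulr_natl mulr2n lerD // le_max lexx ?orbT.
  rewrite exprMn -mulrA ler_wpM2l ?exprn_ge0 // mulrDl.
  have := Hn e e1; have := Hn' e e2.
  have := exprn_ge0 n (C0 e); have := exprn_ge0 n (D0 e).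
  by rewrite /Num.max; case: ifP => _; lra.
- move=> C D [C0 H] [D0 H']; split=> [e|n]; first exact: mulr_ge0.
  (* The exponent is doubled because C^n D^n is estimated by C^(2n) + D^(2n). *)
  have [c [eta [c0 eta0 Hn]]] := H (n * 2)%N; have [c' [eta' [c'0 eta'0 Hn']]] := H' (n * 2)%N.
  exists (c + c'), (Num.min eta eta').
  split; [by rewrite addr_ge0|by rewrite lt_min eta0|].
  move=> e; rewrite lt_min => /andP[e1 e2]; rewrite exprMn mulrDl.
  have := Hn e e1; have := Hn' e e2; rewrite !exprM.
  have := sqr_ge0 (C e ^+ n - D e ^+ n); rewrite sqrrB.
  have := mulr_ge0 (exprn_ge0 n (C0 e)) (exprn_ge0 n (D0 e)); lra.
Qed.

Definition slowB := projT1 (cid slow_class).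
Lemma slowE C : slowB C <-> slow_bound C.
Proof. by rewrite /slowB; case: cid => B /= ->. Qed.

Lemma slow_moderate C : slowB C -> modB C.
Proof.
move=> /slowE[C0 /(_ 1%N)[c [eta [c0 eta0 H]]]]; apply/modE; split=> //.
by exists 1%N, c, eta; split.
Qed.

Lemma powR_le_expn (x q : R) n : 0 <= x -> q <= n%:R -> 0 <= q -> x `^ q <= 1 + x ^+ n.
Proof.
move=> x0 qn q0; have [x1|/ltW x1] := leP x 1.
  rewrite (@le_trans _ _ 1) //; last by rewrite lerDl exprn_ge0.
  have := @ge0_ler_powR _ q q0 x 1; rewrite powR1 !nnegrE; apply => //.
rewrite (@le_trans _ _ (x ^+ n)) //; last by rewrite lerDr.
by rewrite -powR_mulrn //; exact: ler_powR.
Qed.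

Lemma slow_scale_bound (mu : eps_index R -> R[i]) :
  slow_scale mu -> slowB (fun e => Normc.normc (mu e)).
Proof.
move=> H; apply/slowE; split=> [e|n]; first exact: normc_ge0.
have [C [eta [C0 eta0 HC]]] := H n%:R (ler0n _ n).
exists C, eta; split=> //; first exact: ltW.
by move=> e ee; rewrite -powR_mulrn ?normc_ge0 // HC.
Qed.

Lemma normc_real (x : R) : Normc.normc (x%:C)%C = `|x|.
Proof. by rewrite /= expr0n /= addr0 sqrtr_sqr. Qed.

Lemma slow_bound_scale C : slowB C -> slow_scale (fun e => ((C e)%:C)%C).
Proof.
move=> /slowE[C0 H] q q0.
have [n qn] : exists n : nat, q <= n%:R.
  by exists (Num.bound q); apply: ltW; exact: archi_boundP.
have [c [eta [c0 eta0 Hn]]] := H n.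
exists (1 + c), eta; split=> //; first by rewrite ltr_pwDl.
move=> e ee; rewrite normc_real ger0_norm //.
rewrite (le_trans (powR_le_expn (C0 e) qn q0)) // mulrDl lerD ?Hn // mul1r.
by rewrite invf_ge1 ?eps_gt0 ?eps_le1.
Qed.

(** exp(T c ln(1/eps)) is the power eps^(-Tc), at most eps^(-n) once n >= T|c|. *)
Lemma log_exp_bounds C (c eta : R) : 0 < eta -> (forall e, 0 <= C e) ->
  (forall e, sval e < eta -> C e <= c * ln (sval e)^-1) -> exp_bounds modB C.
Proof.
move=> eta0 C0 H; split=> // T T0; apply/modE; split=> [e|]; first exact: expR_ge0.
have [n cn] : exists n : nat, T * `|c| <= n%:R.
  by exists (Num.bound (T * `|c|)); apply: ltW; apply: archi_boundP; rewrite mulr_ge0.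
exists n, 1, eta; split=> // e ee; rewrite mul1r.
have e1 : 1 <= (sval e)^-1 by rewrite invf_ge1 ?eps_gt0 ?eps_le1.
have l0 : 0 <= ln (sval e)^-1 by exact: ln_ge0.
rewrite -exprVn -[X in _ <= X ^+ n]lnK ?posrE ?(lt_le_trans ltr01) // -expRM_natl ler_expR.
rewrite mulr_natl -mulr_natl (@le_trans _ _ (T * (`|c| * ln (sval e)^-1))) //.
  by rewrite ler_wpM2l // (le_trans (H e ee)) // ler_wpM2r // ler_norm.
by rewrite mulrA ler_wpM2r.
Qed.

(** exp(T c ln|mu|) is the power |mu|^(Tc), at most 1 + |mu|^n once n >= T c, and powers of a slow
    scale net are slow scale. *)
Lemma slow_log_exp_bounds C (c eta : R) (mu : eps_index R -> R[i]) : 0 < eta -> slow_scale mu ->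
  (forall e, 0 <= C e) -> 0 <= c ->
  (forall e, sval e < eta -> C e <= c * ln (Normc.normc (mu e))) -> exp_bounds slowB C.
Proof.
move=> eta0 Hmu C0 c0 H; split=> // T T0.
have [n cn] : exists n : nat, T * c <= n%:R.
  by exists (Num.bound (T * c)); apply: ltW; apply: archi_boundP; rewrite mulr_ge0.
have B1 : slowB (fun e => 1 + Normc.normc (mu e) ^+ n).
  apply: boundsD; first exact: bounds_cst.
  elim: n {cn} => [|n IH]; first by under eq_fun do rewrite expr0; exact: bounds_cst.
  under eq_fun do rewrite exprS.
  by apply: boundsM => //; exact: slow_scale_bound.
apply: (bounds_le eta0 B1) => [e|e ee]; first exact: expR_ge0.
(* Where mu vanishes, [ln] has the default value 0, and the bound forces [C e = 0]. *)
have [m0|m0] := leP (Normc.normc (mu e)) 0.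
  have := H e ee; rewrite (ln0 m0) mulr0 => Ce; have -> : C e = 0 by apply/eqP; rewrite eq_le Ce C0.
  by rewrite mulr0 expR0 lerDl exprn_ge0 // normc_ge0.
apply: le_trans (powR_le_expn (ltW m0) cn (mulr_ge0 T0 c0)).
rewrite /powR gt_eqF // ler_expR -mulrA ler_wpM2l // H //.
Qed.

End BoundClassInstances.

(** * Representatives *)

Section NetBounds.
Context {R : realType} {d : nat}.
Local Notation V := 'rV[R]_d.
Implicit Types (u v w : net R d) (B : bound_class R) (e : eps_index R).

Lemma normc_Re_le (z : R[i]) : `|complex.Re z| <= Normc.normc z.
Proof. by case: z => a b /=; rewrite -sqrtr_sqr ler_wsqrtr // lerDl sqr_ge0. Qed.

Lemma normc_Im_le (z : R[i]) : `|complex.Im z| <= Normc.normc z.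
Proof. by case: z => a b /=; rewrite -sqrtr_sqr ler_wsqrtr // lerDr sqr_ge0. Qed.

Lemma normc_le_ReIm (z : R[i]) : Normc.normc z <= `|complex.Re z| + `|complex.Im z|.
Proof.
case: z => a b /=; rewrite -[leRHS]ger0_norm ?addr_ge0 // -sqrtr_sqr ler_wsqrtr //.
by rewrite sqrrD !real_normK ?num_real // addrAC lerDl mulrn_wge0 // mulr_ge0.
Qed.

Lemma compact_norm_ball (r : R) : compact [set p : V | `|p| <= r].
Proof.
have [r0|r0] := leP 0 r; last first.
  rewrite (_ : [set p : V | _] = set0); first exact: compact0.
  by apply/seteqP; split=> // p /= pr; have := lt_le_trans r0 (normr_ge0 p); rewrite ltNge pr.
have := @rV_compact R d (fun=> `[- r, r]%classic) (fun=> @segment_compact R _ _).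
congr compact; apply/seteqP; split=> p /= H.
  by apply: row_norm_le => // i; have := H i; rewrite in_itv /= -ler_norml.
by move=> i; rewrite in_itv /= -ler_norml (le_trans (coord_le_norm _ _)).
Qed.

Lemma compact_norm_bounded (K : set V) : compact K ->
  exists2 r, 0 <= r & forall p, K p -> `|p| <= r.
Proof.
move=> /compact_bounded [M [_ HM]]; exists (`|M| + 1) => [|p Kp]; first exact: addr_ge0.
by apply: HM => //; rewrite (le_lt_trans (ler_norm _)) // ltrDl.
Qed.

Lemma continuous_ball_bounded (f : V -> R) r : continuous f ->
  exists2 M, 0 <= M & forall p, `|p| <= r -> `|f p| <= M.
Proof.
move=> cf; have : compact (f @` [set p : V | `|p| <= r]).
  apply: continuous_compact; last exact: compact_norm_ball.
  exact: continuous_subspaceT.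
move=> /compact_bounded [M [_ HM]]; exists (`|M| + 1) => [|p pr]; first exact: addr_ge0.
by apply: HM; [rewrite (le_lt_trans (ler_norm _)) // ltrDl|exists p].
Qed.

(** Asymptotic estimates say nothing once eps >= eta; there each function is bounded on the ball by
    continuity and compactness, with a constant that may be arbitrary. *)
Lemma extend_bound (f : eps_index R -> V -> R) g eta r : (forall e, continuous (f e)) ->
  (forall e, 0 <= g e) ->
  (forall e, sval e < eta -> forall p, `|p| <= r -> `|f e p| <= g e) ->
  exists C, [/\ forall e, 0 <= C e, forall e, sval e < eta -> C e <= g e &
    forall e p, `|p| <= r -> `|f e p| <= C e].
Proof.
move=> cf g0 Hg.
have [M HM] : {M : eps_index R -> R & forall e,
    0 <= M e /\ forall p, `|p| <= r -> `|f e p| <= M e}.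
  apply: (choice (P := fun e M => 0 <= M /\ forall p, `|p| <= r -> `|f e p| <= M)) => e.
  by have [M M0 HM] := continuous_ball_bounded r (cf e); exists M.
exists (fun e => if sval e < eta then g e else M e); split=> [e|e ->|e p pr] //.
  by case: ifP => _ //; exact: (HM e).1.
by case: ifP => ee; [exact: Hg|exact: (HM e).2].
Qed.

Lemma eventually_bigO1 B (f : eps_index R -> V -> R) : (forall e, continuous (f e)) ->
  (forall r, exists g eta, [/\ B g, 0 < eta & forall e, sval e < eta ->
     forall p, `|p| <= r -> `|f e p| <= g e]) -> bigO1 B f.
Proof.
move=> cf H r; have [g [eta [Bg eta0 Hg]]] := H r.
have [C [C0 Cg HC]] := extend_bound cf (bounds_ge0 Bg) Hg.
by exists C => [|e p pr]; [exact: bounds_le eta0 Bg C0 Cg|rewrite mulr1 HC].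
Qed.

Lemma O_on_bigO1 B u : (forall e x, cdifferentiable (u e) x) ->
  (forall r, exists2 g, B g & O_on [set p | `|p| <= r] u g) ->
  bigO1 B (re_net u) /\ bigO1 B (im_net u).
Proof.
move=> du H.
have H' r : exists g eta, [/\ B g, 0 < eta & forall e, sval e < eta ->
    forall p, `|p| <= r -> Normc.normc (u e p) <= g e].
  have [g Bg [C [eta [C0 eta0 HC]]]] := H r; exists (fun e => C * g e), eta; split=> //.
  by apply: boundsM => //; apply: bounds_cst; exact: ltW.
split; apply: eventually_bigO1 => [e x|r].
- by apply: differentiable_continuous; have [] := du e x.
- have [g [eta [Bg eta0 Hg]]] := H' r; exists g, eta; split=> // e ee p pr.
  exact: le_trans (normc_Re_le _) (Hg e ee p pr).
- by apply: differentiable_continuous; have [] := du e x.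
- have [g [eta [Bg eta0 Hg]]] := H' r; exists g, eta; split=> // e ee p pr.
  exact: le_trans (normc_Im_le _) (Hg e ee p pr).
Qed.

Lemma bigO1_O_on B u K : bigO1 B (re_net u) -> bigO1 B (im_net u) -> compact K ->
  exists2 g, B g & O_on K u g.
Proof.
move=> Hr Hi /compact_norm_bounded [r _ Kr].
have [C BC HC] := Hr r; have [D BD HD] := Hi r.
exists (fun e => C e + D e); first exact: boundsD.
exists 1, 1; split=> // e _ p /Kr pr; rewrite mul1r (le_trans (normc_le_ReIm _)) //.
by rewrite lerD // -[leRHS]mulr1; [exact: HC|exact: HD].
Qed.

Lemma moderate_cregular u : moderate u <-> cregular modB u.
Proof.
split=> [[su Hu]|Hu].
  apply: smooth_cregular => // s; apply: O_on_bigO1 => [e x|r]; first exact: (su e s x).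
  have [N HN] := Hu _ s (@compact_norm_ball r).
  exists (fun e => sval e ^- N) => //; apply/modE; split=> [e|].
    by rewrite invr_ge0 exprn_ge0 // ltW // eps_gt0.
  by exists N, 1, 1; split=> // e _; rewrite mul1r.
split=> [|K s cK]; first exact: cregular_smooth Hu.
have [Hr Hi] := cregular_ipartial s Hu.
have [g /modE[g0 [N [c [eta [c0 eta0 Hg]]]]] [C [eta' [C0 eta'0 HC]]]] :=
  bigO1_O_on (regular_O1 (Hr 0%N)) (regular_O1 (Hi 0%N)) cK.
exists N, (C * (c + 1)), (Num.min eta eta').
split; [by rewrite mulr_gt0 // ltr_wpDl|by rewrite lt_min eta0|].
move=> e; rewrite lt_min => /andP[e1 e2] x Kx; rewrite (le_trans (HC e e2 x Kx)) //.
rewrite -mulrA ler_wpM2l ?(ltW C0) // (le_trans (Hg e e1)) // ler_wpM2r ?lerDl //.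
by rewrite invr_ge0 exprn_ge0 // ltW // eps_gt0.
Qed.

Lemma cregular_slow u : (forall e, smooth (u e)) ->
  (forall K s, compact K -> exists2 mu, slow_scale mu &
    O_on K (nipartial s u) (fun e => Normc.normc (mu e))) -> cregular slowB u.
Proof.
move=> su Hu; apply: smooth_cregular => // s; apply: O_on_bigO1 => [e x|r]; first exact: (su e s x).
have [mu smu H] := Hu _ s (@compact_norm_ball r).
by exists (fun e => Normc.normc (mu e)) => //; exact: slow_scale_bound.
Qed.

Lemma slow_cregular u : cregular slowB u -> forall K s, compact K ->
  exists2 mu, slow_scale mu & O_on K (nipartial s u) (fun e => Normc.normc (mu e)).
Proof.
move=> Hu K s cK; have [Hr Hi] := cregular_ipartial s Hu.
have [g Bg HC] := bigO1_O_on (regular_O1 (Hr 0%N)) (regular_O1 (Hi 0%N)) cK.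
exists (fun e => ((g e)%:C)%C); first exact: slow_bound_scale.
apply: O_on_le HC => e; rewrite normc_real; exact: ler_norm.
Qed.

Definition rapid (f : eps_index R -> V -> R) := forall r (q : nat), exists c eta,
  0 < eta /\ forall e, sval e < eta -> forall p, `|p| <= r -> `|f e p| <= c * sval e ^+ q.

Lemma rapid_negligible0 u : negligible0 u <-> rapid (re_net u) /\ rapid (im_net u).
Proof.
split=> [Hu|[Hr Hi] K /compact_norm_bounded[r _ Kr] q].
  split=> r q; have [C [eta [C0 eta0 H]]] := Hu _ (@compact_norm_ball r) q;
    exists C, eta; split=> // e ee p pr.
  - exact: le_trans (normc_Re_le _) (H e ee p pr).
  - exact: le_trans (normc_Im_le _) (H e ee p pr).
have [c [eta [eta0 H]]] := Hr r q; have [c' [eta' [eta'0 H']]] := Hi r q.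
exists (`|c| + `|c'| + 1), (Num.min eta eta').
split; [by rewrite ltr_wpDl ?addr_ge0|by rewrite lt_min eta0|].
move=> e; rewrite lt_min => /andP[e1 e2] p /Kr pr.
have q0 : 0 <= sval e ^+ q by rewrite exprn_ge0 // ltW // eps_gt0.
rewrite (le_trans (normc_le_ReIm _)) // (@le_trans _ _ ((`|c| + `|c'|) * sval e ^+ q)) //.
  rewrite mulrDl lerD //.
    by rewrite (le_trans (H e e1 p pr)) // ler_wpM2r // ler_norm.
  by rewrite (le_trans (H' e e2 p pr)) // ler_wpM2r // ler_norm.
by rewrite ler_wpM2r // lerDl.
Qed.

(* Landau's trick: a difference quotient with step a high power of eps
   transfers the smallness of a moderate net to its gradient. *)
Lemma rapid_gradient (f : eps_index R -> V -> R) g i : locD1 modB f g -> rapid f -> rapid (g i).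
Proof.
move=> HD Hf r q.
have [C BC HC] := HD (`|r| + 1).
have /modE[C0 [N [c [eta [c0 eta0 Hc]]]]] := BC.
have [c' [eta' [eta'0 H']]] := Hf (`|r| + 1) (N + q + q)%N.
exists (`|c'| + `|c'| + c), (Num.min eta eta'); split; first by rewrite lt_min eta0.
move=> e; rewrite lt_min => /andP[e1 e2] p pr.
have ee0 := eps_gt0 e.
(* The Taylor constant grows at most like eps^(-N), so the remainder divided by h is O(eps^q);
   taking f of order eps^(N + 2q) makes f/h of order eps^q too. *)
pose h := sval e ^+ (N + q).
have h0 : 0 < h by rewrite exprn_gt0.
have h1 : h <= 1 by rewrite exprn_ile1 ?eps_le1 // ltW.
pose p' := p + h *: delta_mx 0 i.
have pp' : p' - p = h *: delta_mx 0 i by rewrite addrAC subrr add0r.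
have dn : `|p' - p| <= h.
  rewrite pp'; apply: row_norm_le => [|j]; first exact: ltW.
  by rewrite !mxE eqxx; case: (j == i) => /=; rewrite ?mulr1 ?mulr0 ?normr0 ?gtr0_norm // ltW.
have pR : `|p| <= `|r| + 1 by rewrite (le_trans pr) // (le_trans (ler_norm _)) // lerDl.
have p'R : `|p'| <= `|r| + 1.
  rewrite -(subrK p p') addrC (le_trans (ler_normD _ _)) // lerD ?(le_trans dn) //.
  exact: le_trans pr (ler_norm _).
have := HC e (p, p'); rewrite prod_normE ge_max /= pR p'R => /(_ isT).
have -> : \sum_j (p' - p) 0 j * g j e p = h * g i e p.
  rewrite pp' (bigD1 i) //= !mxE !eqxx mulr1 big1 ?addr0 // => j /negPf ji.
  by rewrite !mxE ji andbF mulr0 mul0r.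
move=> H.
have F x : `|x| <= `|r| + 1 -> `|f e x| <= `|c'| * sval e ^+ q * h.
  move=> xR; rewrite (le_trans (H' e e2 x xR)) // -mulrA -exprD addnC ler_wpM2r ?ler_norm //.
  by rewrite exprn_ge0 // ltW.
have Ch : C e * `|p' - p| ^+ 2 <= c * sval e ^+ q * h.
  apply: (@le_trans _ _ (c * sval e ^- N * h ^+ 2)).
    by rewrite ler_pM ?exprn_ge0 // ?Hc // lerXn2r ?nnegrE ?(ltW h0).
  rewrite expr2 mulrA ler_wpM2r ?(ltW h0) // -mulrA ler_wpM2l // /h exprD mulKf //.
  by rewrite expf_neq0 // gt_eqF.
rewrite -(ler_pM2l h0) -[X in X * _ <= _](gtr0_norm h0) -normrM.
have -> : h * g i e p = (f e p' - f e p) - (f e p' - f e p - h * g i e p) by ring.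
rewrite (le_trans (ler_normB _ _)) // [leRHS]mulrC 2!mulrDl lerD ?(le_trans H) //.
by rewrite (le_trans (ler_normB _ _)) // 2!mulrDl lerD // F.
Qed.

Lemma regular_rapid_derive (f : eps_index R -> V -> R) i : regularoo modB f -> rapid f ->
  rapid (fun e x => 'D_(delta_mx 0 i) (f e) x).
Proof.
move=> rf Hf; have [_ _ [g _ H]] := rf 1%N.
have -> : (fun e x => 'D_(delta_mx 0 i) (f e) x) = g i.
  by apply/funext => e; apply/funext => x; have [_ ->] := locD1_derive H e x.
exact: rapid_gradient H Hf.
Qed.

(** Landau's trick is applied once for each derivative. In consequence, equality of classes of
    moderate nets can be tested on values. *)
Lemma moderate_negligible0 u : moderate u -> negligible0 u ->
  forall s, negligible0 (nipartial s u).
Proof.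
move=> /moderate_cregular Hu /rapid_negligible0 nu s; apply/rapid_negligible0.
elim: s u Hu nu => [//|j s IH] u [Hr Hi] [nr ni].
apply: (IH (npartial j u)); first exact: cregular_partial.
by split; exact: regular_rapid_derive.
Qed.

End NetBounds.

Section Representatives.
Context {R : realType} {d : nat}.
Implicit Types (u v w : net R d) (a b : colombeau R d).

Lemma represents_moderate v a : represents v a -> moderate v.
Proof. by move=> [u [<- _]]; exact: moderate_netP. Qed.

Lemma represents_gclass v (Mv : moderate v) :
  represents v (gclass (ModerateNet (moderate_in Mv))).
Proof. by exists (ModerateNet (moderate_in Mv)). Qed.

Lemma represents_exists a : exists v, represents v a.
Proof. by exists (repr a : moderate_net R d), (repr a); rewrite /gclass reprK. Qed.

Lemma represents_sub_negligible v w a : represents v a -> represents w a ->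
  forall K s (q : nat), compact K -> O_on K (nipartial s (v - w)) (fun e => sval e ^+ q).
Proof.
move=> [v' [<- Hv]] [w' [<- Hw]] K s q cK.
have /gclass_eq H : gclass v' = gclass w' by rewrite Hv Hw.
exact: H K s q cK.
Qed.

Lemma represents_sub_negligible0 v w a : represents v a -> represents w a ->
  negligible0 (v - w).
Proof. by move=> Hv Hw K cK q; exact: (represents_sub_negligible Hv Hw [::] q cK). Qed.

Lemma represents_negligible0 v w a : represents v a -> moderate w -> negligible0 (w - v) ->
  represents w a.
Proof.
move=> [v' [<- <-]] Mw nwv; exists (ModerateNet (moderate_in Mw)); split=> //.
apply/gclass_eq => K s q cK.
have Md : moderate (w - (v' : net R d)).
  have := moderate_netP (ModerateNet (moderate_in Mw) - v'); exact.
exact: (moderate_negligible0 Md nwv s cK q).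
Qed.

Lemma represents_eq v w a b : represents v a -> represents w b -> negligible0 (w - v) ->
  a = b.
Proof.
move=> Hv Hw nwv.
have [w' [E <-]] := represents_negligible0 Hv (represents_moderate Hw) nwv.
by move: Hw => [w'' [E' <-]]; congr gclass; apply: val_inj; rewrite /= E E'.
Qed.

Lemma represents_inj v a b : represents v a -> represents v b -> a = b.
Proof. by move=> [v' [E <-]] [w' [E' <-]]; congr gclass; apply: val_inj; rewrite /= E. Qed.

Lemma representsM v w a b : represents v a -> represents w b -> represents (v * w) (a * b).
Proof.
move=> [v' [<- <-]] [w' [<- <-]]; exists (v' * w'); split=> //.
by rewrite /gclass rmorphM.
Qed.

Lemma representsD v w a b : represents v a -> represents w b -> represents (v + w) (a + b).
Proof.
move=> [v' [<- <-]] [w' [<- <-]]; exists (v' + w'); split=> //.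
by rewrite /gclass rmorphD.
Qed.

Lemma representsN v a : represents v a -> represents (- v) (- a).
Proof.
move=> [v' [<- <-]]; exists (- v'); split=> //.
by rewrite /gclass rmorphN.
Qed.

Lemma represents_partial j v a : represents v a -> represents (npartial j v) (gpartial j a).
Proof. by move=> [v' [<- <-]]; exists (mpartial j v'); rewrite gpartial_class. Qed.

Lemma represents_cst (c : R[i]) : represents (fun _ _ => c) (gcst c : colombeau R d).
Proof. by exists (mcst c). Qed.

Lemma represents_gD j v a : represents v a ->
  represents ((fun _ _ => Complex 0 (-1)) * npartial j v) (gD j a).
Proof. by move=> Hv; apply: representsM; [exact: represents_cst|exact: represents_partial]. Qed.

Lemma represents1 : represents (fun _ _ => 1) (1 : colombeau R d).
Proof.
exists (mcst 1); split=> //; rewrite /gclass (_ : mcst 1 = 1) ?rmorph1 //.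
exact: val_inj.
Qed.

End Representatives.

Lemma represents_sum {R : realType} {d N : nat} (v : 'I_N -> net R d) (a : 'I_N -> colombeau R d) :
  (forall j, represents (v j) (a j)) -> represents (\sum_j v j) (\sum_j a j).
Proof.
move=> H; elim: (index_enum _) => [|j r IH].
  rewrite !big_nil; exists 0; split=> //; by rewrite /gclass rmorph0.
by rewrite !big_cons; exact: representsD.
Qed.

Lemma represents_pull {R : realType} {m d : nat} (L : {linear 'rV[R]_m -> 'rV[R]_d}) v a :
  represents v a -> represents (npull L v) (gpull L a).
Proof. by move=> [v' [<- <-]]; exists (mpull L v'); rewrite gpull_class. Qed.

(** * Cut-off functions *)

Section SmoothOneVariable.
Context {R : realType}.
Implicit Types (f g : R -> R).

(** A coinductive form of smoothness: [f] belongs to some family of functions closed under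
    differentiation. For [flat] this family is explicit. *)
Definition smooth1 f := exists P : (R -> R) -> Prop,
  P f /\ forall g, P g -> exists2 g', P g' & forall x : R, is_derive x 1 g (g' x).

Lemma bounded_on_segment f (T : R) : continuous f ->
  exists2 M, 0 <= M & forall x, `|x| <= T -> `|f x| <= M.
Proof.
move=> cf; have : compact (f @` `[- T, T]%classic).
  by apply: continuous_compact; [exact: continuous_subspaceT|exact: segment_compact].
move=> /compact_bounded [M [_ HM]]; exists (`|M| + 1) => [|x xT]; first exact: addr_ge0.
apply: HM; first by rewrite (le_lt_trans (ler_norm _)) // ltrDl.
by exists x => //=; rewrite in_itv /= -ler_norml.
Qed.

Lemma smooth1_regular (B : bound_class R) k f : smooth1 f ->
  regular B k (fun _ (v : 'rV[R]_1) => f (v 0 0)).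
Proof.
move=> [P [Pf HP]]; elim: k f Pf => [|k IH] f Pf.
  have [f' Pf' ff'] := HP f Pf; have [f'' _ ff''] := HP f' Pf'.
  split=> //.
    move=> r; have [M M0 HM] := bounded_on_segment r (derive_continuous ff').
    exists (fun=> M); first exact: bounds_cst.
    by move=> e v vr; rewrite mulr1 HM // (le_trans (coord_le_norm _ _)).
  move=> r; have [M M0 HM] := bounded_on_segment r (derive_continuous ff'').
  exists (fun=> M); first exact: bounds_cst.
  move=> e [v w]; rewrite prod_normE ge_max /= => /andP[vr wr].
  rewrite (le_trans (mvt_norm ff' HM _ _)) ?(le_trans (coord_le_norm _ _)) //.
  by rewrite ler_wpM2l // -row_subE coord_le_norm.
have [f' Pf' ff'] := HP f Pf; have [f'' Pf'' ff''] := HP f' Pf'.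
have [f3 _ ff3] := HP f'' Pf''.
apply: (@regularSI _ _ _ _ _ (fun _ _ v => f' (v 0 0))).
- by have := IH f Pf; exact: regular_O1.
- by move=> _; exact: IH.
- move=> r; have [M M0 HM] := bounded_on_segment r (derive_continuous ff3).
  exists (fun=> M); first exact: bounds_cst.
  move=> e [v w]; rewrite prod_normE ge_max /= => /andP[vr wr].
  have v0 : `|v 0 0| <= r by exact: le_trans (coord_le_norm _ _) vr.
  have w0 : `|w 0 0| <= r by exact: le_trans (coord_le_norm _ _) wr.
  rewrite big_ord_recl big_ord0 addr0 row_subE.
  have [c [c1 c2 ->]] := mvt_between (v 0 0) (w 0 0) ff'.
  rewrite mulrC -mulrBr normrM.
  have := mvt_norm ff'' HM v0 (c2 _ v0 w0) => H.
  apply: (@le_trans _ _ (`|w 0 0 - v 0 0| * (M * `|w 0 0 - v 0 0|))).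
    by rewrite ler_wpM2l // (le_trans H) // ler_wpM2l.
  rewrite mulrCA ler_wpM2l // expr2 -row_subE.
  by rewrite ler_pM // coord_le_norm.
Qed.

Lemma regular_comp1 (B : bound_class R) d k f (u : eps_index R -> 'rV[R]_d -> R) :
  regular B k (fun _ (v : 'rV[R]_1) => f (v 0 0)) -> bounded_net u -> regular B k u ->
  regular B k (fun e p => f (u e p)).
Proof.
move=> rf bu ru.
have := @regular_comp R B d 1 k (fun _ v => f (v 0 0)) (fun=> u) (fun=> bu) rf (fun=> ru).
congr regular; apply/funext => e; apply/funext => p; by rewrite mxE.
Qed.

End SmoothOneVariable.

(** * Smooth steps from exp(-1/x) *)

Section Bump.
Context {R : realType}.
Implicit Types (p : {poly R}).

(** p(1/x) exp(-1/x) for x > 0, extended by 0. Differentiation replaces p by (p - p') X^2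
    ([flat_derive]), so these functions form a family as in [smooth1]. *)
Definition flat p (x : R) := if 0 < x then p.[x^-1] * expR (- x^-1) else 0.

Lemma horner_pow_bound p : exists2 M, 0 <= M &
  forall y, 1 <= y -> `|p.[y]| <= M * y ^+ size p.
Proof.
exists (\sum_(i < size p) `|p`_i|) => [|y y1]; first exact: sumr_ge0.
rewrite horner_coef (le_trans (ler_norm_sum _ _ _)) // mulr_suml ler_sum // => i _.
rewrite normrM ler_wpM2l // ger0_norm ?exprn_ge0 ?(le_trans ler01) //.
by rewrite ler_weXn2l // ltnW.
Qed.

(** With y = 1/h, the inequality exp(y) >= y^n / n! for n = [size p] + 2 beats |p(y)| <= M y^(size
    p) by the factor y^(-2) = h^2. The quadratic bound yields the derivative 0 at the origin. *)
Lemma flat_bound p : exists2 C, 0 <= C & forall h, `|h| <= 1 -> `|flat p h| <= C * h ^+ 2.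
Proof.
have [M M0 HM] := horner_pow_bound p.
pose F : R := ((size p).+2)`!%:R.
have F0 : 0 < F by rewrite ltr0n fact_gt0.
exists (M * F) => [|h h1]; first by rewrite mulr_ge0 // ltW.
rewrite /flat; case: ifP => [h0|_]; last by rewrite normr0 mulr_ge0 ?sqr_ge0 // mulr_ge0 // ltW.
move: h1; rewrite gtr0_norm // => h1.
have y1 : 1 <= h^-1 by rewrite invf_ge1.
have y0 : 0 < h^-1 by rewrite invr_gt0.
rewrite normrM (ger0_norm (expR_ge0 _)) expRN.
have := expR_ge1Dxn (size p).+1 (ltW y0); set y := h^-1; rewrite -/F => He.
have {}He : y ^+ (size p).+2 / F <= expR y by rewrite (le_trans _ He) // lerDr.
have P : 0 < y ^+ (size p).+2 / F by rewrite divr_gt0 // exprn_gt0.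
apply: (@le_trans _ _ ((M * y ^+ size p) * (y ^+ (size p).+2 / F)^-1)).
  by rewrite ler_pM ?invr_ge0 ?expR_ge0 ?HM // lef_pV2 ?posrE ?expR_gt0.
have -> : h = y^-1 by rewrite /y invrK.
have yn : y != 0 by rewrite gt_eqF.
have ypn : y ^+ size p != 0 by rewrite expf_neq0.
have Fn : F != 0 by rewrite gt_eqF.
rewrite le_eqVlt; apply/orP; left; apply/eqP.
by rewrite !exprS; field; rewrite yn ypn Fn.
Qed.

Lemma is_derive_quadratic (f : R -> R) (x c C : R) :
  (forall h, `|h| <= 1 -> `|f (h + x) - f x - h * c| <= C * h ^+ 2) -> is_derive x 1 f c.
Proof.
move=> H.
have lim : (fun h => h^-1 *: (f (h *: 1 + x) - f x)) @ (0 : R)^' --> c.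
  apply/cvgrPdist_le => e e0.
  have C1 : 0 < `|C| + 1 by rewrite ltr_wpDl.
  have d0 : 0 < Num.min 1 (e / (`|C| + 1)) by rewrite lt_min ltr01 divr_gt0.
  near=> h.
  have h0 : h != 0 by near: h; exact: nbhs_dnbhs_neq.
  have hn : `|h| <= Num.min 1 (e / (`|C| + 1)).
    near: h; apply: nbhs_dnbhs; have := near_dist_le (0 : R) d0.
    by apply: filterS => t; rewrite sub0r normrN.
  move: hn; rewrite le_min => /andP[h1 hC].
  rewrite /GRing.scale /= mulr1 distrC.
  rewrite (_ : _ - c = h^-1 * (f (h + x) - f x - h * c)); last by field.
  rewrite normrM normfV ler_pdivrMl ?normr_gt0 // (le_trans (H h h1)) //.
  rewrite -(real_normK (num_real h)) expr2 mulrCA ler_wpM2l //.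
  rewrite (@le_trans _ _ ((`|C| + 1) * `|h|)) //.
    by rewrite ler_wpM2r // (le_trans (ler_norm _)) // lerDl.
  by rewrite mulrC -ler_pdivlMr.
by apply: DeriveDef; [apply/cvg_ex; exists c|exact: cvg_lim].
Unshelve. all: by end_near. Qed.

Lemma flat_derive p (x : R) : is_derive x 1 (flat p) (flat ((p - p^`()) * 'X^2) x).
Proof.
have [x0|x0|->] := ltgtP x 0.
- rewrite {2}/flat ltNge (ltW x0) /=.
  apply: (@near_eq_is_derive _ _ _ (fun _ : R => 0 : R)).
  near=> z; rewrite /flat ltNge ifF //; apply/negbTE; rewrite negbK; apply: ltW.
  by near: z; exact: lt_nbhsl.
- have dinv : is_derive x 1 (fun y : R => y^-1) (- x ^- 2).
    have := @is_deriveV R (@id R) x 1 1 (lt0r_neq0 x0) (is_derive_id x 1).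
    by rewrite /GRing.scale /= mulr1.
  apply: (@near_eq_is_derive _ _ _ (fun y : R => p.[y^-1] * expR (- y^-1) : R)).
    near=> z; rewrite /flat ifT //; near: z; exact: lt_nbhsr.
  rewrite /flat x0.
  have d1 : is_derive x 1 (fun y : R => p.[y^-1]) ((p^`()).[x^-1] * - x ^- 2).
    exact: (@is_derive1_comp R (horner p) (fun y => y^-1)).
  have d2 : is_derive x 1 (fun y : R => expR (- y^-1)) (x ^- 2 * expR (- x^-1)).
    have := @is_derive1_comp R expR (fun y => - y^-1) x _ _ (is_derive_expR _) (is_derive_opp dinv).
    by rewrite opprK mulrC.
  apply: is_derive_val (is_derive_mul d1 d2) _.
  by rewrite hornerM hornerXn hornerD hornerN -exprVn; ring.
- rewrite {2}/flat ltxx; have [C C0 HC] := flat_bound p.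
  apply: (@is_derive_quadratic _ _ _ C) => h h1.
  by rewrite addr0 mulr0 subr0 {2}/flat ltxx subr0 HC.
Unshelve. all: by end_near. Qed.

Lemma flat_smooth p : smooth1 (flat p).
Proof.
exists (fun f => exists p, f = flat p); split; first by exists p.
by move=> _ [q ->]; exists (flat ((q - q^`()) * 'X^2));
  [exists ((q - q^`()) * 'X^2)|move=> x; exact: flat_derive].
Qed.

(** Positive on (0,1) and zero elsewhere, so that its primitive [step] is constant on both sides of
    that interval. *)
Definition bump (s : R) := flat 1 s * flat 1 (1 - s).

Lemma flat1_ge0 s : 0 <= flat 1 s.
Proof. by rewrite /flat; case: ifP => // _; rewrite hornerC mul1r expR_ge0. Qed.

Lemma bump_regular (B : bound_class R) k : regular B k (fun _ (v : 'rV[R]_1) => bump (v 0 0)).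
Proof.
apply: regularM; first exact: smooth1_regular (flat_smooth _).
apply: (@regular_comp1 _ _ _ _ (flat 1) (fun _ v => 1 - v 0 0)).
- exact: smooth1_regular (flat_smooth _).
- apply: (@regular_O1 _ _ _ 0); apply: regularB; [exact: regular_cst|exact: regular_coord].
- by apply: regularB; [exact: regular_cst|exact: regular_coord].
Qed.

Definition step (s : R) := oriented_integral 0 s bump.

Lemma flat_continuous p : continuous (flat p).
Proof. exact: derive_continuous (flat_derive p). Qed.

Lemma bump_continuous : continuous bump.
Proof.
move=> s; apply: cvgM; first exact: flat_continuous.
have c : continuous (flat 1 \o (fun s : R => 1 - s)).
  move=> z; apply: continuous_comp; last exact: flat_continuous.
  by apply: continuousB; [exact: cst_continuous|exact: cvg_id].
exact: c.
Qed.

Lemma step_derive (s : R) : is_derive s 1 step (bump s).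
Proof. exact: oriented_integral_derive bump_continuous s. Qed.

(** A primitive is the solution of a linear equation with zero matrix, here without parameters, so
    [linear_ode_regular] applies with [m = 0]. *)
Lemma step_regular (B : bound_class R) k : regular B k (fun _ (v : 'rV[R]_1) => step (v 0 0)).
Proof.
pose A (_ _ : 'I_1) (_ : eps_index R) (_ : 'rV[R]_(0 + 1)) : R := 0.
pose r (_ : 'I_1) (_ : eps_index R) (v : 'rV[R]_(0 + 1)) : R := bump (v 0 0).
pose w (_ : 'I_1) (_ : eps_index R) (_ : 'rV[R]_0) (s : R) : R := step s.
have ode : linear_ode A r (fun _ _ _ => 0) w.
  split=> [j e q|j e q s]; first exact: oriented_integral0.
  apply: is_derive_val (step_derive s) _.
  rewrite big1 ?add0r => [|k' _]; last by rewrite mul0r.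
  rewrite /r; congr bump; rewrite -[LHS](time_joint q s) /time_part.
  by congr (joint q s 0 _); apply: val_inj.
have E : (fun (_ : eps_index R) (v : 'rV[R]_(0 + 1)) => step (v 0 0)) = uncurry_time (w ord0).
  apply/funext => e; apply/funext => v; rewrite /uncurry_time /w /time_part.
  by congr (step (v 0 _)); apply: val_inj.
change (@regular R B (0 + 1) k (fun (_ : eps_index R) (v : 'rV[R]_(0 + 1)) => step (v 0 0))).
rewrite E; apply: (linear_ode_regular (A := A) _ ode) => [j l|j l|j|j].
- move=> r'; exists (fun=> 0); first exact: exp_bounds_cst.
  by move=> e p _; rewrite normr0.
- exact: regular_cst.
- exact: bump_regular.
- exact: regular_cst.
Qed.

Lemma step_le0 s : s <= 0 -> step s = 0.
Proof.
move=> s0; have [c /andP[_ c0]] := mvt s0 (fun x _ => step_derive x).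
rewrite /bump {1}/flat ltNge c0 /= !mul0r {1}/step oriented_integral0 sub0r.
by move=> /eqP; rewrite oppr_eq0 => /eqP.
Qed.

Lemma step_ge1 s : 1 <= s -> step s = step 1.
Proof.
move=> s1; have [c /andP[c1 _]] := mvt s1 (fun x _ => step_derive x).
rewrite /bump {2}/flat subr_gt0 ltNge c1 /= mulr0 mul0r => /eqP.
by rewrite subr_eq0 => /eqP.
Qed.

Lemma step1_gt0 : 0 < step 1.
Proof.
have mono (a b : R) : a <= b -> step a <= step b.
  move=> ab; apply: (ger0_derive_le ab (fun x _ => step_derive x)) => x _.
  by rewrite mulr_ge0 ?flat1_ge0.
(* On a segment inside (0,1), here [1/3, 1/2], the bump is strictly positive, so that [step] gains a
   positive amount across it. *)
have h1 : (3^-1 : R) <= 2^-1 by rewrite lef_pV2 ?posrE // ler_nat.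
have [c /andP[c1 c2] H] := mvt h1 (fun x _ => step_derive x).
have s3 : 0 <= step 3^-1.
  by have := mono 0 3^-1; rewrite {1}/step oriented_integral0; apply; rewrite invr_ge0.
have s2 : step 2^-1 <= step 1 by apply: mono; rewrite invf_le1 // ler1n.
suff : 0 < bump c * (2^-1 - 3^-1) by lra.
have c0 : 0 < c by rewrite (lt_le_trans _ c1) // invr_gt0.
have c3 : 0 < 1 - c by rewrite subr_gt0 (le_lt_trans c2) // invf_lt1 // ltr1n.
rewrite mulr_gt0 // ?subr_gt0 ?ltf_pV2 ?posrE ?ltr_nat //.
by rewrite /bump /flat c0 c3 !hornerC !mul1r mulr_gt0 ?expR_gt0.
Qed.

End Bump.

Section Cutoff.
Context {R : realType} {n : nat}.

Lemma regular_prod (B : bound_class R) d k N (f : 'I_N -> eps_index R -> 'rV[R]_d -> R) :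
  (forall j, regular B k (f j)) -> regular B k (fun e p => \prod_j f j e p).
Proof.
move=> H; elim: (index_enum _) => [|j r IH].
  have := regular_cst B k (1 : R); move=> /(_ d); congr regular.
  by apply/funext => e; apply/funext => p; rewrite big_nil.
have := regularM (H j) IH; congr regular.
by apply/funext => e; apply/funext => p; rewrite big_cons.
Qed.

Lemma row_norm_attained (v : 'rV[R]_n) : 0 < `|v| -> exists j, `|v| = `|v 0 j|.
Proof.
move=> v0; have [|[i j] /= H] := @mx_norm_neq0 R 1 n v; first by rewrite gt_eqF.
by exists j; rewrite (ord1 i) in H; rewrite [LHS]/Num.Def.normr /= H.
Qed.

(** The norm is the maximum norm, so a product over the coordinates of normalised steps in both
    directions works: all arguments are at least 1 when the norm is at most [rho], and a coordinate
    attaining the norm makes one argument nonpositive when the norm is at least [rho + 1]. *)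
Lemma cutoff_exists (rho : R) : 0 <= rho -> exists X : 'rV[R]_(1 + n) -> R,
  [/\ forall (B : bound_class R) k, regular B k (fun _ p => X p),
      forall p, `|rsubmx p| <= rho -> X p = 1 &
      forall p, rho + 1 <= `|rsubmx p| -> X p = 0].
Proof.
move=> rho0.
exists (fun p => \prod_(j < n) (((step (1 : R))^-1 * step (rho + 1 - p 0 (rshift 1 j))) *
  ((step (1 : R))^-1 * step (rho + 1 + p 0 (rshift 1 j))))).
have s1 := @step1_gt0 R; split=> [B k|p pr|p pr].
- apply: (regular_prod (f := fun j (_ : eps_index R) (p : 'rV[R]_(1 + n)) =>
    ((step (1 : R))^-1 * step (rho + 1 - p 0 (rshift 1 j))) *
    ((step (1 : R))^-1 * step (rho + 1 + p 0 (rshift 1 j))))) => j.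
  have rc c B' : regular B' k (fun (_ : eps_index R) (_ : 'rV[R]_(1 + n)) => (c : R)).
    exact: regular_cst.
  have rx B' : regular B' k (fun (_ : eps_index R) (p : 'rV[R]_(1 + n)) => p 0 (rshift 1 j)).
    exact: regular_coord.
  apply: regularM; apply: regularM => //.
    apply: (@regular_comp1 _ _ _ _ (@step R) (fun _ p => rho + 1 - p 0 (rshift 1 j))).
    + exact: step_regular.
    + by apply: (@regular_O1 _ _ _ k); exact: regularB.
    + exact: regularB.
  apply: (@regular_comp1 _ _ _ _ (@step R) (fun _ p => rho + 1 + p 0 (rshift 1 j))).
  + exact: step_regular.
  + by apply: (@regular_O1 _ _ _ k); exact: regularD.
  + exact: regularD.
- rewrite big1 // => j _.
  have : `|p 0 (rshift 1 j)| <= rho.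
    by rewrite (le_trans _ pr) // (le_trans _ (coord_le_norm _ j)) // mxE.
  rewrite ler_norml => /andP[H1 H2].
  by rewrite !step_ge1 ?mulVf ?mul1r ?gt_eqF //; lra.
- have p0 : 0 < `|rsubmx p| by rewrite (lt_le_trans _ pr) // ltr_wpDl.
  have [j Hj] := row_norm_attained p0.
  rewrite (bigD1 j) //=; move: pr; rewrite Hj mxE.
  have [x0|x0] := leP 0 (p 0 (rshift 1 j)).
    rewrite ger0_norm // => H; rewrite [step (rho + 1 - _)]step_le0 ?mulr0 ?mul0r ?mulr0 ?mul0r //; lra.
  rewrite ltr0_norm // => H; rewrite (@step_le0 _ (rho + 1 + p 0 (rshift 1 j)))
    ?mulr0 ?mul0r ?mulr0 ?mul0r //; lra.
Qed.

End Cutoff.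

(** * Exponentials and supports *)

Section ComplexNets.
Context {R : realType} {d : nat}.
Local Notation V := 'rV[R]_d.
Implicit Types (u v : net R d) (B : bound_class R) (f g : eps_index R -> V -> R).

Lemma re_netM u v : re_net (u * v) =
  fun e p => re_net u e p * re_net v e p - im_net u e p * im_net v e p.
Proof.
apply/funext => e; apply/funext => p; rewrite /re_net /im_net.
by rewrite [(u * v) e p]/(u e p * v e p); case: (u e p) => a b; case: (v e p).
Qed.

Lemma im_netM u v : im_net (u * v) =
  fun e p => re_net u e p * im_net v e p + im_net u e p * re_net v e p.
Proof.
apply/funext => e; apply/funext => p; rewrite /re_net /im_net.
by rewrite [(u * v) e p]/(u e p * v e p); case: (u e p) => a b; case: (v e p).
Qed.

Lemma re_netD u v : re_net (u + v) = fun e p => re_net u e p + re_net v e p.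
Proof.
apply/funext => e; apply/funext => p; rewrite /re_net.
by rewrite [(u + v) e p]/(u e p + v e p); case: (u e p) => a b; case: (v e p).
Qed.

Lemma im_netD u v : im_net (u + v) = fun e p => im_net u e p + im_net v e p.
Proof.
apply/funext => e; apply/funext => p; rewrite /im_net.
by rewrite [(u + v) e p]/(u e p + v e p); case: (u e p) => a b; case: (v e p).
Qed.

Lemma re_netB u v : re_net (u - v) = fun e p => re_net u e p - re_net v e p.
Proof.
apply/funext => e; apply/funext => p; rewrite /re_net.
by rewrite [(u - v) e p]/(u e p - v e p); case: (u e p) => a b; case: (v e p).
Qed.

Lemma im_netB u v : im_net (u - v) = fun e p => im_net u e p - im_net v e p.
Proof.
apply/funext => e; apply/funext => p; rewrite /im_net.
by rewrite [(u - v) e p]/(u e p - v e p); case: (u e p) => a b; case: (v e p).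
Qed.

Lemma cregularD B u v : cregular B u -> cregular B v -> cregular B (u + v).
Proof.
by move=> [ru iu] [rv iv]; split=> k; rewrite ?re_netD ?im_netD; exact: regularD.
Qed.

Lemma cregularM B u v : cregular B u -> cregular B v -> cregular B (u * v).
Proof.
move=> [ru iu] [rv iv]; split=> k; rewrite ?re_netM ?im_netM.
  by apply: regularB; exact: regularM.
by apply: regularD; exact: regularM.
Qed.

Lemma cregular_cst B (c : R[i]) : cregular B ((fun _ _ => c) : net R d).
Proof. by split=> k; exact: regular_cst. Qed.

Definition real_embed f : net R d := fun e p => ((f e p)%:C)%C.

Lemma cregular_real B f : regularoo B f -> cregular B (real_embed f).
Proof. by move=> rf; split=> // k; exact: regular_cst. Qed.

Lemma rapid_le f1 f2 g :
  (forall r, exists C eta, [/\ modB C, 0 < eta & forall e, sval e < eta ->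
    forall p, `|p| <= r -> `|g e p| <= C e * (`|f1 e p| + `|f2 e p|)]) ->
  rapid f1 -> rapid f2 -> rapid g.
Proof.
move=> H r1 r2 r q.
have [C [eta [/modE[C0 [N [c [eta' [c0 eta'0 Hc]]]]] eta0 HC]]] := H r.
have [c1 [eta1 [eta10 H1]]] := r1 r (N + q)%N.
have [c2 [eta2 [eta20 H2]]] := r2 r (N + q)%N.
exists (c * (`|c1| + `|c2|)), (Num.min (Num.min eta eta') (Num.min eta1 eta2)).
split; first by rewrite !lt_min eta0 eta'0 eta10.
move=> e; rewrite !lt_min => /andP[/andP[e1 e2] /andP[e3 e4]] p pr.
have e0 := eps_gt0 e.
rewrite (le_trans (HC e e1 p pr)) //.
have -> : c * (`|c1| + `|c2|) * sval e ^+ q =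
    (c * sval e ^- N) * ((`|c1| + `|c2|) * sval e ^+ (N + q)).
  by rewrite exprD; field; rewrite expf_neq0 // gt_eqF.
rewrite ler_pM ?addr_ge0 ?Hc // mulrDl lerD //.
  by rewrite (le_trans (H1 e e3 p pr)) // ler_wpM2r ?ler_norm // exprn_ge0 // ltW.
by rewrite (le_trans (H2 e e4 p pr)) // ler_wpM2r ?ler_norm // exprn_ge0 // ltW.
Qed.

Lemma rapid0 : rapid (fun _ (_ : V) => 0 : R).
Proof.
move=> r q; exists 0, 1; split=> // e _ p _; by rewrite normr0 mul0r.
Qed.

Lemma rapid_mul f g : bigO1 modB f -> rapid g -> rapid (fun e p => f e p * g e p).
Proof.
move=> Hf rg; apply: (rapid_le (f1 := g) (f2 := fun _ _ => 0)) => //; last exact: rapid0.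
move=> r; have [C BC HC] := Hf r; exists C, 1; split=> // e _ p pr.
by rewrite normr0 addr0 normrM ler_wpM2r // (le_trans (HC e p pr)) // mulr1.
Qed.

Lemma rapidD f g : rapid f -> rapid g -> rapid (fun e p => f e p + g e p).
Proof.
move=> rf rg; apply: (rapid_le (f1 := f) (f2 := g)) => // r.
exists (fun=> 1), 1; split=> // [|e _ p _]; first exact: bounds_cst.
by rewrite mul1r ler_normD.
Qed.

Lemma rapidN f : rapid f -> rapid (fun e p => - f e p).
Proof.
move=> rf; apply: (rapid_le (f1 := f) (f2 := f)) => // r.
exists (fun=> 1), 1; split=> // [|e _ p _]; first exact: bounds_cst.
by rewrite mul1r normrN lerDl.
Qed.

Lemma rapid_eq f g : (forall e p, f e p = g e p) -> rapid f -> rapid g.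
Proof.
by move=> fg; congr rapid; apply/funext => e; apply/funext => p.
Qed.

End ComplexNets.

Section Exponential.
Context {R : realType} {d : nat}.
Local Notation V := 'rV[R]_d.
Implicit Types (u beta : net R d) (B : bound_class R).

Definition cexpi beta : net R d := fun e p => cexp (Complex 0 1 * beta e p).

Lemma re_cexpi beta e p :
  re_net (cexpi beta) e p = expR (- im_net beta e p) * cos (re_net beta e p).
Proof.
rewrite /re_net /im_net /cexpi /cexp; case: (beta e p) => a b /=.
by rewrite !mul0r !mul1r !add0r.
Qed.

Lemma im_cexpi beta e p :
  im_net (cexpi beta) e p = expR (- im_net beta e p) * sin (re_net beta e p).
Proof.
rewrite /re_net /im_net /cexpi /cexp; case: (beta e p) => a b /=.
by rewrite !mul0r !mul1r !add0r.
Qed.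

Lemma derive_comp1 (f : V -> R) (g : R -> R) (g' : R) x (v : V) : differentiable f x ->
  is_derive (f x) 1 g g' ->
  differentiable (fun y => g (f y)) x /\ 'D_v (fun y => g (f y)) x = g' * 'D_v f x.
Proof.
move=> df gg'.
have dg : differentiable g (f x) by apply/derivable1_diffP; exact: ex_derive.
have dgf : differentiable (fun y => g (f y)) x by exact: (differentiable_comp df dg).
split=> //; rewrite !deriveE // (diff_comp df dg) /= deriv1E; last exact: ex_derive.
by rewrite derive1E derive_val /GRing.scale /= mulrC.
Qed.

Lemma cexpi_derive beta e x (v : V) : cdifferentiable (beta e) x ->
  [/\ cdifferentiable (cexpi beta e) x,
   'D_v (re_net (cexpi beta) e) x = - 'D_v (im_net beta e) x * re_net (cexpi beta) e x -
      'D_v (re_net beta e) x * im_net (cexpi beta) e x &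
   'D_v (im_net (cexpi beta) e) x = - 'D_v (im_net beta e) x * im_net (cexpi beta) e x +
      'D_v (re_net beta e) x * re_net (cexpi beta) e x].
Proof.
move=> [dr di].
have dni : differentiable (fun y => - im_net beta e y) x by exact: differentiableN.
have Dni : 'D_v (fun y => - im_net beta e y) x = - 'D_v (im_net beta e) x.
  by rewrite (@deriveN _ _ _ (im_net beta e)) //; exact: diff_derivable.
have [dE DE] := derive_comp1 (f := fun y => - im_net beta e y) v dni (is_derive_expR _).
have [dC DC] := derive_comp1 (f := re_net beta e) v dr (is_derive_cos _).
have [dS DS] := derive_comp1 (f := re_net beta e) v dr (is_derive_sin _).
have reE : re_net (cexpi beta) e =
    (fun y => expR (- im_net beta e y)) * (fun y => cos (re_net beta e y)).
  by apply/funext => y; rewrite re_cexpi.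
have imE : im_net (cexpi beta) e =
    (fun y => expR (- im_net beta e y)) * (fun y => sin (re_net beta e y)).
  by apply/funext => y; rewrite im_cexpi.
split.
- split; first by rewrite -[(fun y => _)]/(re_net (cexpi beta) e) reE; exact: differentiableM.
  by rewrite -[(fun y => _)]/(im_net (cexpi beta) e) imE; exact: differentiableM.
- rewrite [in LHS]reE deriveM; try exact: diff_derivable.
  rewrite DE Dni DC im_cexpi re_cexpi.
  by rewrite /GRing.scale /=; ring.
- rewrite [in LHS]imE deriveM; try exact: diff_derivable.
  rewrite DE Dni DS re_cexpi im_cexpi.
  by rewrite /GRing.scale /=; ring.
Qed.

Lemma npartial_cexpi beta j : (forall e x, cdifferentiable (beta e) x) ->
  npartial j (cexpi beta) = (fun _ _ => Complex 0 1) * npartial j beta * cexpi beta.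
Proof.
move=> db; apply/funext => e; apply/funext => x.
have [_ H1 H2] := cexpi_derive (delta_mx 0 j) (db e x).
have -> : npartial j (cexpi beta) e x = Complex ('D_(delta_mx 0 j) (re_net (cexpi beta) e) x)
  ('D_(delta_mx 0 j) (im_net (cexpi beta) e) x) by [].
rewrite H1 H2; transitivity (Complex 0 1 * (Complex ('D_(delta_mx 0 j) (re_net beta e) x)
  ('D_(delta_mx 0 j) (im_net beta e) x)) * cexpi beta e x); last by [].
rewrite /re_net /im_net; case: (cexpi beta e x) => a b /=.
by rewrite [RHS]/GRing.mul /=; congr Complex; ring.
Qed.

Definition cbigO1 B u := bigO1 B (re_net u) /\ bigO1 B (im_net u).

(** Every derivative of exp(i beta) has the form h exp(i beta) with h regular, and this form is
    stable under differentiation; so a bound on the exponential bounds all its derivatives. *)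
Lemma cexpi_regular B beta : cregular B beta -> cbigO1 B (cexpi beta) ->
  cregular B (cexpi beta).
Proof.
move=> rb Hb.
have db := cregular_diff rb.
have [s1 s2] : all_derivatives (cbigO1 B) (cexpi beta).
  apply: (@all_derivatives_coind R d (fun w => exists2 h, cregular B h & w = h * cexpi beta)).
    move=> _ [h rh ->].
    have dh := cregular_diff rh.
    have de e x : cdifferentiable (cexpi beta e) x by have [] := cexpi_derive 0 (db e x).
    split=> [e x||j].
    - exact: cdifferentiableM (dh e x) (de e x).
    - have [rh0 ih0] := rh; have [rE iE] := Hb.
      have O1 f : regularoo B f -> bigO1 B f by move=> /(_ 0%N); exact: regular_O1.
      rewrite /cbigO1 re_netM im_netM; split.
        by apply: locO_sub; apply: locO_mulr => //; exact: O1.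
      by apply: locO_add; apply: locO_mulr => //; exact: O1.
    - exists (npartial j h + h * ((fun _ _ => Complex 0 1) * npartial j beta)).
        apply: cregularD; first exact: cregular_partial.
        apply: cregularM => //; apply: cregularM; last exact: cregular_partial.
        exact: cregular_cst.
      by rewrite (npartialM j dh de) npartial_cexpi // mulrDl !mulrA.
  exists 1; last by rewrite mul1r.
  exact: (cregular_cst B (1 : R[i])).
exact: smooth_cregular.
Qed.

(** |exp(i beta)| = exp(-Im beta), which is bounded within [B] because Im beta is logarithmic
    relative to [B]. *)
Lemma cexpi_bigO1 B beta : (forall r, exists2 L, exp_bounds B L &
    forall e p, `|p| <= r -> `|im_net beta e p| <= L e) -> cbigO1 B (cexpi beta).
Proof.
move=> H; split=> r; have [L eL HL] := H r; exists (fun e => expR (1 * L e));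
  try (by apply: eL.2); move=> e p pr; rewrite mulr1 mul1r.
- rewrite re_cexpi normrM (ger0_norm (expR_ge0 _)) -[leRHS]mulr1 ler_pM ?expR_ge0 //.
    by rewrite ler_expR (le_trans (ler_norm _)) // normrN HL.
  by rewrite ler_norml cos_geN1 cos_le1.
- rewrite im_cexpi normrM (ger0_norm (expR_ge0 _)) -[leRHS]mulr1 ler_pM ?expR_ge0 //.
    by rewrite ler_expR (le_trans (ler_norm _)) // normrN HL.
  by rewrite ler_norml sin_geN1 sin_le1.
Qed.

(** Mean value theorem along the segment t -> (a + th, b + tk); the factor [expR 1] bounds exp(-tk)
    for |t|, |k| <= 1. *)
Lemma exp_cos_sin_lipschitz (a b h k : R) : `|k| <= 1 ->
  `|expR (- (b + k)) * cos (a + h) - expR (- b) * cos a| <= (`|h| + `|k|) * (expR (- b) * expR 1) /\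
  `|expR (- (b + k)) * sin (a + h) - expR (- b) * sin a| <= (`|h| + `|k|) * (expR (- b) * expR 1).
Proof.
move=> k1.
have da (x : R) : is_derive x 1 (fun t : R => a + t * h) h.
  apply: is_derive_val (is_derive_add (is_derive_const x a)
    (is_derive_mul (is_derive_id x 1) (is_derive_const x h))) _.
  by rewrite mulr0 addr0 mul1r add0r.
have dE (x : R) : is_derive x 1 (fun t : R => expR (- (b + t * k))) (- k * expR (- (b + x * k))).
  have db : is_derive x 1 (fun t : R => - (b + t * k)) (- k).
    apply: is_derive_opp; apply: is_derive_val (is_derive_add (is_derive_const x b)
      (is_derive_mul (is_derive_id x 1) (is_derive_const x k))) _.
    by rewrite mulr0 addr0 mul1r add0r.
  by rewrite mulrC; exact: (@is_derive1_comp R expR).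
have dC (x : R) : is_derive x 1 (fun t : R => cos (a + t * h)) (- h * sin (a + x * h)).
  by rewrite mulNr -mulrN mulrC; exact: (@is_derive1_comp R cos).
have dS (x : R) : is_derive x 1 (fun t : R => sin (a + t * h)) (h * cos (a + x * h)).
  by rewrite mulrC; exact: (@is_derive1_comp R sin).
have n0 : `|0 : R| <= 1 by rewrite normr0.
have n1 : `|1 : R| <= 1 by rewrite normr1.
have Eb (x : R) : `|x| <= 1 -> expR (- (b + x * k)) <= expR (- b) * expR 1.
  move=> x1; rewrite -expRD ler_expR opprD lerD2l (le_trans (ler_norm _)) // normrN normrM.
  by rewrite mulr_ile1.
have bnd (x s c : R) : `|x| <= 1 -> `|s| <= 1 -> `|c| <= 1 ->
    `|- k * expR (- (b + x * k)) * c + expR (- (b + x * k)) * s * h| <=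
     (`|h| + `|k|) * (expR (- b) * expR 1).
  move=> x1 s1 c1; have E0 := expR_ge0 (- (b + x * k)).
  have := Eb x x1; set E := expR _ => EE.
  rewrite (le_trans (ler_normD _ _)) // !normrM normrN (ger0_norm E0) addrC mulrDl lerD //.
    rewrite mulrC ler_wpM2l // -[leRHS]mulr1 ler_pM //.
  rewrite -mulrA ler_wpM2l // -[leRHS]mulr1 ler_pM //.
split.
- have H x : `|x| <= 1 -> `|- k * expR (- (b + x * k)) * cos (a + x * h) +
      expR (- (b + x * k)) * (- h * sin (a + x * h))| <= (`|h| + `|k|) * (expR (- b) * expR 1).
    move=> x1; have := bnd x (- sin (a + x * h)) (cos (a + x * h)) x1.
    rewrite normrN !(ler_norml _ 1) sin_geN1 sin_le1 cos_geN1 cos_le1 => /(_ isT isT) /(le_trans _).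
    by apply; rewrite le_eqVlt; apply/orP; left; apply/eqP; congr `|_|; ring.
  have := mvt_norm (fun x => is_derive_mul (dE x) (dC x)) H n0 n1.
  by rewrite !mul1r !mul0r !addr0 subr0 normr1 mulr1.
- have H x : `|x| <= 1 -> `|- k * expR (- (b + x * k)) * sin (a + x * h) +
      expR (- (b + x * k)) * (h * cos (a + x * h))| <= (`|h| + `|k|) * (expR (- b) * expR 1).
    move=> x1; have := bnd x (cos (a + x * h)) (sin (a + x * h)) x1.
    rewrite !(ler_norml _ 1) sin_geN1 sin_le1 cos_geN1 cos_le1 => /(_ isT isT) /(le_trans _).
    by apply; rewrite le_eqVlt; apply/orP; left; apply/eqP; congr `|_|; ring.
  have := mvt_norm (fun x => is_derive_mul (dE x) (dS x)) H n0 n1.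
  by rewrite !mul1r !mul0r !addr0 subr0 normr1 mulr1.
Qed.

(** This makes exp(i beta) meaningful on classes. For small eps the imaginary parts of the two nets
    differ by at most 1 on a ball, so the moduli are comparable, and the difference of the
    exponentials is at most a moderate factor times that of the exponents. *)
Lemma cexpi_perturb beta beta' : cregular modB beta -> cregular modB beta' ->
  (forall r, exists2 L, exp_bounds modB L & forall e p, `|p| <= r -> `|im_net beta e p| <= L e) ->
  negligible0 (beta' - beta) ->
  moderate (cexpi beta') /\ negligible0 (cexpi beta' - cexpi beta).
Proof.
move=> rb rb' Hb /rapid_negligible0; rewrite re_netB im_netB => -[nr ni].
have small r : exists eta, 0 < eta /\ forall e, sval e < eta -> forall p, `|p| <= r ->
    `|im_net beta' e p - im_net beta e p| <= 1.
  have [c [eta [eta0 H]]] := ni r 1%N.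
  exists (Num.min eta (`|c| + 1)^-1); split; first by rewrite lt_min eta0 invr_gt0 ltr_wpDl.
  move=> e; rewrite lt_min => /andP[e1 e2] p pr; rewrite (le_trans (H e e1 p pr)) // expr1.
  have e0 := eps_gt0 e.
  rewrite (@le_trans _ _ ((`|c| + 1) * sval e)) //.
    by rewrite ler_wpM2r ?(ltW e0) // (le_trans (ler_norm _)) // lerDl.
  by rewrite -ler_pdivlMl ?ltr_wpDl // mulr1 ltW.
have bnd r : exists C eta, [/\ modB C, 0 < eta & forall e, sval e < eta ->
    forall p, `|p| <= r -> expR (- im_net beta e p) * expR 1 <= C e /\
      `|im_net beta' e p - im_net beta e p| <= 1].
  have [L eL HL] := Hb r; have [eta [eta0 H]] := small r.
  exists (fun e => expR (1 * L e) * expR 1), eta; split=> //.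
    by apply: boundsM; [exact: eL.2|apply: bounds_cst; exact: expR_ge0].
  move=> e ee p pr; split; last exact: H.
  rewrite ler_wpM2r ?expR_ge0 // ler_expR mul1r (le_trans (ler_norm _)) // normrN.
  exact: HL.
have sub (x y : R) : x = y + (x - y) by rewrite addrC subrK.
split.
  apply/moderate_cregular; apply: cexpi_regular => //.
  have db := cregular_diff rb'.
  have dc e x : cdifferentiable (cexpi beta' e) x by have [] := cexpi_derive 0 (db e x).
  have E e p : sval e = sval e -> expR (- im_net beta' e p) =
      expR (- im_net beta e p) * expR (- (im_net beta' e p - im_net beta e p)).
    by move=> _; rewrite -expRD -opprD addrC subrK.
  have le1 e p : `|im_net beta' e p - im_net beta e p| <= 1 ->
      expR (- im_net beta' e p) <= expR (- im_net beta e p) * expR 1.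
    by move=> H; rewrite E // ler_wpM2l ?expR_ge0 // ler_expR (le_trans (ler_norm _)) // normrN.
  split; apply: eventually_bigO1 => [e x|r]; try by apply: differentiable_continuous; have [] := dc e x.
    have [C [eta [BC eta0 H]]] := bnd r; exists C, eta; split=> // e ee p pr.
    have [H1 H2] := H e ee p pr; apply: le_trans H1.
    rewrite re_cexpi normrM (ger0_norm (expR_ge0 _)) -[leRHS]mulr1 ler_pM ?expR_ge0 ?le1 //.
    by rewrite ler_norml cos_geN1 cos_le1.
  have [C [eta [BC eta0 H]]] := bnd r; exists C, eta; split=> // e ee p pr.
  have [H1 H2] := H e ee p pr; apply: le_trans H1.
  rewrite im_cexpi normrM (ger0_norm (expR_ge0 _)) -[leRHS]mulr1 ler_pM ?expR_ge0 ?le1 //.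
  by rewrite ler_norml sin_geN1 sin_le1.
apply/rapid_negligible0; rewrite re_netB im_netB; split.
- apply: rapid_le nr ni => r.
  have [C [eta [BC eta0 H]]] := bnd r; exists C, eta; split=> // e ee p pr.
  have [H1 H2] := H e ee p pr.
  have [H3 _] := exp_cos_sin_lipschitz (re_net beta e p) (im_net beta e p)
    (re_net beta' e p - re_net beta e p) H2.
  rewrite !re_cexpi; move: H3; rewrite -!sub => /le_trans; apply.
  by rewrite mulrC ler_wpM2r // addr_ge0.
- apply: rapid_le nr ni => r.
  have [C [eta [BC eta0 H]]] := bnd r; exists C, eta; split=> // e ee p pr.
  have [H1 H2] := H e ee p pr.
  have [_ H3] := exp_cos_sin_lipschitz (re_net beta e p) (im_net beta e p)
    (re_net beta' e p - re_net beta e p) H2.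
  rewrite !im_cexpi; move: H3; rewrite -!sub => /le_trans; apply.
  by rewrite mulrC ler_wpM2r // addr_ge0.
Qed.

End Exponential.

(** * Generalised functions off their support *)

Section Support.
Context {R : realType} {d : nat}.
Implicit Types (A : net R d) (a : colombeau R d).

Lemma O_on_sub (K K' : set 'rV[R]_d) A g : K `<=` K' -> O_on K' A g -> O_on K A g.
Proof.
move=> KK' [C [eta [C0 eta0 H]]]; exists C, eta; split=> // e ee x Kx.
by apply: H => //; exact: KK'.
Qed.

Lemma O_onU (K K' : set 'rV[R]_d) A g : (forall e, 0 <= g e) ->
  O_on K A g -> O_on K' A g -> O_on (K `|` K') A g.
Proof.
move=> g0 [C [eta [C0 eta0 H]]] [C' [eta' [C'0 eta'0 H']]].
exists (C + C'), (Num.min eta eta'); split; [exact: addr_gt0|by rewrite lt_min eta0|].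
move=> e; rewrite lt_min => /andP[e1 e2] x [Kx|Kx].
  by rewrite (le_trans (H e e1 x Kx)) // ler_wpM2r // lerDl ltW.
by rewrite (le_trans (H' e e2 x Kx)) // ler_wpM2r // lerDr ltW.
Qed.

Lemma O_on_bigcup (s : seq 'rV[R]_d) (F : 'rV[R]_d -> set 'rV[R]_d) A g : (forall e, 0 <= g e) ->
  (forall p, p \in s -> O_on (F p) A g) ->
  O_on [set x | exists2 p, p \in s & F p x] A g.
Proof.
move=> g0; elim: s => [|p s IH] H.
  by exists 1, 1; split=> // e _ x [].
apply: (@O_on_sub _ (F p `|` [set x | exists2 p, p \in s & F p x])).
  move=> x [q]; rewrite inE => /orP[/eqP -> Fx|qs Fx]; [by left|by right; exists q].
apply: O_onU => //; first by apply: H; rewrite mem_head.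
by apply: IH => q qs; apply: H; rewrite inE qs orbT.
Qed.

(** A point off the support lies in an open set on which some representative is negligible, and [A]
    differs from that representative by a negligible net. The representative varies with the point;
    compactness reduces to finitely many balls. *)
Lemma vanishing_off_support A a (K : set 'rV[R]_d) (q : nat) : represents A a -> compact K ->
  K `&` Defs.support a = set0 -> O_on K A (fun e => sval e ^+ q).
Proof.
move=> Aa cK Ks.
have g0 (e : eps_index R) : 0 <= sval e ^+ q by rewrite exprn_ge0 // ltW // eps_gt0.
(* The balls are closed so that their intersections with [K] are compact sets inside [W], as
   [vanishes_on] demands. *)
have loc p : exists r : R, 0 < r /\
    (K p -> O_on (K `&` closed_ball p r) A (fun e => sval e ^+ q)).
  have [Kp|nKp] := pselect (K p); last by exists 1; split.
  have : ~ Defs.support a p.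
    by move=> sp; have : (K `&` Defs.support a) p by []; rewrite Ks.
  rewrite /Defs.support => /contrapT [W [oW [u ua HW]] Wp].
  have /nbhs_closedballP [r0 Hr] : nbhs p W by exact: open_nbhs_nbhs.
  have [r rpos Hr'] : exists2 r : R, 0 < r & closed_ball p r `<=` W by exists r0%:num.
  exists r; split=> // _.
  have cKr : compact (K `&` closed_ball p r).
    by apply: compact_closedI => //; exact: closed_ball_closed.
  have KW : K `&` closed_ball p r `<=` W by move=> x [_]; exact: Hr'.
  have H1 := HW _ [::] q cKr KW.
  have H2 := represents_sub_negligible Aa ua [::] q cKr.
  have -> : A = (A - u) + u by rewrite subrK.
  exact: O_onD H2 H1.
have [r Hr] := choice loc.
have := cK; rewrite compact_cover => /(_ _ K (fun p => ball p (r p))) [].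
- by move=> p _; exact: ball_open.
- by move=> p Kp; exists p => //; exact: ballxx (Hr p).1.
- move=> D DK Kcov.
  apply: (@O_on_sub _ [set x | exists2 p, p \in finmap.enum_fset D & (K `&` closed_ball p (r p)) x]).
    move=> x Kx; have [p /= pD px] := Kcov x Kx; exists p => //; split=> //.
    exact: subset_closed_ball px.
  apply: O_on_bigcup => // p pD; apply: (Hr p).2.
  by have := DK p pD; rewrite inE.
Qed.

End Support.

(** * The flow of the principal part *)

Section Curves.
Context {R : realType} {d : nat}.

Lemma derive_curve (f : 'rV[R]_d -> R) (Z : R -> 'rV[R]_d) (Z' : 'I_d -> R) (s : R) :
  differentiable f (Z s) -> (forall c, is_derive s 1 (fun r => Z r 0 c) (Z' c)) ->
  is_derive s 1 (fun r => f (Z r)) (\sum_c Z' c * 'D_(delta_mx 0 c) f (Z s)).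
Proof.
move=> df dZ.
have derZ : derivable Z s 1 by apply/derivable_mxP => i c; rewrite ord1; exact: ex_derive.
have dfZ : differentiable Z s by apply/derivable1_diffP.
have dfZ' : differentiable (f \o Z) s by exact: differentiable_comp.
apply: DeriveDef; first by apply/derivable1_diffP.
have -> : (fun r => f (Z r)) = f \o Z by [].
rewrite deriveE // (diff_comp dfZ df) /= -(deriveE _ dfZ) -deriveE // derive_sum_delta //.
by rewrite derive_mx //; apply: eq_bigr => c _; rewrite mxE derive_val.
Qed.

Lemma continuous_row (Z : R -> 'rV[R]_d) : (forall c, continuous (fun s => Z s 0 c)) ->
  continuous Z.
Proof.
move=> cZ s; apply/cvgrPdist_le => /= r r0.
have H c : \forall t \near s, `|Z s 0 c - Z t 0 c| <= r.
  by have := cZ c s => /cvgrPdist_le /(_ r r0).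
near=> t; apply: row_norm_le => [|c]; first exact: ltW.
rewrite row_subE; move: c; near: t; exact: filter_forall.
Unshelve. all: by end_near. Qed.

(** Gronwall's inequality for the difference, with zero initial value and zero inhomogeneity; time
    is shifted because the curves are compared at [s0]. *)
Lemma curve_unique (F : 'I_d -> R -> 'rV[R]_d -> R) (y z : 'I_d -> R -> R) (s0 : R) :
  (forall T : R, exists2 L, 0 <= L & forall s x x' j, `|s| <= T ->
    `|F j s x' - F j s x| <= L * \sum_k `|x' 0 k - x 0 k|) ->
  (forall j (s : R), is_derive s 1 (y j) (F j s (\row_k y k s))) ->
  (forall j (s : R), is_derive s 1 (z j) (F j s (\row_k z k s))) ->
  (forall j, y j s0 = z j s0) -> forall j s, y j s = z j s.
Proof.
move=> lipF dy dz yz j s.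
have [L L0 HL] := lipF (`|s0| + `|s - s0|).
have D1 i (r : R) : is_derive r 1 (fun r => y i (s0 + r) - z i (s0 + r))
    (F i (s0 + r) (\row_k y k (s0 + r)) - F i (s0 + r) (\row_k z k (s0 + r))).
  apply: is_derive_sub; first exact: (is_derive_shift_arg s0 (dy i)).
  exact: (is_derive_shift_arg s0 (dz i)).
have D2 i (r : R) : `|r| <= `|s - s0| ->
    `|F i (s0 + r) (\row_k y k (s0 + r)) - F i (s0 + r) (\row_k z k (s0 + r))| <=
    L * (\sum_k `|y k (s0 + r) - z k (s0 + r)|) + 0.
  move=> rs; rewrite addr0 (le_trans (HL _ _ _ _ _)) //.
    by rewrite (le_trans (ler_normD _ _)) // lerD2l.
  by rewrite ler_wpM2l // ler_sum // => k _; rewrite !mxE.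
have D3 i : `|y i (s0 + 0) - z i (s0 + 0)| <= 0 by rewrite addr0 yz subrr normr0.
have := gronwall L0 (lexx 0) (lexx 0) D1 D2 D3 j (lexx _).
by rewrite addr0 mulr0 mul0r normr_le0 subr_eq0 addrC subrK => /eqP.
Qed.

End Curves.

Section SpaceTime.
Context {R : realType} {n : nat}.
Implicit Types (t : R) (x : 'rV[R]_n) (p : 'rV[R]_(1 + n)).

Lemma tx_time t x : tx t x 0 time_idx = t.
Proof. by rewrite /tx /time_idx row_mxEl mxE. Qed.

Lemma tx_space t x j : tx t x 0 (space_idx j) = x 0 j.
Proof. by rewrite /tx /space_idx row_mxEr. Qed.

Lemma tx_split p : tx (p 0 time_idx) (rsubmx p) = p.
Proof.
rewrite -[RHS]hsubmxK /tx; congr row_mx.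
by apply/rowP => i; rewrite !mxE ord1.
Qed.

Lemma rsubmx_tx t x : rsubmx (tx t x) = x.
Proof. by rewrite /tx row_mxKr. Qed.

Lemma norm_tx t x : `|tx t x| <= Num.max `|t| `|x|.
Proof.
rewrite (le_trans (norm_row_mx _ _)) // ge_max !le_max lexx orbT andbT.
by apply/orP; left; apply: row_norm_le => // i; rewrite mxE.
Qed.

Lemma norm_tx_le t x r : `|t| <= r -> `|x| <= r -> `|tx t x| <= r.
Proof. by move=> tr xr; rewrite (le_trans (norm_tx t x)) // ge_max tr. Qed.

Lemma rsubmx_norm p : `|rsubmx p| <= `|p|.
Proof.
apply: row_norm_le => // j; rewrite mxE; exact: coord_le_norm.
Qed.

Lemma sum_space_time (f : 'I_(1 + n) -> R) :
  \sum_c f c = f time_idx + \sum_j f (space_idx j).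
Proof. by rewrite big_split_ord big_ord1. Qed.

Lemma space_time_case (P : 'I_(1 + n) -> Prop) : P time_idx ->
  (forall j, P (space_idx j)) -> forall c, P c.
Proof.
move=> Pt Ps c; rewrite -(splitK c); case: (fintype.split c) => a /=.
  by rewrite ord1.
exact: Ps.
Qed.

End SpaceTime.

Section ParameterIndependent.
Context {R : realType} (B : bound_class R).

Lemma regular_comp_param d N k (F : eps_index R -> 'rV[R]_N -> R) (phi : 'rV[R]_d -> 'rV[R]_N) :
  (forall c k, regular (@bddB R) k (fun _ p => phi p 0 c)) ->
  regular B k F -> regular B k (fun e p => F e (phi p)).
Proof.
move=> rphi rF.
have := @regular_comp R B d N k F (fun c _ p => phi p 0 c) (fun c => regular_O1 (rphi c 0%N)) rF
  (fun c => regular_sub (@bdd_sub R B) (rphi c k)).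
congr regular; apply/funext => e; apply/funext => p; congr (F e _).
by apply/rowP => c; rewrite mxE.
Qed.

(* Primitives in s are linear equations with zero matrix. *)
Lemma primitive_exists m (r : eps_index R -> 'rV[R]_(m + 1) -> R) : regularoo B r ->
  exists w : eps_index R -> 'rV[R]_m -> R -> R,
    [/\ forall e q, w e q 0 = 0,
        forall e q (s : R), is_derive s 1 (w e q) (r e (joint q s)) &
        regularoo B (uncurry_time w)].
Proof.
move=> rr; pose A (_ _ : 'I_1) : eps_index R -> 'rV[R]_(m + 1) -> R := fun _ _ => 0.
have rA i j k : regular B k (A i j) by exact: regular_cst.
have [w ww] : exists w, linear_ode A (fun=> r) (fun _ _ _ => 0) w.
  by apply: (@linear_ode_exists R B) => // _; exact: rr.
have logA (i j : 'I_1) : log_bounded B (A i j).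
  by move=> r'; exists (fun=> 0) => [|e p _]; [exact: exp_bounds_cst|rewrite normr0].
exists (w ord0); split; first by move=> e q; rewrite ww.1.
  move=> e q s; apply: is_derive_val (ww.2 ord0 e q s) _.
  by rewrite big_ord1 mul0r add0r.
move=> k; apply: (linear_ode_regular logA ww) => [i j|_|_]; first exact: rA.
  exact: rr.
exact: regular_cst.
Qed.

Lemma is_derive_eq_unique (f g df : R -> R) (s0 : R) :
  (forall s : R, is_derive s 1 f (df s)) -> (forall s : R, is_derive s 1 g (df s)) ->
  f s0 = g s0 -> forall s, f s = g s.
Proof.
move=> Df Dg fg s; apply/eqP; rewrite -subr_eq0; apply/eqP.
have D (r : R) : is_derive r 1 (fun r => f r - g r) 0.
  by apply: is_derive_val (is_derive_sub (Df r) (Dg r)) _; rewrite subrr.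
by rewrite (derive0_cst D s s0) fg subrr.
Qed.

End ParameterIndependent.

Section Flow.
Context {R : realType} {n : nat} (B : bound_class R).
Local Notation rnet d := (eps_index R -> 'rV[R]_d -> R).

(** The Lipschitz bound is uniform over all x and logarithmic relative to [B], whereas the size of
    the field is only bounded within [B]. Confinement of the curves therefore rests on the vanishing
    beyond [rho]. *)
Definition transport_field (rho : R) (A : 'I_n -> rnet (1 + n)) :=
  [/\ 0 <= rho, forall j, regularoo B (A j),
      forall j e p, rho <= `|rsubmx p| -> A j e p = 0 &
      forall T, exists2 L, exp_bounds B L & forall e t x x' j, `|t| <= T ->
        `|A j e (tx t x') - A j e (tx t x)| <= L e * \sum_k `|x' 0 k - x 0 k|].

Definition flow_point (Y : 'I_n -> eps_index R -> 'rV[R]_(1 + n) -> R -> R) e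
    (q : 'rV[R]_(1 + n)) (s : R) : 'rV[R]_(1 + n) := tx (q 0 time_idx + s) (\row_k Y k e q s).

(* Y is the flow of minus A in the space variables, along which time increases
   with unit speed. *)
Definition is_flow (A : 'I_n -> rnet (1 + n)) (Y : 'I_n -> eps_index R -> 'rV[R]_(1 + n) -> R -> R) :=
  forall j e (q : 'rV[R]_(1 + n)), Y j e q 0 = q 0 (space_idx j) /\
  forall s : R, is_derive s 1 (Y j e q) (- A j e (flow_point Y e q s)).

Variables (rho : R) (A : 'I_n -> rnet (1 + n)).
Hypothesis HA : transport_field rho A.

Lemma field_lipschitz e t0 (T : R) : exists2 L, 0 <= L & forall s x x' j, `|s| <= T ->
  `|- A j e (tx (t0 + s) x') - - A j e (tx (t0 + s) x)| <= L * \sum_k `|x' 0 k - x 0 k|.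
Proof.
have [_ _ _ /(_ (`|t0| + T)) [L [L0 _] HL]] := HA; exists (L e) => // s x x' j sT.
rewrite -opprD normrN HL // (le_trans (ler_normD _ _)) // lerD2l //.
Qed.

Lemma flow_exists : exists Y, is_flow A Y.
Proof.
have [_ rA _ _] := HA.
pose F e (t s : R) (x : 'rV[R]_n) : 'rV[R]_n := \row_j - A j e (tx (t + s) x).
have H (eq : eps_index R * 'rV[R]_(1 + n)) : exists y : R -> 'rV[R]_n,
    y 0 = rsubmx eq.2 /\
    forall j (s : R), is_derive s 1 (fun s => y s 0 j) (F eq.1 (eq.2 0 time_idx) s (y s) 0 j).
  case: eq => e q /=; apply: picard => [y cy j|T].
    have cZ : continuous (fun s => tx (q 0 time_idx + s) (y s)).
      apply: continuous_row; elim/(@space_time_case n) => [|k].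
        under eq_fun do rewrite tx_time.
        by move=> s; apply: continuousD; [exact: cst_continuous|exact: cvg_id].
      by under eq_fun do rewrite tx_space; exact: cy.
    under eq_fun do rewrite mxE.
    move=> s; apply: continuousN; apply: continuous_comp; first exact: cZ.
    have [_ _ [g _ Hg]] := rA j 1%N.
    by apply: differentiable_continuous; have [] := locD1_derive Hg e (tx (q 0 time_idx + s) (y s)).
  have [L L0 HL] := field_lipschitz e (q 0 time_idx) T.
  exists (L * n%:R) => s y y' sT; apply: row_norm_le => [|j].
    by rewrite mulr_ge0 // mulr_ge0.
  rewrite row_subE !mxE (le_trans (HL _ _ _ _ sT)) // -mulrA ler_wpM2l //.
  rewrite mulr_natl -[X in _ *+ X]card_ord -sumr_const ler_sum // => k _.
  by rewrite -row_subE coord_le_norm.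
have [y Hy] := choice H.
exists (fun j e q s => y (e, q) s 0 j) => j e q; have [y0 dy] := Hy (e, q); split.
  by rewrite y0 mxE.
move=> s; apply: is_derive_val (dy j s) _; rewrite mxE /flow_point /=.
by congr (- A j e (tx _ _)); apply/rowP => k; rewrite mxE.
Qed.

Variable Y : 'I_n -> eps_index R -> 'rV[R]_(1 + n) -> R -> R.
Hypothesis HY : is_flow A Y.

Lemma flow_time e q s : flow_point Y e q s 0 time_idx = q 0 time_idx + s.
Proof. by rewrite tx_time. Qed.

Lemma flow_space e q s j : flow_point Y e q s 0 (space_idx j) = Y j e q s.
Proof. by rewrite tx_space mxE. Qed.

Lemma flow_point0 e q : flow_point Y e q 0 = q.
Proof.
apply/rowP; elim/(@space_time_case n) => [|j]; first by rewrite flow_time addr0.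
by rewrite flow_space (HY j e q).1.
Qed.

(* Beyond the radius rho the field vanishes, so that curves are constant there. *)
Lemma flow_bounded e q s : `|\row_k Y k e q s| <= Num.max rho `|q|.
Proof.
rewrite le_max; have [//|far] := leP `|\row_k Y k e q s| rho.
have [_ _ A0 _] := HA.
(* If the curve is beyond [rho] at time [s], the constant curve through that point solves the same
   equation; by uniqueness the curve is constant and stays at its starting point. *)
have E : forall j r, Y j e q r = (\row_k Y k e q s) 0 j.
  apply: (@curve_unique R n (fun j r x => - A j e (tx (q 0 time_idx + r) x))
    (fun j r => Y j e q r) (fun j _ => (\row_k Y k e q s) 0 j) s).
  - by move=> T; exact: field_lipschitz.
  - by move=> j r; exact: (HY j e q).2.
  - move=> j r; apply: is_derive_val (is_derive_const _ _) _.
    rewrite A0 ?oppr0 // rsubmx_tx (le_trans (ltW far)) // le_eqVlt; apply/orP; left.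
    by apply/eqP; congr `|_|; apply/rowP => k; rewrite !mxE.
  - by move=> j; rewrite mxE.
apply/orP; right; apply: (le_trans _ (rsubmx_norm q)).
rewrite le_eqVlt; apply/orP; left; apply/eqP; congr `|_|; apply/rowP => j.
by rewrite -(E j 0) (HY j e q).1 mxE.
Qed.

Lemma flow_bounded_net j : bounded_net (uncurry_time (Y j)).
Proof.
have [rho0 _ _ _] := HA.
move=> r; exists (fun=> Num.max rho `|r|).
  by apply: bounds_cst; rewrite le_max rho0.
move=> e p pr; rewrite mulr1 /uncurry_time.
have -> : Y j e (space_part p) (time_part p) = (\row_k Y k e (space_part p) (time_part p)) 0 j.
  by rewrite mxE.
rewrite (le_trans (coord_le_norm _ _)) // (le_trans (flow_bounded _ _ _)) //.
rewrite ge_max !le_max lexx /=; apply/orP; right.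
by rewrite (le_trans (space_part_norm p)) // (le_trans pr) // ler_norm.
Qed.

Lemma flow_regular j : regularoo B (uncurry_time (Y j)).
Proof.
have [_ rA _ lA] := HA.
(* The field in the form required by [nonlinear_ode_regular]: starting time and elapsed time are
   added, and the starting position enters only as initial value. *)
pose arg (p : 'rV[R]_(1 + n + 1 + n)) : 'rV[R]_(1 + n) :=
  tx (p 0 (lshift n (lshift 1 time_idx)) + p 0 (lshift n (rshift (1 + n) ord0))) (rsubmx p).
have argE p v : arg (row_mx p v) = tx (p 0 (lshift 1 time_idx) + p 0 (rshift (1 + n) ord0)) v.
  by rewrite /arg !row_mxEl row_mxKr.
move=> k; apply: (@nonlinear_ode_regular R B (1 + n) n (fun j e p => - A j e (arg p))
  (fun j _ q => q 0 (space_idx j)) Y) => [l i|r|i e q|i e q s|i|l i].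
- apply: regularN; apply: regular_comp_param; last exact: rA.
  move=> c l'; elim/(@space_time_case n): c => [|c]; rewrite /arg.
    by under eq_fun do under eq_fun do rewrite tx_time; apply: regularD; exact: regular_coord.
  by under eq_fun do under eq_fun do rewrite tx_space mxE; exact: regular_coord.
- have [L BL HL] := lA (r + r); exists L => // e p v v' i pr.
  rewrite !argE -opprD normrN HL // (le_trans (ler_normD _ _)) // lerD //;
    exact: le_trans (coord_le_norm _ _) pr.
- by rewrite (HY i e q).1.
- apply: is_derive_val ((HY i e q).2 s) _; rewrite stateE argE; congr (- A i e (tx (_ + _) _)).
    by rewrite row_mxEl.
  by rewrite row_mxEr mxE.
- exact: flow_bounded_net.
- exact: regular_coord.
Qed.

(** Both sides solve the same equation in [s] and agree at 0. Carrying the time in the starting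
    point is what turns the non-autonomous flow into a group action. *)
Lemma flow_group e q r s j : Y j e (flow_point Y e q r) s = Y j e q (r + s).
Proof.
move: j s; apply: (@curve_unique R n (fun j s x => - A j e (tx (q 0 time_idx + r + s) x))
    (fun j s => Y j e (flow_point Y e q r) s) (fun j s => Y j e q (r + s)) 0).
- by move=> T; exact: field_lipschitz.
- move=> j s; apply: is_derive_val ((HY j e (flow_point Y e q r)).2 s) _.
  by rewrite {1}/flow_point flow_time.
- move=> j s; apply: is_derive_val (is_derive_shift_arg r (HY j e q).2 s) _.
  by rewrite /flow_point addrA.
- by move=> j; rewrite (HY j e _).1 flow_space addr0.
Qed.

Lemma flow_point_group e q r s :
  flow_point Y e (flow_point Y e q r) s = flow_point Y e q (r + s).
Proof.
apply/rowP; elim/(@space_time_case n) => [|j]; first by rewrite !flow_time addrA.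
by rewrite !flow_space flow_group.
Qed.

Lemma flow_point_norm e q s r : `|q| <= r -> `|s| <= r ->
  `|flow_point Y e q s| <= Num.max rho (r + r).
Proof.
move=> qr sr; have r0 : 0 <= r := le_trans (normr_ge0 _) qr.
apply: norm_tx_le; rewrite le_max; apply/orP.
  right; rewrite (le_trans (ler_normD _ _)) // lerD //; exact: le_trans (coord_le_norm _ _) qr.
have := flow_bounded e q s; rewrite le_max => /orP[->|H]; first by left.
by right; rewrite (le_trans H) // (le_trans qr) // lerDl.
Qed.

(** The reason for the sign of the field: along the flow of -A the operator d/dt - sum_j A_j d/dx_j
    becomes d/ds. *)
Lemma derive_along_flow e q s (f : 'rV[R]_(1 + n) -> R) :
  differentiable f (flow_point Y e q s) ->
  is_derive s 1 (fun r => f (flow_point Y e q r))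
    ('D_(delta_mx 0 time_idx) f (flow_point Y e q s) -
     \sum_j A j e (flow_point Y e q s) * 'D_(delta_mx 0 (space_idx j)) f (flow_point Y e q s)).
Proof.
move=> df.
pose Z' (c : 'I_(1 + n)) : R :=
  match fintype.split c with inl _ => 1 | inr j => - A j e (flow_point Y e q s) end.
have dZ c : is_derive s 1 (fun r => flow_point Y e q r 0 c) (Z' c).
  rewrite /Z'; elim/(@space_time_case n): c => [|j].
    under eq_fun do rewrite flow_time; rewrite /time_idx (unsplitK (inl _)).
    apply: is_derive_val (is_derive_add (is_derive_const s (q 0 time_idx)) (is_derive_id s 1)) _.
    by rewrite add0r.
  by under eq_fun do rewrite flow_space; rewrite /space_idx (unsplitK (inr _)); exact: (HY j e q).2.
apply: is_derive_val (derive_curve df dZ) _.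
rewrite sum_space_time /Z' /time_idx (unsplitK (inl _)) mul1r; congr (_ + _).
rewrite -sumrN; apply: eq_bigr => j _.
by rewrite /space_idx (unsplitK (inr _)) mulNr.
Qed.

Lemma flow_arg_regular (f : rnet (1 + n)) : regularoo B f ->
  regularoo B (fun e p => f e (flow_point Y e (space_part p) (time_part p))).
Proof.
move=> rf k.
pose u c : rnet (1 + n + 1) := fun e p => flow_point Y e (space_part p) (time_part p) 0 c.
have ru c : bounded_net (u c) /\ forall l, regular B l (u c).
  elim/(@space_time_case n): c => [|j]; rewrite /u.
    have rt (B' : bound_class R) l :
        regular B' l (fun e (p : 'rV[R]_(1 + n + 1)) =>
          flow_point Y e (space_part p) (time_part p) 0 time_idx).
      have := regularD (regular_coord B' l (lshift 1 time_idx))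
        (regular_coord B' l (rshift (1 + n) ord0)).
      by congr regular; apply/funext => e; apply/funext => p; rewrite flow_time mxE.
    by split; [exact: regular_O1 (rt _ 0%N)|exact: rt].
  have -> : (fun e (p : 'rV[R]_(1 + n + 1)) =>
      flow_point Y e (space_part p) (time_part p) 0 (space_idx j)) =
      uncurry_time (Y j) by apply/funext => e; apply/funext => p; rewrite flow_space.
  by split; [exact: flow_bounded_net|exact: flow_regular].
have := regular_comp (fun c => (ru c).1) (rf k) (fun c => (ru c).2 k).
congr regular; apply/funext => e; apply/funext => p; congr (f e _).
by apply/rowP => c; rewrite mxE.
Qed.

Definition flow_primitive (f : rnet (1 + n)) (w : eps_index R -> 'rV[R]_(1 + n) -> R -> R) :=
  forall e q, w e q 0 = 0 /\
    forall s : R, is_derive s 1 (w e q) (f e (flow_point Y e q s)).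

Lemma flow_primitive_exists f : regularoo B f -> exists2 w, flow_primitive f w &
  regularoo B (uncurry_time w).
Proof.
move=> /flow_arg_regular /primitive_exists [w [w0 dw rw]]; exists w => // e q.
split=> // s; apply: is_derive_val (dw e q s) _.
by rewrite space_joint time_joint.
Qed.

Lemma flow_primitive_group f w e q r s : flow_primitive f w ->
  w e (flow_point Y e q r) s = w e q (r + s) - w e q r.
Proof.
move=> fw; move: s; apply: (is_derive_eq_unique (s0 := 0)
  (df := fun s => f e (flow_point Y e q (r + s)))) => [s|s|].
- apply: is_derive_val ((fw e (flow_point Y e q r)).2 s) _.
  by rewrite flow_point_group.
- apply: is_derive_val (is_derive_sub (is_derive_shift_arg r (fw e q).2 s) (is_derive_const _ _)) _.
  by rewrite subr0.
- by rewrite (fw e _).1 addr0 subrr.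
Qed.

(* \int_0^t f ds along the curve through q = (t,x). *)
Definition phase (w : eps_index R -> 'rV[R]_(1 + n) -> R -> R) : rnet (1 + n) :=
  fun e q => - w e q (- q 0 time_idx).

Lemma phase_regular w : regularoo B (uncurry_time w) -> regularoo B (phase w).
Proof.
move=> rw k.
have := regularN (regular_comp_param
  (phi := fun q : 'rV[R]_(1 + n) => joint q (- q 0 time_idx)) _ (rw k)).
rewrite /phase => H.
have -> : (fun e q => - w e q (- q 0 time_idx)) =
  (fun e (q : 'rV[R]_(1 + n)) => - uncurry_time w e (joint q (- q 0 time_idx))).
  by apply/funext => e; apply/funext => q; rewrite uncurry_joint.
apply: H => c l; rewrite /joint -(splitK c); case: (fintype.split c) => a /=.
  by under eq_fun do under eq_fun do rewrite row_mxEl; exact: regular_coord.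
by under eq_fun do under eq_fun do rewrite row_mxEr mxE; apply: regularN; exact: regular_coord.
Qed.

Lemma phase_transport f w e q : flow_primitive f w -> (forall e x, differentiable (phase w e) x) ->
  'D_(delta_mx 0 time_idx) (phase w e) q =
  \sum_j A j e q * 'D_(delta_mx 0 (space_idx j)) (phase w e) q + f e q.
Proof.
move=> fw dphi; apply/eqP; rewrite addrC -subr_eq; apply/eqP.
have H := derive_along_flow (s := 0) (dphi e (flow_point Y e q 0)).
rewrite flow_point0 in H.
(* Moving the end point along the flow does not change the point reached at time 0, so by
   [flow_primitive_group] the phase changes only through the upper limit of the integral; its
   derivative at 0 is [f]. *)
have E : (fun r => phase w e (flow_point Y e q r)) =
    (fun r => w e q r - w e q (- q 0 time_idx)).
  apply/funext => r; rewrite /phase flow_time (flow_primitive_group _ _ _ _ fw) opprB.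
  by congr (_ - w e q _); rewrite opprD addrC subrK.
have H2 := is_derive_sub ((fw e q).2 0) (is_derive_const (0 : R) (w e q (- q 0 time_idx))).
rewrite -(@derive_val _ _ _ _ _ _ _ H) E (@derive_val _ _ _ _ _ _ _ H2) subr0.
by rewrite flow_point0.
Qed.

(** The phase is an integral over a time of length at most [|r|] along a curve confined to a fixed
    ball, hence at most [|r|] times a logarithmic bound; such bounds are stable under multiplication
    by constants. *)
Lemma phase_log_bounded f w : flow_primitive f w -> log_bounded B f -> log_bounded B (phase w).
Proof.
move=> fw logf r; have [L BL HL] := logf (Num.max rho (`|r| + `|r|)).
exists (fun e => `|r| * L e); first exact: exp_boundsZ.
move=> e q qr; rewrite /phase normrN.
have qr' : `|q| <= `|r| by rewrite (le_trans qr) ?ler_norm.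
have tr : `|- q 0 time_idx| <= `|r| by rewrite normrN (le_trans (coord_le_norm _ _)).
have L0 : 0 <= L e by case: BL.
have := @mvt_norm R (w e q) _ `|r| (L e) (fw e q).2 _ 0 (- q 0 time_idx).
rewrite (fw e q).1 !subr0 normr0 => /(_ _ (normr_ge0 _) tr) H.
rewrite (le_trans (H _)) //; last by rewrite mulrC ler_wpM2r.
by move=> s sr; apply: HL; exact: flow_point_norm.
Qed.

End Flow.

(** * Coefficients of logarithmic type *)

Section LogarithmicBounds.
Context {R : realType} {d : nat}.
Local Notation rnet := (eps_index R -> 'rV[R]_d -> R).

Lemma log_bounded_eventually (B : bound_class R) (f : rnet) : (forall e, continuous (f e)) ->
  (forall r, exists L eta, [/\ exp_bounds B L, 0 < eta & forall e, sval e < eta ->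
     forall p, `|p| <= r -> `|f e p| <= L e]) -> log_bounded B f.
Proof.
move=> cf H r; have [g [eta [Bg eta0 Hg]]] := H r.
have [C [C0 Cg HC]] := extend_bound cf Bg.1 Hg.
by exists C => //; exact: exp_bounds_le eta0 Bg C0 Cg.
Qed.

Lemma exp_bounds_slow_moderate (L : eps_index R -> R) : exp_bounds slowB L -> exp_bounds modB L.
Proof. by move=> [L0 HL]; split=> // T T0; apply: slow_moderate; exact: HL. Qed.

Lemma log_bounded_slow_moderate (f : rnet) : log_bounded slowB f -> log_bounded modB f.
Proof.
by move=> H r; have [L BL HL] := H r; exists L => //; exact: exp_bounds_slow_moderate.
Qed.

Definition log_class (B : bound_class R) (a : colombeau R d) := exists2 u, represents u a &
  forall r, exists2 L, exp_bounds B L & O_on [set p | `|p| <= r] u L.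

Lemma log_type_class (a : colombeau R d) : log_type a -> log_class modB a.
Proof.
move=> [u ua Hu]; exists u => // r; exists (fun e => ln (sval e)^-1).
  apply: (@log_exp_bounds _ _ 1 1) => // e => [|_]; last by rewrite mul1r.
  by rewrite ln_ge0 // invf_ge1 ?eps_gt0 // eps_le1.
exact: Hu (@compact_norm_ball R d r).
Qed.

Lemma slow_scale_log_type_class (a : colombeau R d) : slow_scale_log_type a -> log_class slowB a.
Proof.
move=> [u ua Hu]; exists u => // r.
have [r0|r0] := leP 0 r; last first.
  exists (fun=> 0); first exact: exp_bounds_cst.
  exists 1, 1; split=> // e _ p /= pr.
  by have := lt_le_trans r0 (normr_ge0 p); rewrite ltNge pr.
have [mu smu [C [eta [C0 eta0 H]]]] := Hu _ (@compact_norm_ball R d r).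
(* For small eps the logarithm is nonnegative, as a positive multiple of it dominates a modulus at
   the origin; the maximum only serves the other eps. *)
exists (fun e => Num.max 0 (ln (Normc.normc (mu e)))).
  apply: (@slow_log_exp_bounds _ _ 1 eta mu) => // e => [|ee]; first by rewrite le_max lexx.
  rewrite mul1r ge_max lexx andbT.
  have := H e ee 0; rewrite /= normr0 => /(_ r0) /(le_trans (normc_ge0 _)).
  by rewrite pmulr_rge0.
exists C, eta; split=> // e ee p pr; rewrite (le_trans (H e ee p pr)) //.
by rewrite ler_wpM2l ?(ltW C0) // le_max lexx orbT.
Qed.

(** Two representatives differ by O(1) on balls, and adding a constant preserves logarithmic bounds.
    This carries the hypothesis on one representative over to the truncated ones. *)
Lemma log_class_bounded (B : bound_class R) (a : colombeau R d) v : log_class B a ->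
  represents v a -> log_bounded B (re_net v) /\ log_bounded B (im_net v).
Proof.
move=> [u ua Hu] va.
have dv e x : cdifferentiable (v e) x by have [/(_ e [::] x)] := represents_moderate va.
have H r : exists L eta, [/\ exp_bounds B L, 0 < eta & forall e, sval e < eta ->
    forall p, `|p| <= r -> Normc.normc (v e p) <= L e].
  have [L BL [C [eta [C0 eta0 HC]]]] := Hu r.
  have [C' [eta' [C'0 eta'0 HC']]] :=
    represents_sub_negligible0 va ua (@compact_norm_ball R d r) 0%N.
  exists (fun e => C' * 1 + C * L e), (Num.min eta eta'); split.
  - apply: exp_boundsD; first by apply: exp_bounds_cst; rewrite mulr1 ltW.
    by apply: exp_boundsZ => //; exact: ltW.
  - by rewrite lt_min eta0.
  move=> e; rewrite lt_min => /andP[e1 e2] p pr.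
  have -> : v e p = (v - u) e p + u e p.
    by rewrite (_ : (v - u) e p = v e p - u e p) // subrK.
  by rewrite (le_trans (normcD _ _)) // lerD ?HC' ?HC.
split; apply: log_bounded_eventually => [e x|r].
- by apply: differentiable_continuous; have [] := dv e x.
- have [g [eta [Bg eta0 Hg]]] := H r; exists g, eta; split=> // e ee p pr.
  exact: le_trans (normc_Re_le _) (Hg e ee p pr).
- by apply: differentiable_continuous; have [] := dv e x.
- have [g [eta [Bg eta0 Hg]]] := H r; exists g, eta; split=> // e ee p pr.
  exact: le_trans (normc_Im_le _) (Hg e ee p pr).
Qed.

End LogarithmicBounds.

(** * Truncated representatives of the coefficients *)

Section TruncatedCoefficients.
Context {R : realType} {n : nat}.
Local Notation rnet := (eps_index R -> 'rV[R]_(1 + n) -> R).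
Implicit Types (a : colombeau R (1 + n)).

Lemma closed_far (rho : R) : closed [set p : 'rV[R]_(1 + n) | rho <= `|rsubmx p|].
Proof.
have -> : [set p : 'rV[R]_(1 + n) | rho <= `|rsubmx p|] =
    (fun p : 'rV[R]_(1 + n) => `|rsubmx p|) @^-1` [set x | rho <= x] by [].
apply: preimage_closed; last exact: closed_ge.
move=> p _; apply: continuous_comp; last exact: norm_continuous.
apply: differentiable_continuous; exact: differentiable_rsubmx.
Qed.

(** [u] is real but perhaps not regular, [v] is regular but perhaps not real; [A] is the cut-off of
    Re v. Since A - u = X (Re v - u) + (X - 1) u, it remains to see that u is negligible where X
    differs from 1, which is off the support. *)
Lemma truncated_representative (B : bound_class R) a v : (forall C, B C -> modB C) ->
  real_valued a -> compact_in_x a -> represents v a -> cregular B v ->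
  exists2 rho0, 0 <= rho0 & forall rho, rho0 <= rho -> exists A : rnet,
    [/\ regularoo B A, represents (real_embed A) a &
        forall e p, rho + 1 <= `|rsubmx p| -> A e p = 0].
Proof.
move=> BM [u ua ur] [K /compact_norm_bounded [r0 r00 Kr] sK] va rv.
exists (r0 + 1) => [|rho r0rho]; first exact: addr_ge0.
have rho0 : 0 <= rho by rewrite (le_trans _ r0rho) // addr_ge0.
have [X [rX X1 X0]] := @cutoff_exists R n rho rho0.
pose A : rnet := fun e p => X p * re_net v e p.
have rA : regularoo B A by move=> k; apply: regularM; [exact: rX|exact: rv.1].
exists A; split=> //; last by move=> e p pr; rewrite /A X0 // mul0r.
apply: (represents_negligible0 ua).
  by apply/moderate_cregular/cregular_real => k; exact: regular_sub BM (rA k).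
have /rapid_negligible0 [nr _] := represents_sub_negligible0 va ua.
rewrite re_netB in nr.
apply/rapid_negligible0; rewrite re_netB im_netB; split; last first.
  by apply: rapid_eq (@rapid0 R (1 + n)) => e p; rewrite /im_net ur subr0.
(* (X - 1) u only sees [u] on the closed set |x| >= rho, which is disjoint from the support because
   [rho] exceeds [r0] by at least 1. *)
pose g : rnet := fun e p => if rho <= `|rsubmx p| then re_net u e p else 0.
have rg : rapid g.
  move=> r q.
  have cK : compact ([set p : 'rV[R]_(1 + n) | `|p| <= r] `&` [set p | rho <= `|rsubmx p|]).
    by apply: compact_closedI; [exact: compact_norm_ball|exact: closed_far].
  have [|C [eta [C0 eta0 H]]] := vanishing_off_support q ua cK.
    apply/seteqP; split=> // p [[_ /= far] /sK /= /Kr near].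
    by have := le_trans r0rho (le_trans far near); rewrite gerDl ler10.
  exists C, eta; split=> // e ee p pr; rewrite /g; case: ifP => far; last first.
    by rewrite normr0 mulr_ge0 ?exprn_ge0 ?(ltW C0) // ltW // eps_gt0.
  by rewrite (le_trans (normc_Re_le _)) // H.
have bX := regular_O1 (rX (@modB R) 0%N).
have bX1 := regular_O1 (regularB (rX (@modB R) 0%N) (regular_cst _ 0%N 1)).
apply: rapid_eq (rapidD (rapid_mul bX nr) (rapid_mul bX1 rg)) => e p.
have -> : re_net (real_embed A) e p = X p * re_net v e p by [].
rewrite /g; case: ifP => far; first by ring.
by rewrite X1 ?(ltW _) ?mulr0 ?addr0 ?mul1r // ltNge far.
Qed.

(** Mean value theorem in x at fixed time. The gradient in x is logarithmic on the ball containing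
    all points with |t| <= T and |x| <= rho, and it vanishes for |x| > rho; so the constant does not
    depend on the size of x. *)
Lemma truncated_lipschitz (B : bound_class R) (A : 'I_n -> rnet) rho T : 0 <= rho ->
  (forall j e x, differentiable (A j e) x) ->
  (forall j e p, rho <= `|rsubmx p| -> A j e p = 0) ->
  (forall j k, log_bounded B (fun e p => 'D_(delta_mx 0 (space_idx k)) (A j e) p)) ->
  exists2 L, exp_bounds B L & forall e t x x' j, `|t| <= T ->
    `|A j e (tx t x') - A j e (tx t x)| <= L e * \sum_k `|x' 0 k - x 0 k|.
Proof.
move=> rho0 dA A0 logA.
have [L BL HL] := @log_bounded_uniform R B (1 + n) ('I_n * 'I_n)%type
  (fun jk e p => 'D_(delta_mx 0 (space_idx jk.2)) (A jk.1 e) p) (Num.max T rho)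
  (fun jk => logA jk.1 jk.2).
exists L => // e t x x' j tT.
have [c c01 ->] := mvt_segment (tx t x) (tx t x') (dA j e).
set p := _ + tx t x.
have pt : p 0 time_idx = t by rewrite /p mxE [X in X + _]mxE row_subE !tx_time subrr mulr0 add0r.
rewrite sum_space_time row_subE !tx_time subrr mul0r add0r mulr_sumr.
rewrite (le_trans (ler_norm_sum _ _ _)) // ler_sum // => k _.
rewrite row_subE !tx_space normrM mulrC ler_wpM2r //.
have [near|far] := leP `|rsubmx p| rho.
  apply: (HL (j, k)); rewrite -(tx_split p) pt norm_tx_le // le_max ?tT // near ?orbT //.
rewrite (@near_eq_derive _ _ _ (A j e) (fun=> 0)) ?derive_cst ?normr0; first exact: BL.1.
have crs : {for p, continuous (fun p : 'rV[R]_(1 + n) => `|rsubmx p|)}.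
  apply: continuous_comp; last exact: norm_continuous.
  apply: differentiable_continuous; exact: differentiable_rsubmx.
have : \forall y \near p, rho < `|rsubmx y|.
  by move: crs => /cvgr_gt; apply.
by apply: filterS => y yr; exact/A0/ltW.
Qed.

(** The form in which existence and uniqueness use the coefficients; it is provided both with
    moderate and with slow scale constants. *)
Definition transport_data (B : bound_class R) (a1 : 'I_n -> colombeau R (1 + n)) a0 rho A v :=
  [/\ transport_field B rho A, forall j, represents (real_embed (A j)) (a1 j),
      represents v a0, cregular B v & log_bounded B (re_net v) /\ log_bounded B (im_net v)].

Lemma transport_data_exists (B : bound_class R) (a1 : 'I_n -> colombeau R (1 + n)) a0 :
  (forall C, B C -> modB C) ->
  (forall j, [/\ real_valued (a1 j), compact_in_x (a1 j) &
     exists2 v, represents v (a1 j) & cregular B v]) ->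
  (forall j k, log_class B (gpartial (space_idx k) (a1 j))) ->
  log_class B a0 -> (exists2 v, represents v a0 & cregular B v) ->
  exists rho A v, transport_data B a1 a0 rho A v.
Proof.
move=> BM Ha1 Hd Ha0 [v va rv].
have [rho0 Hrho] : {rho0 : 'I_n -> R & forall j, 0 <= rho0 j /\
    forall rho, rho0 j <= rho -> exists A : rnet,
    [/\ regularoo B A, represents (real_embed A) (a1 j) &
        forall e p, rho + 1 <= `|rsubmx p| -> A e p = 0]}.
  apply: (choice (P := fun j rho0 => 0 <= rho0 /\
    forall rho, rho0 <= rho -> exists A : rnet,
    [/\ regularoo B A, represents (real_embed A) (a1 j) &
        forall e p, rho + 1 <= `|rsubmx p| -> A e p = 0])) => j.
  have [rva ca [w wa rw]] := Ha1 j.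
  by have [r r0 H] := truncated_representative BM rva ca wa rw; exists r.
(* A common radius for all j: the sum dominates each [rho0 j]. *)
pose rho := \sum_j rho0 j.
have rhoj j : rho0 j <= rho.
  by rewrite /rho (bigD1 j) //= lerDl sumr_ge0 // => i _; exact: (Hrho i).1.
have [A HA] := choice (fun j => (Hrho j).2 rho (rhoj j)).
have rho_ge0 : 0 <= rho by apply: sumr_ge0 => j _; exact: (Hrho j).1.
exists (rho + 1), A, v; split=> //.
- split=> [|j|j e p|T]; first exact: addr_ge0.
  + by have [] := HA j.
  + by have [_ _] := HA j; exact.
  apply: (@truncated_lipschitz _ _ (rho + 1)) => [|j e x|j e p|j k].
  + exact: addr_ge0.
  + have [rA _ _] := HA j; have [_ _ [g _ Hg]] := rA 1%N.
    by have [] := locD1_derive Hg e x.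
  + by have [_ _] := HA j; exact.
  + have [_ /(represents_partial (space_idx k)) HA2 _] := HA j.
    by have [] := log_class_bounded (Hd j k) HA2.
- by move=> j; have [] := HA j.
- exact: log_class_bounded Ha0 va.
Qed.

Lemma moderate_transport_data (a1 : 'I_n -> colombeau R (1 + n)) a0 :
  log_type_coefficients a1 a0 -> exists rho A v, transport_data modB a1 a0 rho A v.
Proof.
move=> [H1 [H2 [_ H3]]].
have rep a : exists2 v, represents v a & cregular modB v.
  have [v va] := represents_exists a; exists v => //.
  exact/moderate_cregular/(represents_moderate va).
apply: transport_data_exists => // [j|j k|].
- by have [] := H1 j; split.
- exact: log_type_class.
- exact: log_type_class.
Qed.

Lemma slow_transport_data (a1 : 'I_n -> colombeau R (1 + n)) a0 :
  slow_scale_coefficients a1 a0 -> exists rho A v, transport_data slowB a1 a0 rho A v.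
Proof.
move=> [H1 [H2 [H3 _ H4]]].
have rep a : slow_scale_regular a -> exists2 v, represents v a & cregular slowB v.
  move=> [v va Hv]; exists v => //; apply: cregular_slow => //.
  by have [] := represents_moderate va.
apply: transport_data_exists => [|j|j k||].
- exact: slow_moderate.
- by have [rv sv cv] := H1 j; split=> //; exact: rep.
- exact: slow_scale_log_type_class.
- exact: slow_scale_log_type_class.
- exact: rep.
Qed.

Lemma transport_data_slow_moderate (a1 : 'I_n -> colombeau R (1 + n)) a0 rho A v :
  transport_data slowB a1 a0 rho A v -> transport_data modB a1 a0 rho A v.
Proof.
move=> [[rho0 rA A0 lA] Aa va rv [l1 l2]].
split=> //; last by split; exact: log_bounded_slow_moderate.
  split=> // [j k|T]; first by apply: regular_sub (rA j k); exact: slow_moderate.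
  by have [L BL HL] := lA T; exists L => //; exact: exp_bounds_slow_moderate.
by split=> k; [apply: regular_sub (rv.1 k)|apply: regular_sub (rv.2 k)]; exact: slow_moderate.
Qed.

End TruncatedCoefficients.

(** * Existence and uniqueness *)

Section NetAlgebra.
Context {R : realType} {d : nat}.
Implicit Types (u v : net R d) (a b : colombeau R d).

Lemma net_eq u v : (forall e p, re_net u e p = re_net v e p) ->
  (forall e p, im_net u e p = im_net v e p) -> u = v.
Proof.
move=> H1 H2; apply/funext => e; apply/funext => p.
by apply/eqP; rewrite eq_complex; apply/andP; split; apply/eqP; [exact: H1|exact: H2].
Qed.

Lemma re_net_sum N (u : 'I_N -> net R d) e p :
  re_net (\sum_j u j) e p = \sum_j re_net (u j) e p.
Proof.
elim: (index_enum _) => [|j s IH]; first by rewrite !big_nil.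
by rewrite !big_cons re_netD IH.
Qed.

Lemma im_net_sum N (u : 'I_N -> net R d) e p :
  im_net (\sum_j u j) e p = \sum_j im_net (u j) e p.
Proof.
elim: (index_enum _) => [|j s IH]; first by rewrite !big_nil.
by rewrite !big_cons im_netD IH.
Qed.

Lemma re_real_embed f e p : re_net (@real_embed R d f) e p = f e p.
Proof. by []. Qed.

Lemma im_real_embed f e p : im_net (@real_embed R d f) e p = 0.
Proof. by []. Qed.

Lemma represents0 : represents (0 : net R d) (0 : colombeau R d).
Proof.
have [v va] := represents_exists (0 : colombeau R d).
have := representsD va (representsN va); by rewrite !subrr.
Qed.

Lemma representsB u v a b : represents u a -> represents v b -> represents (u - v) (a - b).
Proof. by move=> ua vb; apply: representsD => //; exact: representsN. Qed.

Lemma represents_diff u a : represents u a -> forall e x, cdifferentiable (u e) x.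
Proof. by move=> /represents_moderate [su _] e x; exact: (su e [::] x). Qed.

Lemma gDB j a b : gD j (a - b) = gD j a - gD j b.
Proof.
rewrite /gD -mulrBr; congr (_ * _).
have [u ua] := represents_exists a; have [v vb] := represents_exists b.
apply: (represents_inj (represents_partial j (representsB ua vb))).
have -> : npartial j (u - v) = npartial j u - npartial j v.
  by apply/funext => e; exact: (partialB j (represents_diff ua e) (represents_diff vb e)).
by apply: representsB; exact: represents_partial.
Qed.

Lemma rapid_uniform (I : finType) (f : I -> eps_index R -> 'rV[R]_d -> R) r (q : nat) :
  (forall i, rapid (f i)) -> exists c eta, [/\ 0 <= c, 0 < eta &
    forall i e, sval e < eta -> forall p, `|p| <= r -> `|f i e p| <= c * sval e ^+ q].
Proof.
move=> Hf; suff [c [eta [c0 eta0 H]]] : exists c eta, [/\ 0 <= c, 0 < eta &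
    forall i, i \in enum I -> forall e, sval e < eta -> forall p, `|p| <= r ->
      `|f i e p| <= c * sval e ^+ q].
  by exists c, eta; split=> // i; apply: H; rewrite mem_enum.
elim: (enum I) => [|i s [c [eta [c0 eta0 H]]]]; first by exists 0, 1; split.
have [c' [eta' [eta'0 H']]] := Hf i r q.
exists (c + `|c'|), (Num.min eta eta'); split; [exact: addr_ge0|by rewrite lt_min eta0|].
move=> k; rewrite inE => ks e; rewrite lt_min => /andP[e1 e2] p pr.
have eq0 : 0 <= sval e ^+ q by rewrite exprn_ge0 // ltW // eps_gt0.
move: ks => /orP[/eqP ->|ks].
  rewrite (le_trans (H' e e2 p pr)) // ler_wpM2r // (le_trans (ler_norm _)) //.
  by rewrite lerDr.
by rewrite (le_trans (H k ks e e1 p pr)) // ler_wpM2r // lerDl.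
Qed.

Lemma exp_bounds_gronwall (B : bound_class R) (L : eps_index R -> R) (N : nat) T :
  exp_bounds B L -> 0 <= T -> B (fun e => expR ((2 * N%:R * L e + 1) * T)).
Proof.
move=> [L0 HL] T0.
have := boundsM (HL (T * (2 * N%:R)) (mulr_ge0 T0 (mulr_ge0 (ler0n _ 2) (ler0n _ N))))
  (bounds_cst B (expR_ge0 T)).
congr (bounds _ _); apply/funext => e; rewrite -expRD; congr expR; ring.
Qed.

(** The factor [K] is moderate and chosen before [q], so it costs a fixed number of powers of eps,
    regained by enlarging [q]. *)
Lemma rapid_of_bound (f : eps_index R -> 'rV[R]_d -> R) :
  (forall r, exists2 K, modB K & forall q : nat, exists c eta,
    [/\ 0 <= c, 0 < eta & forall e, sval e < eta -> forall p, `|p| <= r ->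
      `|f e p| <= c * sval e ^+ q * K e]) -> rapid f.
Proof.
move=> H r q; have [K /modE[K0 [N [k [eta [k0 eta0 HK]]]]] HK'] := H r.
have [c [eta' [c0 eta'0 Hc]]] := HK' (q + N)%N.
exists (c * k), (Num.min eta eta'); split; first by rewrite lt_min eta0.
move=> e; rewrite lt_min => /andP[e1 e2] p pr.
have e0 := eps_gt0 e.
rewrite (le_trans (Hc e e2 p pr)) //.
rewrite (le_trans (ler_wpM2l _ (HK e e1))) //; first by rewrite mulr_ge0 // exprn_ge0 // ltW.
rewrite exprD mulrA [X in X <= _](_ : _ = c * k * sval e ^+ q) //.
by field; rewrite expf_neq0 // gt_eqF.
Qed.

End NetAlgebra.

Lemma gpullB {R : realType} {m d : nat} (L : {linear 'rV[R]_m -> 'rV[R]_d}) a b :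
  gpull L (a - b) = gpull L a - gpull L b.
Proof.
have [u ua] := represents_exists a; have [v vb] := represents_exists b.
apply: (represents_inj (represents_pull L (representsB ua vb))).
exact: (representsB (represents_pull L ua) (represents_pull L vb)).
Qed.

(** * The exponential of the phase solves the Cauchy problem *)

Section Solution.
Context {R : realType} {n : nat} (B : bound_class R).
Hypothesis B_moderate : forall C, B C -> modB C.
Variables (a1 : 'I_n -> colombeau R (1 + n)) (a0 : colombeau R (1 + n)).
Variables (rho : R) (A : 'I_n -> eps_index R -> 'rV[R]_(1 + n) -> R) (v : net R (1 + n)).
Hypothesis HD : transport_data B a1 a0 rho A v.
Variable Y : 'I_n -> eps_index R -> 'rV[R]_(1 + n) -> R -> R.
Hypothesis HY : is_flow A Y.
Variables wr wi : eps_index R -> 'rV[R]_(1 + n) -> R -> R.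
Hypotheses (Hwr : flow_primitive Y (re_net v) wr) (Hwi : flow_primitive Y (im_net v) wi).
Hypotheses (Rwr : regularoo B (uncurry_time wr)) (Rwi : regularoo B (uncurry_time wi)).

Definition phase_net : net R (1 + n) := fun e p => Complex (phase wr e p) (phase wi e p).

Lemma phase_net_regular : cregular B phase_net.
Proof. by split; apply: phase_regular. Qed.

Lemma phase_net_log : log_bounded B (im_net phase_net).
Proof. by have [T _ _ _ [_ l]] := HD; exact: (phase_log_bounded T HY Hwi l). Qed.

Lemma exp_phase_regular : cregular B (cexpi phase_net).
Proof.
apply: cexpi_regular; first exact: phase_net_regular.
exact: cexpi_bigO1 phase_net_log.
Qed.

Lemma phase_net_transport : npartial time_idx phase_net =
  \sum_j real_embed (A j) * npartial (space_idx j) phase_net + v.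
Proof.
have [T _ _ _ _] := HD.
have dr e x : differentiable (phase wr e) x by have [] := cregular_diff phase_net_regular e x.
have di e x : differentiable (phase wi e) x by have [] := cregular_diff phase_net_regular e x.
apply: net_eq => e p.
  rewrite re_netD re_net_sum [LHS](phase_transport T HY e p Hwr dr); congr (_ + _).
  by apply: eq_bigr => j _; rewrite re_netM im_real_embed mul0r subr0.
rewrite im_netD im_net_sum [LHS](phase_transport T HY e p Hwi di); congr (_ + _).
by apply: eq_bigr => j _; rewrite im_netM im_real_embed mul0r addr0.
Qed.

(** An exact identity between nets: as -i times i is 1, D_t and D_j of exp(i beta) are the
    derivatives of beta times exp(i beta), so the transport equation of the phase becomes that of
    the exponential, with no negligible error. *)
Lemma exp_phase_equation :
  (fun _ _ => Complex 0 (-1)) * npartial time_idx (cexpi phase_net) =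
  \sum_j real_embed (A j) *
    ((fun _ _ => Complex 0 (-1)) * npartial (space_idx j) (cexpi phase_net)) +
  v * cexpi phase_net.
Proof.
have db := cregular_diff phase_net_regular.
have E (u : net R (1 + n)) :
    (fun _ _ => Complex 0 (-1)) * ((fun _ _ => Complex 0 1) * u * cexpi phase_net) =
    u * cexpi phase_net.
  rewrite !mulrA [X in X * u](_ : _ = 1) ?mul1r //.
  by apply: net_eq => e p; rewrite ?re_netM ?im_netM /re_net /im_net /=; ring.
rewrite npartial_cexpi // E phase_net_transport mulrDl mulr_suml; congr (_ + _).
by apply: eq_bigr => j _; rewrite npartial_cexpi // E mulrA.
Qed.

Lemma exp_phase_solution : exists2 b, represents (cexpi phase_net) b & cauchy_solution a1 a0 b.
Proof.
have [_ Aa va _ _] := HD.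
have M : moderate (cexpi phase_net).
  apply/moderate_cregular; have [r1 r2] := exp_phase_regular.
  by split=> k; [exact: regular_sub (r1 k)|exact: regular_sub (r2 k)].
have rb := represents_gclass M; set b := gclass _ in rb.
exists b => //; split.
  apply: (represents_inj (represents_gD time_idx rb)); rewrite exp_phase_equation.
  apply: representsD; last exact: representsM.
  by apply: represents_sum => j; apply: representsM => //; exact: represents_gD.
apply: (represents_inj (represents_pull _ rb)).
have -> : npull initial_slice (cexpi phase_net) = fun _ _ => 1.
  apply: net_eq => e x; rewrite /npull.
    rewrite [LHS](re_cexpi phase_net e (initial_slice x)) /re_net /im_net /= /phase tx_time oppr0.
    by rewrite (Hwr e _).1 (Hwi e _).1 !oppr0 expR0 cos0 mulr1.
  rewrite [LHS](im_cexpi phase_net e (initial_slice x)) /re_net /im_net /= /phase tx_time oppr0.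
  by rewrite (Hwr e _).1 (Hwi e _).1 !oppr0 expR0 sin0 mulr0.
exact: represents1.
Qed.

End Solution.

(** * Uniqueness by Gronwall's inequality along the flow *)

Section Uniqueness.
Context {R : realType} {n : nat}.
Variables (a1 : 'I_n -> colombeau R (1 + n)) (a0 : colombeau R (1 + n)).
Variables (rho : R) (A : 'I_n -> eps_index R -> 'rV[R]_(1 + n) -> R) (v : net R (1 + n)).
Hypothesis HD : transport_data modB a1 a0 rho A v.

(** Along the flow, the real and imaginary parts of a representative solve a linear system with
    entries from [v] and negligible inhomogeneity, starting from negligible values at time 0.
    Gronwall's factor is moderate since [v] is logarithmic, so the values stay negligible. *)
Lemma homogeneous_solution_eq0 (c : colombeau R (1 + n)) :
  gD time_idx c = \sum_j a1 j * gD (space_idx j) c + a0 * c ->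
  gpull initial_slice c = 0 -> c = 0.
Proof.
move=> eqc c0; have [T Aa va _ [l1 l2]] := HD; have [u uc] := represents_exists c.
have [Y HY] := flow_exists T.
pose N := (fun _ _ => Complex 0 (-1)) * npartial time_idx u -
  (\sum_j real_embed (A j) * ((fun _ _ => Complex 0 (-1)) * npartial (space_idx j) u) + v * u).
have /rapid_negligible0 [Nr Ni] : negligible0 N.
  apply: (represents_sub_negligible0 (represents_gD time_idx uc)); rewrite eqc.
  apply: representsD; last exact: representsM.
  by apply: represents_sum => j; apply: representsM => //; exact: represents_gD.
have /rapid_negligible0 [Ir Ii] : negligible0 (npull initial_slice u - 0).
  apply: (represents_sub_negligible0 (represents_pull initial_slice uc)).
  by rewrite c0; exact: represents0.
have du := represents_diff uc.
pose field f e p := 'D_(delta_mx 0 time_idx) (f e) p -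
  \sum_j A j e p * 'D_(delta_mx 0 (space_idx j)) (f e) p.
(* The equation reads field u = i (N + v u); hence the real part is minus the imaginary part of N +
   v u, and the imaginary part is its real part. *)
have Fr e p : field (re_net u) e p = - im_net N e p - im_net (v * u) e p.
  rewrite /N im_netB im_netD im_net_sum im_netM.
  have -> : \sum_j im_net (real_embed (A j) *
      ((fun _ _ => Complex 0 (-1)) * npartial (space_idx j) u)) e p =
      - \sum_j A j e p * 'D_(delta_mx 0 (space_idx j)) (re_net u e) p.
    rewrite -sumrN; apply: eq_bigr => j _; rewrite im_netM.
    rewrite im_real_embed re_real_embed mul0r addr0.
    by rewrite im_netM /re_net /im_net /=; ring.
  by rewrite /field /re_net /im_net /=; ring.
have Fi e p : field (im_net u) e p = re_net N e p + re_net (v * u) e p.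
  rewrite /N re_netB re_netD re_net_sum re_netM.
  have -> : \sum_j re_net (real_embed (A j) *
      ((fun _ _ => Complex 0 (-1)) * npartial (space_idx j) u)) e p =
      \sum_j A j e p * 'D_(delta_mx 0 (space_idx j)) (im_net u e) p.
    apply: eq_bigr => j _; rewrite re_netM.
    rewrite im_real_embed re_real_embed mul0r subr0.
    by rewrite re_netM /re_net /im_net /=; ring.
  by rewrite /field /re_net /im_net /=; ring.
pose f (j : 'I_2) := if j == ord0 then re_net u else im_net u.
pose g (j : 'I_2) := if j == ord0 then im_net N else re_net N.
pose h (j : 'I_2) := if j == ord0 then re_net (npull initial_slice u - 0)
  else im_net (npull initial_slice u - 0).
have rg j : rapid (g j) by rewrite /g; case: ifP.
have rh j : rapid (h j) by rewrite /h; case: ifP.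
have df j e x : differentiable (f j e) x.
  by have [d1 d2] := du e x; rewrite /f; case: ifP.
suff Hf j : rapid (f j).
  apply: (represents_eq uc represents0); apply/rapid_negligible0.
  rewrite re_netB im_netB; split.
    by apply: rapid_eq (rapidN (Hf ord0)) => e p; rewrite sub0r.
  by apply: rapid_eq (rapidN (Hf ord_max)) => e p; rewrite sub0r.
apply: rapid_of_bound => r.
(* Curves start in the ball of radius |r| and run for a time at most 2|r|, whence the bound of
   [flow_point_norm] for the radius 2|r|. *)
pose P := Num.max rho ((`|r| + `|r|) + (`|r| + `|r|)).
have [L1 B1 H1] := l1 P; have [L2 B2 H2] := l2 P.
have BL := exp_boundsD B1 B2.
exists (fun e => expR ((2 * 2%:R * (L1 e + L2 e) + 1) * `|r|)); first exact: exp_bounds_gronwall.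
move=> q.
have [C [eta [C0 eta0 HC]]] := rapid_uniform P q rg.
have [C' [eta' [C'0 eta'0 HC']]] := rapid_uniform P q rh.
exists (2%:R * (C' + C)), (Num.min eta eta').
split; [by rewrite mulr_ge0 // addr_ge0|by rewrite lt_min eta0|].
move=> e; rewrite lt_min => /andP[e1 e2] p pr.
have pr' : `|p| <= `|r| by rewrite (le_trans pr) // ler_norm.
have tr : `|p 0 time_idx| <= `|r| by rewrite (le_trans (coord_le_norm _ _)).
have eq0 : 0 <= sval e ^+ q by rewrite exprn_ge0 // ltW // eps_gt0.
have zP s : `|s| <= `|r| -> `|flow_point Y e p (- p 0 time_idx + s)| <= P.
  move=> sr; apply: (flow_point_norm T HY).
    by rewrite (le_trans pr') // lerDl.
  by rewrite (le_trans (ler_normD _ _)) // normrN lerD.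
have fE k z : `|z| <= P -> `|field (f k) e z| <=
    (L1 e + L2 e) * (\sum_i `|f i e z|) + C * sval e ^+ q.
  move=> zP'.
  have b1 := H1 e z zP'; have b2 := H2 e z zP'.
  rewrite big_ord_recl big_ord1 [f ord0]/(re_net u) [f (lift _ _)]/(im_net u).
  have ab x y a b : `|x| <= L1 e -> `|y| <= L2 e ->
      `|x| * `|a| + `|y| * `|b| <= (L1 e + L2 e) * (`|a| + `|b|).
    move=> xL yL; have := ler_wpM2r (normr_ge0 a) xL; have := ler_wpM2r (normr_ge0 b) yL.
    have := mulr_ge0 (le_trans (normr_ge0 _) xL) (normr_ge0 b).
    have := mulr_ge0 (le_trans (normr_ge0 _) yL) (normr_ge0 a).
    by rewrite mulrDl !mulrDr; lra.
  have := HC k e e1 z zP'; rewrite /f /g; case: ifP => _ gN.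
    rewrite Fr im_netM (le_trans (ler_normB _ _)) // normrN addrC lerD //.
    rewrite (le_trans (ler_normD _ _)) // !normrM [X in _ <= _ * X]addrC.
    exact: ab.
  rewrite Fi re_netM (le_trans (ler_normD _ _)) // addrC lerD //.
  by rewrite (le_trans (ler_normB _ _)) // !normrM ab.
(* The curve through [p] is parametrised by absolute time: at s = 0 it meets the initial hyperplane,
   at s = t it reaches [p]. *)
have := @gronwall R 2 (fun k s => f k e (flow_point Y e p (- p 0 time_idx + s)))
  (fun k s => field (f k) e (flow_point Y e p (- p 0 time_idx + s)))
  (L1 e + L2 e) (C * sval e ^+ q) (C' * sval e ^+ q) `|r|
  (BL.1 e) (mulr_ge0 C0 eq0) (mulr_ge0 C'0 eq0).
have D1 k (s : R) : is_derive s 1 (fun s => f k e (flow_point Y e p (- p 0 time_idx + s)))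
    (field (f k) e (flow_point Y e p (- p 0 time_idx + s))).
  apply: (is_derive_shift_arg _ (f := fun r => f k e (flow_point Y e p r))
    (df := fun r => field (f k) e (flow_point Y e p r))) => x.
  exact: derive_along_flow.
have D2 k (s : R) : `|s| <= `|r| -> `|field (f k) e (flow_point Y e p (- p 0 time_idx + s))| <=
    (L1 e + L2 e) * (\sum_i `|f i e (flow_point Y e p (- p 0 time_idx + s))|) + C * sval e ^+ q.
  by move=> sr; apply: fE; exact: zP.
have D3 k : `|f k e (flow_point Y e p (- p 0 time_idx + 0))| <= C' * sval e ^+ q.
  rewrite addr0.
  have zE : flow_point Y e p (- p 0 time_idx) =
      initial_slice (rsubmx (flow_point Y e p (- p 0 time_idx))).
    by rewrite -[LHS]tx_split flow_time subrr.
  have -> : f k e (flow_point Y e p (- p 0 time_idx)) =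
      h k e (rsubmx (flow_point Y e p (- p 0 time_idx))).
    by rewrite {1}zE /f /h; case: ifP => _; rewrite ?re_netB ?im_netB subr0.
  apply: HC' => //; rewrite (le_trans (rsubmx_norm _)) //.
  by have := zP 0; rewrite normr0 addr0; apply.
move=> /(_ D1 D2 D3 j _ tr); rewrite addNr (flow_point0 HY) -mulrDl.
by rewrite [2%:R * (_ * _)]mulrA.
Qed.

Lemma cauchy_solution_unique (b b' : colombeau R (1 + n)) :
  cauchy_solution a1 a0 b -> cauchy_solution a1 a0 b' -> b = b'.
Proof.
move=> [e1 i1] [e2 i2]; apply/eqP; rewrite -subr_eq0; apply/eqP.
apply: homogeneous_solution_eq0; last by rewrite gpullB i1 i2 subrr.
rewrite gDB e1 e2 opprD addrACA -mulrBr -sumrB; congr (_ + _).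
by apply: eq_bigr => j _; rewrite gDB mulrBr.
Qed.

End Uniqueness.

(** * Characteristic curves and the integral formula *)

Section Composition.
Context {R : realType} {d N : nat}.
Local Notation rnet m := (eps_index R -> 'rV[R]_m -> R).

Lemma bounded_net_rapid (f g : rnet d) : bounded_net f -> (forall e, continuous (g e)) ->
  rapid (fun e p => g e p - f e p) -> bounded_net g.
Proof.
move=> bf cg fg; apply: eventually_bigO1 => // r.
have [C BC HC] := bf r; have [c [eta [eta0 Hc]]] := fg r 0%N.
exists (fun e => C e + `|c|), eta; split=> //.
  by apply: boundsD => //; exact: bounds_cst.
move=> e ee p pr; rewrite -(subrK (f e p) (g e p)) addrC.
rewrite (le_trans (ler_normD _ _)) // lerD //.
  by have := HC e p pr; rewrite mulr1.
by rewrite (le_trans (Hc e ee p pr)) // expr0 mulr1 ler_norm.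
Qed.

(** F'(u') - F(u) is split into (F' - F)(u'), negligible as u' stays in a fixed ball for small eps,
    and F(u') - F(u), where the Lipschitz constant of [F] on such a ball costs only a power of
    eps. *)
Lemma rapid_comp (F F' : rnet N) (u u' : 'I_N -> rnet d) : locLip modB F ->
  rapid (fun e p => F' e p - F e p) ->
  (forall c, bounded_net (u c)) -> (forall c, bounded_net (u' c)) ->
  (forall c, rapid (fun e p => u' c e p - u c e p)) ->
  rapid (fun e p => F' e (\row_c u' c e p) - F e (\row_c u c e p)).
Proof.
move=> lF FF bu bu' uu.
apply: (rapid_eq (f := fun e p => (F' e (\row_c u' c e p) - F e (\row_c u' c e p)) +
  (F e (\row_c u' c e p) - F e (\row_c u c e p)))) => [e p|]; first by rewrite addrA subrK.
apply: rapidD => r q.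
  have [C /bddE[_ [c [eta [eta0 Hc]]]] HC] := bounded_row r bu'.
  have [c' [eta' [eta'0 Hc']]] := FF c q.
  exists c', (Num.min eta eta'); split; first by rewrite lt_min eta0.
  move=> e; rewrite lt_min => /andP[e1 e2] p pr; apply: Hc' => //.
  exact: le_trans (HC e p pr) (Hc e e1).
have [C /bddE[_ [c [eta [eta0 Hc]]]] HC] := bounded_row r bu.
have [C' /bddE[_ [c' [eta' [eta'0 Hc']]]] HC'] := bounded_row r bu'.
have [K /modE[K0 [m [k [eta1 [k0 eta10 HK]]]]] HK'] := lF (Num.max c c').
have [b [eta2 [b0 eta20 Hb]]] := rapid_uniform r (q + m)%N uu.
exists (k * b), (Num.min (Num.min eta eta') (Num.min eta1 eta2)).
split; first by rewrite !lt_min eta0 eta'0 eta10.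
move=> e; rewrite !lt_min => /andP[/andP[e1 e2] /andP[e3 e4]] p pr.
have u1 : `|\row_c u c e p| <= Num.max c c'.
  by rewrite le_max (le_trans (HC e p pr) (Hc e e1)).
have u2 : `|\row_c u' c e p| <= Num.max c c'.
  by rewrite le_max (le_trans (HC' e p pr) (Hc' e e2)) orbT.
have := HK' e (\row_c u c e p, \row_c u' c e p).
rewrite prod_normE /= ge_max u1 u2 => /(_ isT) H.
rewrite (le_trans H) //.
have ege0 : 0 < sval e := eps_gt0 e.
have H2 : `|\row_c u' c e p - \row_c u c e p| <= b * sval e ^+ (q + m).
  apply: row_norm_le => [|c1]; first by rewrite mulr_ge0 // exprn_ge0 // ltW.
  by rewrite row_subE !mxE Hb.
rewrite (le_trans (ler_pM (K0 e) (normr_ge0 _) (HK e e3) H2)) //.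
rewrite exprD [X in X <= _](_ : _ = k * b * sval e ^+ q) //.
by field; rewrite expf_neq0 // gt_eqF.
Qed.

Lemma composition_represents (F F' : net R N) (u u' : 'I_N -> rnet d) a :
  represents F a -> represents F' a ->
  (forall c, bounded_net (u c)) -> (forall c, bounded_net (u' c)) ->
  (forall c, rapid (fun e p => u' c e p - u c e p)) ->
  (forall c, regularoo modB (u' c)) ->
  moderate (fun e p => F' e (\row_c u' c e p)) /\
  negligible0 ((fun e p => F' e (\row_c u' c e p)) - (fun e p => F e (\row_c u c e p))).
Proof.
move=> Fa F'a bu bu' uu ru'.
have [rr ri] := (moderate_cregular F).1 (represents_moderate Fa).
have [rr' ri'] := (moderate_cregular F').1 (represents_moderate F'a).
have /rapid_negligible0 [nr ni] := represents_sub_negligible0 F'a Fa.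
rewrite re_netB in nr; rewrite im_netB in ni.
split.
  by apply/moderate_cregular; split=> k; [exact: (regular_comp bu' (rr' k) (fun c => ru' c k))|
    exact: (regular_comp bu' (ri' k) (fun c => ru' c k))].
apply/rapid_negligible0; rewrite re_netB im_netB; split.
  by apply: (rapid_comp (regular_Lip (rr 0%N)) nr).
by apply: (rapid_comp (regular_Lip (ri 0%N)) ni).
Qed.

End Composition.

Section Characteristics.
Context {R : realType} {n : nat}.
Implicit Types (p : 'rV[R]_(n + 2)) (x : 'rV[R]_n).

Definition t_coord p : R := p 0 (rshift n ord0).
Definition s_coord p : R := p 0 (rshift n ord_max).
Definition base_point p : 'rV[R]_(1 + n) := tx (t_coord p) (lsubmx p).

Lemma xts_t x (t s : R) : t_coord (xts x t s) = t.
Proof. by rewrite /t_coord /xts row_mxEr mxE. Qed.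

Lemma xts_s x (t s : R) : s_coord (xts x t s) = s.
Proof. by rewrite /s_coord /xts row_mxEr mxE. Qed.

Lemma xts_base x (t s : R) : base_point (xts x t s) = tx t x.
Proof. by rewrite /base_point xts_t /xts row_mxKl. Qed.

Lemma xts_split p : xts (lsubmx p) (t_coord p) (s_coord p) = p.
Proof.
rewrite -[RHS]hsubmxK /xts; congr row_mx; apply/rowP => i; rewrite !mxE.
have [->|->] // : i = ord0 \/ i = ord_max.
by case: i => [[|[|]]] // H; [left|right]; apply: val_inj.
Qed.

Lemma norm_xts_le x (t s r : R) : `|x| <= r -> `|t| <= r -> `|s| <= r -> `|xts x t s| <= r.
Proof.
move=> xr tr sr; rewrite (le_trans (norm_row_mx _ _)) // ge_max xr /=.
apply: row_norm_le => [|i]; first exact: le_trans (normr_ge0 _) tr.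
by rewrite mxE; case: ifP.
Qed.

Lemma base_point_norm p : `|base_point p| <= `|p|.
Proof.
apply: norm_tx_le; first exact: coord_le_norm.
by apply: row_norm_le => // i; rewrite mxE coord_le_norm.
Qed.

Lemma derive_last (f : 'rV[R]_(n + 2) -> R) x (t s : R) : (forall p, differentiable f p) ->
  is_derive s 1 (fun r => f (xts x t r)) ('D_(delta_mx 0 (rshift n ord_max)) f (xts x t s)).
Proof.
move=> df.
have H := @derive_curve R (n + 2) f (fun r => xts x t r)
  (fun c => (delta_mx 0 (rshift n ord_max) : 'rV[R]_(n + 2)) 0 c) s (df _).
apply: is_derive_val (H _) _ => [c|].
  rewrite mxE /= /xts -(splitK c); case: (fintype.split c) => i /=.
    under eq_fun do rewrite row_mxEl.
    by apply: is_derive_val (is_derive_const _ _) _; rewrite eq_lrshift.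
  under eq_fun do rewrite row_mxEr mxE.
  rewrite eq_rshift; case: i => [[|[|]]] // i /=.
    by apply: is_derive_val (is_derive_const _ _) _.
  exact: is_derive_id.
by rewrite -derive_sum_delta.
Qed.

Variables (a1 : 'I_n -> colombeau R (1 + n)) (a0 : colombeau R (1 + n)).
Variables (rho : R) (A : 'I_n -> eps_index R -> 'rV[R]_(1 + n) -> R) (v : net R (1 + n)).
Hypothesis HD : transport_data modB a1 a0 rho A v.
Variable Y : 'I_n -> eps_index R -> 'rV[R]_(1 + n) -> R -> R.
Hypothesis HY : is_flow A Y.

Let HT : transport_field modB rho A.
Proof. by case: HD. Qed.

(** This is gamma(x,t,s): [Y] counts the time elapsed since t, gamma the absolute time s. *)
Definition curve h : eps_index R -> 'rV[R]_(n + 2) -> R :=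
  fun e p => Y h e (base_point p) (s_coord p - t_coord p).

Lemma curve_xts h e x (t s : R) : curve h e (xts x t s) = Y h e (tx t x) (s - t).
Proof. by rewrite /curve xts_base xts_t xts_s. Qed.

Lemma flow_point_curve e p : tx (s_coord p) (\row_h curve h e p) =
  flow_point Y e (base_point p) (s_coord p - t_coord p).
Proof. by rewrite /flow_point tx_time addrC subrK. Qed.

Lemma curve_arg_regular (B : bound_class R) k c :
  regular B k (fun _ p => joint (base_point p) (s_coord p - t_coord p) 0 c).
Proof.
rewrite /joint -(splitK c); case: (fintype.split c) => a /=.
  under eq_fun do under eq_fun do rewrite row_mxEl.
  elim/(@space_time_case n): a => [|j].
    by under eq_fun do under eq_fun do rewrite tx_time; exact: regular_coord.
  by under eq_fun do under eq_fun do rewrite tx_space mxE; exact: regular_coord.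
under eq_fun do under eq_fun do rewrite row_mxEr mxE.
by apply: regularB; exact: regular_coord.
Qed.

Lemma curveE h : curve h = fun e p =>
  uncurry_time (Y h) e (joint (base_point p) (s_coord p - t_coord p)).
Proof. by apply/funext => e; apply/funext => p; rewrite uncurry_joint. Qed.

Lemma curve_regular h : regularoo modB (curve h).
Proof.
move=> k; rewrite curveE.
apply: regular_comp_param (flow_regular HT HY h k) => c l; exact: curve_arg_regular.
Qed.

Lemma curve_bounded h : bounded_net (curve h).
Proof.
have := @locO_compO1 R (@bddB R) _ _ (uncurry_time (Y h))
  (fun c _ p => joint (base_point p) (s_coord p - t_coord p) 0 c)
  (fun c => regular_O1 (curve_arg_regular _ 0%N c)) (flow_bounded_net HT HY h).
rewrite curveE; congr bigO1; apply/funext => e; apply/funext => p; congr (uncurry_time _ e _).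
by apply/rowP => c; rewrite mxE.
Qed.

Lemma curve_moderate h : moderate (real_embed (curve h)).
Proof. exact/moderate_cregular/cregular_real/curve_regular. Qed.

Definition curve_class h : colombeau R (n + 2) :=
  gclass (ModerateNet (moderate_in (curve_moderate h))).

Lemma curve_class_represents h : represents (real_embed (curve h)) (curve_class h).
Proof. exact: represents_gclass. Qed.

Definition along_arg (g : 'I_n -> eps_index R -> 'rV[R]_(n + 2) -> R) (c : 'I_(1 + n)) :
    eps_index R -> 'rV[R]_(n + 2) -> R :=
  fun e p => tx (s_coord p) (\row_h g h e p) 0 c.

(** Any real representatives of the curves differ from [curve] by negligible nets, hence are bounded
    for small eps as well, and [composition_represents] applies to them. This gives the independence
    of representatives. *)
Lemma along_curve_exists (F : net R (1 + n)) a : represents F a -> exists2 c,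
  represents (fun e p => F e (tx (s_coord p) (\row_h curve h e p))) c &
  along_curve curve_class a c.
Proof.
move=> Fa.
have argE g e p : \row_c along_arg g c e p = tx (s_coord p) (\row_h g h e p).
  by apply/rowP => c; rewrite mxE.
have b0 (g : 'I_n -> eps_index R -> 'rV[R]_(n + 2) -> R) : (forall h, bounded_net (g h)) ->
    forall c, bounded_net (along_arg g c).
  move=> bg; elim/(@space_time_case n) => [|h]; rewrite /along_arg.
    by under eq_fun do under eq_fun do rewrite tx_time; apply: regular_O1 (regular_coord _ 0%N _).
  by under eq_fun do under eq_fun do rewrite tx_space mxE; exact: bg.
have r0 (g : 'I_n -> eps_index R -> 'rV[R]_(n + 2) -> R) : (forall h, regularoo modB (g h)) ->
    forall c, regularoo modB (along_arg g c).
  move=> bg; elim/(@space_time_case n) => [|h] k; rewrite /along_arg.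
    by under eq_fun do under eq_fun do rewrite tx_time; exact: regular_coord.
  by under eq_fun do under eq_fun do rewrite tx_space mxE; exact: bg.
have d0 (g g' : 'I_n -> eps_index R -> 'rV[R]_(n + 2) -> R) :
    (forall h, rapid (fun e p => g' h e p - g h e p)) ->
    forall c, rapid (fun e p => along_arg g' c e p - along_arg g c e p).
  move=> gg; elim/(@space_time_case n) => [|h]; rewrite /along_arg.
    by apply: (rapid_eq _ (@rapid0 R _)) => e p; rewrite !tx_time subrr.
  by apply: (rapid_eq _ (gg h)) => e p; rewrite !tx_space !mxE.
have netE g : (fun e p => F e (\row_c along_arg g c e p)) =
    fun e p => F e (tx (s_coord p) (\row_h g h e p)).
  by apply/funext => e; apply/funext => p; rewrite argE.
have rap0 h : rapid (fun e p => curve h e p - curve h e p).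
  by apply: (rapid_eq _ (@rapid0 R _)) => e p; rewrite subrr.
have [M _] := composition_represents Fa Fa (b0 _ curve_bounded) (b0 _ curve_bounded)
  (d0 _ _ rap0) (r0 _ curve_regular).
rewrite netE in M.
have rc := represents_gclass M; set c := gclass _ in rc.
exists c => //; split=> [h|F' g F'a Hg].
  by exists (real_embed (curve h)); first exact: curve_class_represents.
have gr h : regularoo modB (re_net (g h)).
  by have [] := (moderate_cregular _).1 (represents_moderate (Hg h).1).
have gd h : rapid (fun e p => re_net (g h) e p - curve h e p).
  have /rapid_negligible0 [+ _] :=
    represents_sub_negligible0 (Hg h).1 (curve_class_represents h).
  by rewrite re_netB.
have gb h : bounded_net (re_net (g h)).
  apply: bounded_net_rapid (curve_bounded h) _ (gd h) => e x.
  by apply: differentiable_continuous; have [] := represents_diff (Hg h).1 e x.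
have [M' N'] := composition_represents Fa F'a (b0 _ curve_bounded) (b0 _ gb)
  (d0 _ _ gd) (r0 _ gr).
have E' : (fun e p => F' e (\row_c along_arg (fun h => re_net (g h)) c e p)) =
    fun e p => F' e (tx (s_coord p) (\row_h complex.Re (g h e p))).
  by apply/funext => e; apply/funext => p; rewrite argE.
rewrite netE E' in N'; rewrite E' in M'.
exact: represents_negligible0 rc M' N'.
Qed.

Lemma curve_derive h e x (t s : R) :
  is_derive s 1 (fun r => curve h e (xts x t r)) (- A h e (tx s (\row_k curve k e (xts x t s)))).
Proof.
under eq_fun do rewrite curve_xts.
have := is_derive_shift_arg (- t) (HY h e (tx t x)).2 s.
under [X in is_derive _ _ X]eq_fun do rewrite addrC.
have := flow_point_curve e (xts x t s); rewrite xts_s xts_base xts_t => ->.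
by rewrite [- t + s]addrC.
Qed.

Lemma curve_characteristic : characteristic_curve a1 curve_class.
Proof.
have [_ Aa _ _ _] := HD.
move=> h; split.
  have [c rc ac] := along_curve_exists (Aa h); exists c => //.
  apply: (represents_inj (represents_partial _ (curve_class_represents h))).
  have dc e p : differentiable (curve h e) p.
    have [_ _ [g _ Hg]] := curve_regular h 1%N.
    by have [] := locD1_derive Hg e p.
  have -> : npartial (rshift n ord_max) (real_embed (curve h)) =
      - (fun e p => real_embed (A h) e (tx (s_coord p) (\row_k curve k e p))).
    apply: net_eq => e p.
      have H1 := derive_last (lsubmx p) (t_coord p) (s_coord p) (dc e).
      have H2 := curve_derive h e (lsubmx p) (t_coord p) (s_coord p).
      rewrite xts_split in H1 H2.
      exact: (etrans (esym (@derive_val _ _ _ _ _ _ _ H1)) (@derive_val _ _ _ _ _ _ _ H2)).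
    by rewrite [LHS](derive_cst (0 : R)) [RHS]oppr0.
  exact: representsN.
apply: (represents_inj (represents_pull diagonal_slice (curve_class_represents h))).
have -> : npull diagonal_slice (real_embed (curve h)) =
    fun _ (p : 'rV[R]_(1 + n)) => ((p 0 (space_idx h))%:C)%C.
  apply: net_eq => e p //; rewrite [LHS]/(curve h e (diagonal_slice p)).
  by rewrite /diagonal_slice xts_base xts_s xts_t subrr (HY h e _).1 tx_space mxE.
exact: represents_gclass.
Qed.

(** Representatives of a second characteristic curve satisfy the differential equation, and the
    initial condition on the diagonal s = t, up to negligible errors. Gronwall's inequality from the
    diagonal, with the logarithmic Lipschitz constant of the field, bounds their distance from
    [curve]. *)
Lemma characteristic_unique gamma : characteristic_curve a1 gamma -> curve_class = gamma.
Proof.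
move=> Hg; have [_ Aa _ _ _] := HD.
have [g Hrep] : {g : 'I_n -> net R (n + 2) & forall h, represents (g h) (gamma h) /\ real_net (g h)}.
  apply: (choice (P := fun h (g : net R (n + 2)) => represents g (gamma h) /\ real_net g)) => h.
  by have [[c [rv _] _] _] := Hg h; have [u ug ru] := rv h; exists u.
have dg h e p : differentiable (re_net (g h) e) p.
  by have [] := represents_diff (Hrep h).1 e p.
pose Fld h e p := A h e (tx (s_coord p) (\row_k re_net (g k) e p)).
have Nde h : rapid (fun e p => 'D_(delta_mx 0 (rshift n ord_max)) (re_net (g h) e) p + Fld h e p).
  have [[c [_ ac] gc] _] := Hg h.
  have r1 := represents_partial (rshift n ord_max) (Hrep h).1; rewrite gc in r1.
  have := represents_sub_negligible0 r1 (representsN (ac _ _ (Aa h) Hrep)).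
  move=> /rapid_negligible0 [+ _]; rewrite re_netB; apply: rapid_eq => e p.
  by rewrite -[Fld h e p]opprK.
have Ndi h : rapid (fun e (p : 'rV[R]_(1 + n)) =>
    re_net (g h) e (diagonal_slice p) - p 0 (space_idx h)).
  have [_ gd] := Hg h.
  have := represents_sub_negligible0 (represents_pull diagonal_slice (Hrep h).1).
  move=> /(_ (fun _ (p : 'rV[R]_(1 + n)) => ((p 0 (space_idx h))%:C)%C)); rewrite gd.
  by move=> /(_ (represents_gclass _)) /rapid_negligible0 [+ _]; rewrite re_netB.
suff Hf h : rapid (fun e p => re_net (g h) e p - curve h e p).
  apply/funext => h; apply: (represents_eq (curve_class_represents h) (Hrep h).1).
  apply/rapid_negligible0; rewrite re_netB im_netB; split; first exact: Hf.
  by apply: (rapid_eq _ (@rapid0 R _)) => e p; rewrite im_real_embed /im_net (Hrep h).2 subrr.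
apply: rapid_of_bound => r.
(* For |s|, |t| <= |r| the elapsed time s - t is at most 2|r|; started from t, the field is then
   needed at times up to 3|r|. *)
have [_ _ _ lA] := HT; have [L BL HL] := lA (`|r| + (`|r| + `|r|)).
exists (fun e => expR ((2 * n%:R * L e + 1) * (`|r| + `|r|))).
  by apply: exp_bounds_gronwall => //; exact: addr_ge0.
move=> q.
have [c [eta [c0 eta0 Hc]]] := rapid_uniform (`|r| + (`|r| + `|r|)) q Nde.
have [c' [eta' [c'0 eta'0 Hc']]] := rapid_uniform `|r| q Ndi.
exists (n%:R * (c' + c)), (Num.min eta eta').
split; [by rewrite mulr_ge0 // addr_ge0|by rewrite lt_min eta0|].
move=> e; rewrite lt_min => /andP[e1 e2] p pr.
have pr' : `|p| <= `|r| by rewrite (le_trans pr) // ler_norm.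
have eq0 : 0 <= sval e ^+ q by rewrite exprn_ge0 // ltW // eps_gt0.
pose x := lsubmx p; pose t := t_coord p.
have tr : `|t| <= `|r| by exact: le_trans (coord_le_norm _ _) pr'.
have xr : `|x| <= `|r|.
  rewrite (le_trans _ pr') //; apply: row_norm_le => // i.
  by rewrite mxE coord_le_norm.
have D1 k (s : R) : is_derive s 1
    (fun s => re_net (g k) e (xts x t (t + s)) - curve k e (xts x t (t + s)))
    ('D_(delta_mx 0 (rshift n ord_max)) (re_net (g k) e) (xts x t (t + s)) -
      - A k e (tx (t + s) (\row_i curve i e (xts x t (t + s))))).
  apply: is_derive_sub.
    apply: (is_derive_shift_arg t (f := fun r => re_net (g k) e (xts x t r))
      (df := fun r => 'D_(delta_mx 0 (rshift n ord_max)) (re_net (g k) e) (xts x t r))) => z.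
    exact: derive_last.
  exact: (is_derive_shift_arg t (curve_derive k e x t)).
have D2 k (s : R) : `|s| <= `|r| + `|r| ->
    `|'D_(delta_mx 0 (rshift n ord_max)) (re_net (g k) e) (xts x t (t + s)) -
      - A k e (tx (t + s) (\row_i curve i e (xts x t (t + s))))| <=
    L e * (\sum_i `|re_net (g i) e (xts x t (t + s)) - curve i e (xts x t (t + s))|) +
    c * sval e ^+ q.
  move=> sr.
  have tsr : `|t + s| <= `|r| + (`|r| + `|r|) by rewrite (le_trans (ler_normD _ _)) // lerD.
  have r3 : `|r| <= `|r| + (`|r| + `|r|) by rewrite lerDl addr_ge0.
  have := Hc k e e1 (xts x t (t + s)).
  rewrite /Fld xts_s => /(_ (norm_xts_le (le_trans xr r3) (le_trans tr r3) tsr)) H1.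
  have H2 := HL e (t + s) (\row_i curve i e (xts x t (t + s)))
    (\row_i re_net (g i) e (xts x t (t + s))) k tsr.
  set a := A k e (tx (t + s) (\row_i re_net (g i) e _)) in H1 H2.
  set b := A k e _ in H2 *; set X := 'D_ _ _ _ in H1 *.
  have -> : X - - b = (X + a) - (a - b) by ring.
  rewrite (le_trans (ler_normB _ _)) // addrC lerD // (le_trans H2) //.
  by rewrite ler_wpM2l ?BL.1 // ler_sum // => i _; rewrite !mxE.
have D3 k : `|re_net (g k) e (xts x t (t + 0)) - curve k e (xts x t (t + 0))| <= c' * sval e ^+ q.
  have := Hc' k e e2 (base_point p) (le_trans (base_point_norm p) pr').
  rewrite addr0 curve_xts subrr (HY k e _).1 tx_space /diagonal_slice /base_point.
  by rewrite tx_time rsubmx_tx.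
have := gronwall (BL.1 e) (mulr_ge0 c0 eq0) (mulr_ge0 c'0 eq0) D1 D2 D3 h.
have str : `|s_coord p - t| <= `|r| + `|r|.
  rewrite (le_trans (ler_normB _ _)) // lerD // (le_trans (coord_le_norm _ _)) //.
move=> /(_ _ str); rewrite [t + _]addrC subrK xts_split -mulrDl.
by rewrite [n%:R * (_ * _)]mulrA.
Qed.

(** The integral is regular in (t,x) since it is a primitive with (t,x) as parameter, evaluated at s
    = t. Its distance from the phase is an integral of a negligible net between 0 and t. *)
Lemma time_integral_rapid (f : eps_index R -> 'rV[R]_(n + 2) -> R)
    (f0 : eps_index R -> 'rV[R]_(1 + n) -> R) w :
  regularoo modB f -> flow_primitive Y f0 w ->
  rapid (fun e p => f e p - f0 e (tx (s_coord p) (\row_h curve h e p))) ->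
  let If : eps_index R -> 'rV[R]_(1 + n) -> R := fun e q =>
    oriented_integral 0 (q 0 time_idx) (fun s => f e (xts (rsubmx q) (q 0 time_idx) s)) in
  regularoo modB If /\ rapid (fun e q => If e q - phase w e q).
Proof.
move=> rf fw ff0 If.
pose F : eps_index R -> 'rV[R]_(1 + n + 1) -> R := fun e (p : 'rV[R]_(1 + n + 1)) =>
  f e (xts (rsubmx (space_part p)) (space_part p 0 time_idx) (time_part p)).
have rF : regularoo modB F.
  move=> k; apply: regular_comp_param (rf k) => c l.
  rewrite /xts -(splitK c); case: (fintype.split c) => a /=.
    by under eq_fun do under eq_fun do rewrite row_mxEl !mxE; exact: regular_coord.
  under eq_fun do under eq_fun do rewrite row_mxEr mxE; case: (a == ord0).
    by under eq_fun do under eq_fun do rewrite mxE; exact: regular_coord.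
  exact: regular_coord.
have [W [W0 dW rW]] := primitive_exists rF.
have dW' e q (s : R) : is_derive s 1 (W e q) (f e (xts (rsubmx q) (q 0 time_idx) s)).
  by apply: is_derive_val (dW e q s) _; rewrite /F space_joint time_joint.
have IfE e q : If e q = W e q (q 0 time_idx).
  rewrite /If (oriented_integralE _ _ (dW' e q)) ?W0 ?subr0 //.
  rewrite (_ : (fun s => _) = fun s => F e (joint q s)).
    exact: regular_continuous_time (rF 0%N).
  by apply/funext => s; rewrite /F space_joint time_joint.
split.
  move=> k; have := @regular_comp_param R modB (1 + n) (1 + n + 1) k (uncurry_time W)
    (fun q => joint q (q 0 time_idx)) _ (rW k).
  have -> : (fun e q => uncurry_time W e (joint q (q 0 time_idx))) = If.
    by apply/funext => e; apply/funext => q; rewrite uncurry_joint IfE.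
  apply=> c l; rewrite /joint -(splitK c); case: (fintype.split c) => a /=.
    by under eq_fun do under eq_fun do rewrite row_mxEl; exact: regular_coord.
  by under eq_fun do under eq_fun do rewrite row_mxEr mxE; exact: regular_coord.
move=> r q; have [c [eta [eta0 Hc]]] := ff0 `|r| q.
exists (`|c| * `|r|), eta; split=> // e ee p pr.
have pr' : `|p| <= `|r| by rewrite (le_trans pr) // ler_norm.
have eq0 : 0 <= sval e ^+ q by rewrite exprn_ge0 // ltW // eps_gt0.
pose t := p 0 time_idx.
have tr : `|t| <= `|r| by exact: le_trans (coord_le_norm _ _) pr'.
(* The function [W e p s - w e p (- t + s)] equals the integral at s = t and the phase at s = 0, so
   its mean value estimate compares the two. *)
have Dh (s : R) : is_derive s 1 (fun s => W e p s - w e p (- t + s))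
    (f e (xts (rsubmx p) t s) - f0 e (flow_point Y e p (- t + s))).
  by apply: is_derive_sub; exact: (is_derive_shift_arg _ (fw e p).2).
have Hh (s : R) : `|s| <= `|r| -> `|f e (xts (rsubmx p) t s) -
    f0 e (flow_point Y e p (- t + s))| <= `|c| * sval e ^+ q.
  move=> sr; have := Hc e ee (xts (rsubmx p) t s).
  rewrite flow_point_curve xts_base xts_s xts_t tx_split addrC [s - t]addrC.
  move=> /(_ (norm_xts_le (le_trans (rsubmx_norm p) pr') tr sr)) H.
  by rewrite addrC (le_trans H) // ler_wpM2r // ler_norm.
have := mvt_norm Dh Hh (x := 0) (y := t); rewrite normr0 => /(_ (normr_ge0 _) tr).
rewrite IfE /phase addNr (fw e p).1 W0 addr0 !subr0 sub0r !opprK => /le_trans; apply.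
by rewrite [leLHS]mulrAC ler_wpM2r // ler_wpM2l.
Qed.

End Characteristics.

Section Conclusion.
Context {R : realType} {n : nat}.
Variables (a1 : 'I_n -> colombeau R (1 + n)) (a0 : colombeau R (1 + n)).
Variables (rho : R) (A : 'I_n -> eps_index R -> 'rV[R]_(1 + n) -> R) (v : net R (1 + n)).

Lemma regular_solution_exists (B : bound_class R) : (forall C, B C -> modB C) ->
  transport_data B a1 a0 rho A v ->
  exists2 b, cauchy_solution a1 a0 b & exists2 u, represents u b & cregular B u.
Proof.
move=> BM HD; have [T _ _ [vr vi] _] := HD; have [Y HY] := flow_exists T.
have [wr Hwr Rwr] := flow_primitive_exists T HY vr.
have [wi Hwi Rwi] := flow_primitive_exists T HY vi.
have [b rb sb] := exp_phase_solution BM HD HY Hwr Hwi Rwr Rwi.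
exists b => //; exists (cexpi (phase_net wr wi)) => //.
exact: (exp_phase_regular HD HY).
Qed.

Lemma solution_formula b : transport_data modB a1 a0 rho A v -> cauchy_solution a1 a0 b ->
  exists gamma : 'I_n -> colombeau R (n + 2),
    unique (characteristic_curve a1) gamma /\
    exists (c : colombeau R (n + 2)) (beta : colombeau R (1 + n)),
      along_curve gamma a0 c /\ is_time_integral c beta /\ is_exp_i beta b.
Proof.
move=> HD sb; have [T _ va [vr vi] _] := HD; have [Y HY] := flow_exists T.
have [wr Hwr Rwr] := flow_primitive_exists T HY vr.
have [wi Hwi Rwi] := flow_primitive_exists T HY vi.
exists (curve_class HD HY); split.
  by split=> [|gamma]; [exact: curve_characteristic|exact: characteristic_unique].
have rphase := phase_net_regular (n := n) Rwr Rwi.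
have rbeta := represents_gclass ((moderate_cregular _).2 rphase).
set beta := gclass _ in rbeta.
have [c rc ac] := along_curve_exists HD HY va.
exists c, beta; split=> //; split=> [C Cc|beta' rbeta'].
  have [Cr Ci] := (moderate_cregular _).1 (represents_moderate Cc).
  have /rapid_negligible0 [nr ni] := represents_sub_negligible0 Cc rc.
  rewrite re_netB in nr; rewrite im_netB in ni.
  have [Mr Nr] := time_integral_rapid Cr Hwr nr.
  have [Mi Ni] := time_integral_rapid Ci Hwi ni.
  apply: (represents_negligible0 rbeta); first by apply/moderate_cregular.
  by apply/rapid_negligible0; rewrite re_netB im_netB.
(* By uniqueness the given [b] is the constructed solution; another representative of beta changes
   exp(i beta) only by a negligible net. *)
have [b' rb' sb'] := exp_phase_solution (fun _ => id) HD HY Hwr Hwi Rwr Rwi.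
rewrite (cauchy_solution_unique HD sb sb').
have [M N] := cexpi_perturb rphase
  ((moderate_cregular _).1 (represents_moderate rbeta'))
  (phase_net_log HD HY wr Hwi)
  (represents_sub_negligible0 rbeta' rbeta).
exact: represents_negligible0 rb' M N.
Qed.

End Conclusion.

Local Close Scope ring_scope.
Local Close Scope classical_set_scope.

Theorem theorem2p5 (R : realType) (n : nat) (n_gt0 : (0 < n)%N)
    (a1 : 'I_n -> colombeau R (1 + n)) (a0 : colombeau R (1 + n)) :
  (log_type_coefficients a1 a0 ->
    exists! b : colombeau R (1 + n), cauchy_solution a1 a0 b)
  /\
  (slow_scale_coefficients a1 a0 ->
    forall b : colombeau R (1 + n), cauchy_solution a1 a0 b ->
      slow_scale_regular b)
  /\
  (log_type_coefficients a1 a0 ->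
    forall b : colombeau R (1 + n), cauchy_solution a1 a0 b ->
      exists gamma : 'I_n -> colombeau R (n + 2),
        unique (characteristic_curve a1) gamma /\
        exists (c : colombeau R (n + 2)) (beta : colombeau R (1 + n)),
          along_curve gamma a0 c /\
          is_time_integral c beta /\
          is_exp_i beta b).
Proof.
split; [|split].
- move=> /moderate_transport_data [rho [A [v HD]]].
  have [b sb _] := regular_solution_exists (fun _ => id) HD.
  by exists b; split=> [//|b' sb']; exact: (cauchy_solution_unique HD sb sb').
- move=> /slow_transport_data [rho [A [v HD]]] b sb.
  (* A solution is built with slow scale bounds; slow scale data are also moderate data, so
     uniqueness identifies it with [b]. *)
  have [b' sb' [u ub ru]] := regular_solution_exists (@slow_moderate R) HD.
  rewrite (cauchy_solution_unique (transport_data_slow_moderate HD) sb sb').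
  by exists u => // K s cK; exact: slow_cregular.
- move=> /moderate_transport_data [rho [A [v HD]]] b sb.
  exact: solution_formula HD sb.
Qed.
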